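(* Let $\mu,\nu\in\mathscr{P}_2(\mathbb{R}^d)$ be two probability measures permitting unnormalized Lebesgue densities $p$ and $q$, respectively, such that $p(x)=0\implies q(x)=0$. Let $T$ be a Monge map from $\mu$ to $\nu$, i.e. a minimizer of $$\inf_{T:\,T_\#\mu=\nu}\int|x-T(x)|^2\,\mu(dx).$$ Let $X^1,X^2,\dots$ be independent random variables with $X^i\sim\mu$ for all $i$, and define the empirical measures $$\mu^n:=\frac1n\sum_{i=1}^n\delta_{X^i},\qquad \nu^n:=\sum_{i=1}^nw_i^n\delta_{X^i},\qquad w_i:=\frac{q(X^i)}{p(X^i)},\qquad w_i^n:=\frac{w_i}{\sum_{j=1}^nw_j}.$$ Let $\gamma^n$ be an optimal $\mathcal{W}_2$-transport plan of $\mu^n,\nu^n$, $$\int_{\mathbb{R}^d\times\mathbb{R}^d}|x-y|^2\,\gamma^n(dx,dy)=\inf_{\gamma\in\Gamma(\mu^n,\nu^n)}\int_{\mathbb{R}^d\times\mathbb{R}^d}|x-y|^2\,\gamma(dx,dy),$$ and let $T^n(x)=\int y\,\gamma^n(x,dy)$ be the barycentric projection of $\gamma^n$. Then, as $n\to\infty$, almost surely $$T^n_\#\mu^n\to T_\#\mu=\nu\quad\text{weakly}$$ and $$\limsup_n\|T^n\|_{L^2(\mu^n)}\le\|T\|_{L^2(\mu)}.$$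
   Context: $\mathscr{P}_2(\mathbb{R}^d)$ is the set of Borel probability measures on $\mathbb{R}^d$ with finite second moment. $\Gamma(\mu,\nu)$ is the set of couplings, i.e. probability measures on $\mathbb{R}^d\times\mathbb{R}^d$ with marginals $\mu$ and $\nu$. An unnormalized Lebesgue density of $\mu$ is a function $p\ge0$ with $\mu(dx)=a\,p(x)\,dx$ for some constant $a>0$. $\gamma^n(x,dy)$ denotes the conditional distribution of $Y$ given $X=x$ when $(X,Y)\sim\gamma^n$, so $T^n(x)=\mathbb{E}_{(X,Y)\sim\gamma^n}[Y\mid X=x]$ (defined $\mu^n$-a.e.). $T_\#\mu$ is the push-forward measure, and $\|f\|_{L^2(\mu)}=(\int|f|^2\,d\mu)^{1/2}$. Weak convergence is convergence of integrals of bounded continuous functions. *)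

(* Defs.v *)
From HB Require Import structures.
From mathcomp Require Import all_boot all_order all_algebra finmap.
From mathcomp Require Import all_classical all_reals all_analysis.

Set Implicit Arguments.
Unset Strict Implicit.
Unset Printing Implicit Defensive.

Import Order.TTheory GRing.Theory Num.Theory.
Import numFieldNormedType.Exports.

Local Open Scope classical_set_scope.
Local Open Scope ring_scope.

Section borel_matrix.
Context (R : realType) (m n : nat).

Let opens : set (set 'M[R]_(m, n)) := open.

HB.instance Definition _ := @isMeasurable.Build (sigma_display opens)
  'M[R]_(m, n) <<s opens >> (@sigma_algebra0 _ setT opens)
  (@sigma_algebraC _ opens) (@sigma_algebra_bigcup _ setT opens).

End borel_matrix.

Lemma mx_open_measurable (R : realType) (m n : nat) (U : set 'M[R]_(m, n)) :
  open U -> measurable U.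
Proof. by move=> oU; apply: sub_sigma_algebra. Qed.

Lemma measurable_coord (R : realType) (m n : nat) i j :
  measurable_fun setT (fun M : 'M[R]_(m, n) => M i j).
Proof.
apply: (measurability _ (measurable_realfun.RGenOpens.measurableE R)).
move=> _ [_ [a [b ->] <-]]; rewrite setTI.
apply: mx_open_measurable; apply: open_comp; last exact: interval_open.
by move=> M _; exact: coord_continuous.
Qed.

Section measurable_to_matrix.
Context (R : realType) (m n : nat).

Definition rat_box (c : 'M[rat]_(m, n) * nat) : set 'M[R]_(m, n) :=
  [set M | forall i j, ball (ratr (c.1 i j) : R) (c.2.+1%:R^-1) (M i j)].

Lemma open_bigcup_rat_box (U : set 'M[R]_(m, n)) : open U ->
  U = \bigcup_(c in [set c | rat_box c `<=` U]) rat_box c.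
Proof.
move=> oU; apply/seteqP; split=> [M UM|M [c cU]]; last exact: cU.
have /nbhs_ballP[e /= e0 eU] : nbhs M U by rewrite nbhsE; exists U.
have [k ke] : exists k : nat, k.+1%:R^-1 < e / 2.
  have e20 : 0 < (e / 2)^-1 by rewrite invr_gt0 divr_gt0.
  exists (Num.truncn (e / 2)^-1); rewrite invf_plt ?posrE ?divr_gt0//.
  exact: truncnS_gt.
have k0 : 0 < k.+1%:R^-1 :> R by rewrite invr_gt0.
have hq i j : {q : rat | ball (M i j) (k.+1%:R^-1) (ratr q : R)}.
  have : M i j - k.+1%:R^-1 < M i j + k.+1%:R^-1.
    by rewrite ltrBlDr -addrA ltrDl addr_gt0.
  move=> /rat_in_itvoo/cid[q]; rewrite in_itv/= -ltr_distlC => Mq.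
  by exists q; rewrite /ball/=.
pose c := (\matrix_(i, j) sval (hq i j), k).
exists c.
- move=> N cN; apply: eU; split => // i j.
  have h1 := svalP (hq i j); have := cN i j; rewrite /= mxE => h2.
  have := ball_triangle h1 h2; apply: le_ball.
  by rewrite [leRHS](splitr e) lerD ?ltW.
- by move=> i j; rewrite /= mxE; apply: ball_sym; exact: (svalP (hq i j)).
Qed.

Lemma measurable_fun_mx d (S : measurableType d) (f : S -> 'M[R]_(m, n)) :
  (forall i j, measurable_fun setT (fun x => f x i j)) ->
  measurable_fun setT f.
Proof.
move=> mf; apply: (measurability (open : set (set 'M[R]_(m, n)))) => //.
move=> _ [U oU <-]; rewrite setTI (open_bigcup_rat_box oU) preimage_bigcup.
rewrite bigcup_mkcond; apply: countable_bigcupT_measurable => // c.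
case: ifPn => // _.
rewrite (_ : _ @^-1` _ = \bigcap_(i in setT) \bigcap_(j in setT)
    (fun x => f x i j) @^-1` ball (ratr (c.1 i j) : R) (c.2.+1%:R^-1)).
  apply: fin_bigcap_measurable; first exact: finite_finset.
  move=> i _; apply: fin_bigcap_measurable; first exact: finite_finset.
  move=> j _.
  by rewrite -[X in measurable X]setTI; apply: mf => //; rewrite ball_itv; exact: measurable_itv.
by apply/seteqP; split=> x /= h => [i _ j _|i j]; [exact: h|exact: h].
Qed.

End measurable_to_matrix.

Section lebesgue_rV_step.
Context (R : realType) (d : nat) (m : {sigma_finite_measure set 'rV[R]_d -> \bar R}).

Definition cons_rV (z : measurableTypeR R * 'rV[R]_d) : 'rV[R]_d.+1 :=
  \row_j oapp (z.2 0) z.1 (unlift 0 j).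

Definition uncons_rV (v : 'rV[R]_d.+1) : measurableTypeR R * 'rV[R]_d :=
  (v 0 0, \row_j v 0 (lift 0 j)).

Lemma measurable_cons_rV : measurable_fun setT cons_rV.
Proof.
apply: measurable_fun_mx => i j; under eq_fun do rewrite mxE.
case: (unliftP 0 j) => [k _|_] /=; last exact: measurable_fst.
apply: (@measurableT_comp _ _ _ _ _ _ (fun v : 'rV[R]_d => v 0 k)).
  exact: measurable_coord.
exact: measurable_snd.
Qed.

Lemma measurable_uncons_rV : measurable_fun setT uncons_rV.
Proof.
apply: measurable_fun_pair; first exact: measurable_coord.
apply: measurable_fun_mx => i j.
under eq_fun do rewrite mxE.
exact: measurable_coord.
Qed.

Lemma cons_rVK : cancel cons_rV uncons_rV.
Proof.
move=> [x v]; rewrite /uncons_rV /cons_rV mxE unlift_none /=; congr (_, _).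
by apply/rowP => j; rewrite !mxE liftK.
Qed.

Definition lebesgue_rV_step : set 'rV[R]_d.+1 -> \bar R :=
  pushforward (@lebesgue_measure R \x m)%E cons_rV.

Let step0 : lebesgue_rV_step set0 = 0%E.
Proof. by rewrite /lebesgue_rV_step /pushforward preimage_set0 measure0. Qed.

Let step_ge0 A : (0 <= lebesgue_rV_step A)%E.
Proof. by rewrite /lebesgue_rV_step /pushforward; apply: measure_ge0. Qed.

Let step_sigma_additive : semi_sigma_additive lebesgue_rV_step.
Proof.
move=> F mF tF mUF; have mf := measurable_cons_rV.
rewrite /lebesgue_rV_step /pushforward preimage_bigcup.
apply: measure_semi_sigma_additive.
- by move=> n; rewrite -[X in measurable X]setTI; exact: mf.
- apply/trivIsetP => /= i j _ _ ij; rewrite -preimage_setI.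
  by move/trivIsetP : tF => /(_ _ _ _ _ ij) ->//; rewrite preimage_set0.
- by rewrite -preimage_bigcup -[X in measurable X]setTI; exact: mf.
Qed.

HB.instance Definition _ := isMeasure.Build _ _ _ lebesgue_rV_step
  step0 step_ge0 step_sigma_additive.

Let step_sigma_finite : sigma_finite setT lebesgue_rV_step.
Proof.
have /sigma_finiteP[F [TF ndF Foo]] := sigma_finiteT (@lebesgue_measure R).
have /sigma_finiteP[G [TG ndG Goo]] := sigma_finiteT m.
exists (fun n => uncons_rV @^-1` (F n `*` G n)).
  rewrite -preimage_bigcup; apply/esym/seteqP; split=> // v _.
  have [k _ Fk] : (\bigcup_n F n) (uncons_rV v).1 by rewrite -TF.
  have [l _ Gl] : (\bigcup_n G n) (uncons_rV v).2 by rewrite -TG.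
  exists (maxn k l) => //; split.
    by move: Fk; apply/subsetPset/ndF/leq_maxl.
  by move: Gl; apply/subsetPset/ndG/leq_maxr.
move=> k; have [mF Fk] := Foo k; have [mG Gk] := Goo k; split.
  rewrite -[X in measurable X]setTI.
  by apply: measurable_uncons_rV => //; exact: measurableX.
rewrite /lebesgue_rV_step /pushforward -comp_preimage.
rewrite (_ : uncons_rV \o cons_rV = id); last by apply/funext; exact: cons_rVK.
by rewrite preimage_id product_measure1E// lte_mul_pinfty// ge0_fin_numE.
Qed.

HB.instance Definition _ := Measure_isSigmaFinite.Build _ _ _ lebesgue_rV_step
  step_sigma_finite.

End lebesgue_rV_step.

(* Lebesgue measure on R^d: the d-fold product of the Lebesgue measure on R,
   carried along R * R^d = R^(d.+1). *)
Fixpoint lebesgue_rV (R : realType) (d : nat) :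
    {sigma_finite_measure set 'rV[R]_d -> \bar R} :=
  if d is d'.+1 then lebesgue_rV_step (lebesgue_rV R d')
  else dirac (0 : 'rV[R]_0).

Section euclidean_measures.
Context (R : realType) (d : nat).
Local Notation E := 'rV[R]_d.
Implicit Types (mu nu : set E -> \bar R) (x y : E) (T : E -> E).

(* The norm `| x | of the library on matrices is the sup norm. *)
Definition enorm x : R := Num.sqrt (\sum_j x 0 j ^+ 2).

Definition finite_second_moment mu : Prop :=
  (\int[mu]_x (enorm x ^+ 2)%:E < +oo)%E.

Definition unnormalized_density mu (p : E -> R) : Prop :=
  [/\ measurable_fun setT p, (forall x, 0 <= p x) &
   exists2 a : R, 0 < a & forall A, measurable A ->
     mu A = (\int[lebesgue_rV R d]_(x in A) (a * p x)%:E)%E].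

Definition transport_map mu nu T : Prop :=
  measurable_fun setT T /\ forall A, measurable A -> pushforward mu T A = nu A.

Definition monge_cost mu T : \bar R :=
  (\int[mu]_x (enorm (x - T x) ^+ 2)%:E)%E.

Definition monge_map mu nu T : Prop :=
  transport_map mu nu T /\
  monge_cost mu T = ereal_inf [set monge_cost mu S | S in transport_map mu nu].

Definition couplings mu nu : set (probability (E * E)%type R) :=
  [set g | (forall A, measurable A -> g (A `*` setT) = mu A) /\
           (forall B, measurable B -> g (setT `*` B) = nu B)].

Definition kantorovich_cost (g : set (E * E) -> \bar R) : \bar R :=
  (\int[g]_z (enorm (z.1 - z.2) ^+ 2)%:E)%E.

Definition optimal_plan mu nu (g : probability (E * E)%type R) : Prop :=
  couplings mu nu g /\
  kantorovich_cost g = ereal_inf [set kantorovich_cost h | h in couplings mu nu].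

(* The kernel k is a version of x |-> Law(Y | X = x) for (X, Y) ~ g; it is
   determined only almost everywhere for the first marginal of g. *)
Definition conditional_distribution (g : probability (E * E)%type R)
    (k : R.-pker E ~> E) : Prop :=
  forall A B, measurable A -> measurable B ->
    g (A `*` B) = (\int[pushforward g fst]_(x in A) k x B)%E.

Definition barycentric_projection (k : R.-pker E ~> E) : E -> E :=
  fun x => \row_j \int[k x]_y y 0 j.

Definition empirical_measure (x : nat -> E) (n : nat) :
    {measure set E -> \bar R} :=
  mscale (n%:R^-1)%:nng (msum (fun i => \d_(x i)) n).

(* When the weights sum to 0, x / 0 = 0 makes this the zero set function, which
   has no coupling with a probability measure. *)
Definition weighted_empirical_measure (w : nat -> R) (x : nat -> E) (n : nat) :
    set E -> \bar R :=
  fun A => (\sum_(i < n) (w i / \sum_(j < n) w j)%:E * \d_(x i) A)%E.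

Definition weakly_cvg (mu_ : nat -> set E -> \bar R) mu : Prop :=
  forall f : E -> R, continuous f -> (exists M, forall x, `|f x| <= M) ->
    (\int[mu_ n]_x (f x)%:E @[n --> \oo] --> \int[mu]_x (f x)%:E)%E.

End euclidean_measures.

Definition mutually_independent (dO dE : measure_display)
    (Omega : measurableType dO) (E : measurableType dE) (R : realType)
    (P : probability Omega R) (I : choiceType) (X : I -> {RV P >-> E}) : Prop :=
  forall (J : {fset I}) (A : I -> set E), (forall i, measurable (A i)) ->
    P (\bigcap_(i in [set` J]) X i @^-1` A i) =
    (\prod_(i <- J) P (X i @^-1` A i))%E.

(* Main.v *)
Require Import Defs.
From HB Require Import structures.
From mathcomp Require Import finmap.
From mathcomp Require Import all_boot all_order all_algebra.
From mathcomp Require Import all_classical all_reals all_analysis.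
From mathcomp Require Import measurable_realfun.
From mathcomp Require Import ring lra.

Set Implicit Arguments.
Unset Strict Implicit.
Unset Printing Implicit Defensive.

Import Order.TTheory GRing.Theory Num.Theory.
Import numFieldNormedType.Exports.

Local Open Scope classical_set_scope.
Local Open Scope ring_scope.
(** Why the theorem holds.

    Along almost every sample, the plans gamma^n converge, in the weak sense
    needed here, to the plan carried by the graph of T.  This convergence is
    obtained without compactness of sets of measures, from the supports alone.
    The support of an optimal plan between two finitely supported measures is
    cyclically monotone (transporting mass around a cycle of the support cannot
    lower the cost).  Along an ultrafilter these supports have a limit M, the set
    of points all of whose neighbourhoods are eventually met; M is closed and
    still cyclically monotone.  A cyclically monotone set is monotone, so the
    points x above which M has two values separated by a given gap in coordinate
    j meet each line parallel to the j-th axis at most once, and form a Lebesgue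
    null set.  Hence M is almost everywhere the graph of one map S.  A compact
    rectangle that avoids M carries no mass of gamma^n in the limit, and this
    forces S to send mu to nu.  Rockafellar's construction on M gives
    Kantorovich potentials; they certify that S is optimal and that every other
    optimal map takes its values in the contact set of the potentials, which is
    again single-valued almost everywhere.  Thus T = S, and
    gamma^n {T x outside C, y in C} tends to 0 for every closed rational box C
    ([plan_stability]).

    Together with the second moments this gives that the integral of |y - T x|
    under gamma^n tends to 0, and by Jensen's inequality the average of
    |T^n - T| over the sample tends to 0 ([barycenter_L1_cvg]).  As T sends the
    sample points to a sample of nu, the weak convergence follows
    ([barycenter_weakly_cvg]).  Jensen's inequality also bounds the second
    moment of T^n by that of nu^n, which converges to that of nu
    ([barycenter_limsup]).

    All that is asked of the sample is the convergence of countably many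
    averages: those of indicators of finite unions of rational boxes and of
    second moments, with and without the weights w = q / p.  The strong law of
    large numbers ([slln]) supplies them, because weighting by w turns mu into a
    multiple of nu ([integral_density_ratio]).  No moment of w beyond the first
    is at hand, so the strong law is needed for integrable variables; they are
    cut into a bounded part, treated by Chebyshev's inequality at the squares
    ([slln_bounded]), and a part of small mean, for which an upper bound obtained
    by truncation at powers of 2 is enough ([slln_tail]). *)

(** * Null sets of the Lebesgue measure *)

(** By Fubini: integrate first along the axis [j], where each section has at
    most one point.  The induction peels off the first coordinate; it is the
    inner variable of the product when [j] is that coordinate, the outer one
    otherwise. *)
Lemma lebesgue_rV_null (R : realType) (d : nat) (j : 'I_d)
    (A : set 'rV[R]_d) : measurable A ->
  (forall u v, A u -> A v -> (forall k, k != j -> u 0 k = v 0 k) ->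
    u 0 j = v 0 j) ->
  lebesgue_rV R d A = 0%E.
Proof.
elim: d j A => [[]//|d IH] j A mA lineA.
rewrite /= /lebesgue_rV_step /pushforward.
set B := (X in (_ \x _)%E X).
have mB : measurable B.
  by rewrite -[B]setTI; apply: measurable_cons_rV.
case: (unliftP 0 j) => [k jk|j0].
- rewrite /product_measure1; apply: integral0_eq => x _ /=.
  apply: (IH k); first exact: measurable_xsection.
  move=> u v /xsectionP/= Au /xsectionP/= Av uv.
  have /= := lineA _ _ Au Av; rewrite /cons_rV/= !mxE jk liftK/=; apply => l.
  rewrite !mxE; case: (unliftP 0 l) => [l' ->|->]/=; last by [].
  by rewrite (inj_eq lift_inj) => ?; exact: uv.
- rewrite (product_measure_unique (m' := (lebesgue_measure \x^ lebesgue_rV R d)%E))//; last first.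
    by move=> C D mC mD; exact: product_measure2E.
  rewrite /product_measure2; apply: integral0_eq => v _ /=.
  have [->|/set0P[x Bx]] := eqVneq (ysection B v) set0; first by rewrite measure0.
  suff -> : ysection B v = [set x] by rewrite lebesgue_measure_set1.
  move: Bx => /ysectionP/= Ax; apply/seteqP; split=> [y /ysectionP/= Ay|_ ->]; last exact/ysectionP.
  have /= := lineA _ _ Ay Ax; rewrite /cons_rV/= !mxE j0 unlift_none/=; apply => l.
  by rewrite !mxE; case: (unliftP 0 l) => [l' ->|->]//=; rewrite eqxx.
Qed.

(** * Integrals of nonnegative real-valued functions *)

Section real_integrals.
Context {d : measure_display} {T : measurableType d} {R : realType}.
Variable mu : {measure set T -> \bar R}.
Implicit Types f g : T -> R.

Lemma ge0_integral_EFinD f g :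
  measurable_fun setT f -> measurable_fun setT g ->
  (forall x, 0 <= f x) -> (forall x, 0 <= g x) ->
  (\int[mu]_x (f x + g x)%:E = \int[mu]_x (f x)%:E + \int[mu]_x (g x)%:E)%E.
Proof.
move=> mf mg f0 g0; under eq_integral do rewrite EFinD.
by rewrite ge0_integralD//; [move=> x _; rewrite lee_fin|exact/measurable_EFinP|
  move=> x _; rewrite lee_fin|exact/measurable_EFinP].
Qed.

Lemma ge0_integral_EFinZ (k : R) f :
  measurable_fun setT f -> (forall x, 0 <= f x) -> 0 <= k ->
  (\int[mu]_x (k * f x)%:E = k%:E * \int[mu]_x (f x)%:E)%E.
Proof.
move=> mf f0 k0; under eq_integral do rewrite EFinM.
by rewrite ge0_integralZl_EFin//; [move=> x _; rewrite lee_fin|exact/measurable_EFinP].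
Qed.

Lemma ge0_integral_EFinsum (I : Type) (s : seq I) (f : I -> T -> R) :
  (forall i, measurable_fun setT (f i)) -> (forall i x, 0 <= f i x) ->
  (\int[mu]_x (\sum_(i <- s) f i x)%:E = \sum_(i <- s) \int[mu]_x (f i x)%:E)%E.
Proof.
move=> mf f0; under eq_integral do rewrite -sumEFin.
by rewrite ge0_integral_sum//; [move=> i; exact/measurable_EFinP|move=> i x _; rewrite lee_fin].
Qed.

Lemma ge0_le_integral_EFin f g :
  measurable_fun setT f -> measurable_fun setT g ->
  (forall x, 0 <= f x) -> (forall x, f x <= g x) ->
  (\int[mu]_x (f x)%:E <= \int[mu]_x (g x)%:E)%E.
Proof.
move=> mf mg f0 fg; apply: ge0_le_integral => //.
- by move=> x _; rewrite lee_fin.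
- exact/measurable_EFinP.
- exact/measurable_EFinP.
- by move=> x _; rewrite lee_fin.
Qed.

Lemma markov_EFin f (t : R) : measurable_fun setT f -> (forall x, 0 <= f x) ->
  0 < t -> (t%:E * mu [set x | (t <= f x)%R] <= \int[mu]_x (f x)%:E)%E.
Proof.
move=> mf f0 t0; have mS : measurable [set x | (t <= f x)%R].
  have -> : [set x | t <= f x] = f @^-1` `[t, +oo[.
    by apply/seteqP; split=> x /=; rewrite in_itv/= andbT.
  by rewrite -[X in measurable X]setTI; apply: mf.
have -> : (mu [set x | (t <= f x)%R] = \int[mu]_x (\1_[set x | (t <= f x)%R] x)%:E)%E.
  by rewrite integral_indic// setIT.
rewrite -ge0_integral_EFinZ//; last exact: ltW.
apply: ge0_le_integral_EFin => //.
- by apply: measurable_funM => //.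
- by move=> x; rewrite mulr_ge0// ltW.
- move=> x; rewrite indicE; case: (boolP (x \in _)) => [/set_mem/=|_]; first by rewrite mulr1.
  by rewrite mulr0.
Qed.

End real_integrals.

Lemma nneseries_le_bound (R : realType) (u : nat -> \bar R) (B : \bar R) :
  (forall n, 0 <= u n)%E -> (forall N, \sum_(i < N) u i <= B)%E ->
  (\sum_(n <oo) u n <= B)%E.
Proof.
move=> u0 uB; apply: lime_le; first exact: is_cvg_nneseries.
by apply: nearW => N; rewrite big_mkord.
Qed.

Lemma borel_cantelli_ae (d : measure_display) (T : measurableType d)
    (R : realType) (mu : {measure set T -> \bar R}) (F : nat -> set T) :
  (forall k, measurable (F k)) -> (\sum_(n <oo) mu (F n) < +oo)%E ->
  {ae mu, forall x, \forall n \near \oo, ~ F n x}.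
Proof.
move=> mF sF; exists (lim_sup_set F); split.
- by apply: bigcapT_measurable => n; apply: bigcup_measurable.
- exact: lim_sup_set_cvg0.
- move=> x /= nx; apply: contrapT => nl; apply: nx.
  have [n nF] : exists n, ~ (\bigcup_(j >= n) F j) x.
    by apply/existsNP => H; apply: nl => n _; exact: H.
  by exists n => // m /= nm Fm; apply: nF; exists m.
Qed.

(** * The strong law of large numbers *)

Section pair_integral.
Context {dO dE : measure_display} {Omega : measurableType dO}
  {E : measurableType dE} {R : realType}.
Variables (P : probability Omega R) (X : nat -> {RV P >-> E}).
Variable mu : probability E R.
Hypothesis indep : mutually_independent X.
Hypothesis lawX : forall i A, measurable A -> distribution P (X i) A = mu A.

Lemma integral_law i (h : E -> R) : measurable_fun setT h ->
  (forall x, 0 <= h x) ->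
  (\int[P]_o (h (X i o))%:E = \int[mu]_x (h x)%:E)%E.
Proof.
move=> mh h0.
have -> : (\int[P]_o (h (X i o))%:E = \int[distribution P (X i)]_x (h x)%:E)%E.
  by rewrite ge0_integral_distribution//; exact/measurable_EFinP.
apply: eq_measure_integral => A mA _; exact: lawX.
Qed.

(** Independence makes the law of the pair the product measure, as the two agree on
    rectangles. *)
Lemma integral_pair i j (h : E -> R) : i != j -> measurable_fun setT h ->
  (forall x, 0 <= h x) ->
  (\int[P]_o (h (X i o) * h (X j o))%:E =
   \int[mu]_x (h x)%:E * \int[mu]_x (h x)%:E)%E.
Proof.
move=> ij mh h0.
pose Z (o : Omega) : E * E := (X i o, X j o).
have mZ : measurable_fun setT Z by apply: measurable_fun_pair.
pose HH (z : E * E) : \bar R := (h z.1 * h z.2)%:E.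
have mHH : measurable_fun setT HH.
  apply/measurable_EFinP; apply: measurable_funM.
  - exact: measurableT_comp mh measurable_fst.
  - exact: measurableT_comp mh measurable_snd.
have HH0 z : (0 <= HH z)%E by rewrite lee_fin mulr_ge0.
pose ZM : {mfun Omega >-> (E * E)%type} := HB.pack Z (isMeasurableFun.Build _ _ _ _ _ mZ).
have -> : (\int[P]_o (h (X i o) * h (X j o))%:E = \int[distribution P ZM]_z HH z)%E.
  by rewrite ge0_integral_distribution.
have -> : (\int[distribution P ZM]_z HH z = \int[mu \x mu]_z HH z)%E.
  apply: eq_measure_integral => A mA _; symmetry.
  apply: product_measure_unique => // B C mB mC.
  have := indep [fset i; j]%fset (A := fun k => if k == i then B else C).
  rewrite big_fsetU1/=; last by rewrite inE.
  rewrite big_seq_fset1 eqxx eq_sym (negbTE ij) => PBC.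
  rewrite -(lawX i mB) -(lawX j mC); apply: etrans (PBC _); last first.
    by move=> k; case: ifP.
  congr (P _); apply/seteqP; split=> o /=.
    move=> [Bo Co] k /=; rewrite !inE => /orP[] /eqP ->; first by rewrite eqxx.
    by rewrite eq_sym (negbTE ij).
  move=> H; split.
    by have := H i; rewrite /= !inE eqxx; exact.
  by have := H j; rewrite /= !inE eqxx orbT eq_sym (negbTE ij); exact.
rewrite fubini_tonelli1//= /fubini_F.
under eq_integral => x _.
  rewrite /HH/= ge0_integral_EFinZ//.
  over.
rewrite /= ge0_integralZr//; first exact/measurable_EFinP.
  by move=> x _; rewrite lee_fin.
by apply: integral_ge0 => x _; rewrite lee_fin.
Qed.

End pair_integral.

Section partial_sums.
Context {dO dE : measure_display} {Omega : measurableType dO}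
  {E : measurableType dE} {R : realType}.
Variables (P : probability Omega R) (X : nat -> {RV P >-> E}).
Variable mu : probability E R.
Hypothesis indep : mutually_independent X.
Hypothesis lawX : forall i A, measurable A -> distribution P (X i) A = mu A.

Definition psum (h : E -> R) (n : nat) (o : Omega) : R := \sum_(i < n) h (X i o).

Lemma measurable_psum h n : measurable_fun setT h ->
  measurable_fun setT (psum h n).
Proof.
move=> mh; apply: measurable_sum => i; exact: measurableT_comp mh _.
Qed.

Lemma psum_ge0 h n o : (forall x, 0 <= h x) -> 0 <= psum h n o.
Proof. by move=> h0; apply: sumr_ge0 => i _; exact: h0. Qed.

Lemma integral_psum (h : E -> R) n m : measurable_fun setT h -> (forall x, 0 <= h x) ->
  (\int[mu]_x (h x)%:E = m%:E)%E ->
  (\int[P]_o (psum h n o)%:E = (n%:R * m)%:E)%E.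
Proof.
move=> mh h0 hm; rewrite /psum.
rewrite (ge0_integral_EFinsum P (index_enum 'I_n) (f := fun i o => h (X i o)))//; last first.
  by move=> i; exact: measurableT_comp mh _.
under eq_bigr do rewrite (integral_law lawX)// hm.
by rewrite sumEFin sumr_const card_ord mulr_natl.
Qed.

(** The identity [E S_n^2 = n v + (n^2 - n) m^2], obtained by induction on [n] so
    that each step only expands one square. *)
Lemma integral_psum_sqr (h : E -> R) n m v : measurable_fun setT h ->
  (forall x, 0 <= h x) ->
  (\int[mu]_x (h x)%:E = m%:E)%E -> (\int[mu]_x (h x ^+ 2)%:E = v%:E)%E ->
  (\int[P]_o (psum h n o ^+ 2)%:E =
    (n%:R * v + (n%:R ^+ 2 - n%:R) * m ^+ 2)%:E)%E.
Proof.
move=> mh h0 hm hv.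
have mhX i : measurable_fun setT (fun o => h (X i o)) by exact: measurableT_comp mh _.
elim: n => [|n IH].
  under eq_integral do rewrite /psum big_ord0 expr0n/=.
  by rewrite integral0 !mul0r expr0n subrr mul0r addr0.
have -> : (\int[P]_o (psum h n.+1 o ^+ 2)%:E =
  \int[P]_o (psum h n o ^+ 2 +
    (2 * (\sum_(i < n) (h (X i o) * h (X n o))) + h (X n o) ^+ 2))%:E)%E.
  apply: eq_integral => o _; congr EFin; rewrite /psum big_ord_recr/= -mulr_suml; ring.
have mps : measurable_fun setT (psum h n) by exact: measurable_psum.
have ms : measurable_fun setT (fun o => \sum_(i < n) (h (X i o) * h (X n o))).
  by apply: measurable_sum => i; apply: measurable_funM.
have s0 o : 0 <= \sum_(i < n) (h (X i o) * h (X n o)).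
  by apply: sumr_ge0 => i _; rewrite mulr_ge0.
rewrite ge0_integral_EFinD; last 4 first.
- exact: measurable_funX.
- apply: measurable_funD; first exact: measurable_funM.
  exact: measurable_funX.
- by move=> o; rewrite sqr_ge0.
- by move=> o; rewrite addr_ge0 ?sqr_ge0// mulr_ge0.
rewrite IH ge0_integral_EFinD; last 4 first.
- exact: measurable_funM.
- exact: measurable_funX.
- by move=> o; rewrite mulr_ge0.
- by move=> o; rewrite sqr_ge0.
rewrite ge0_integral_EFinZ//.
rewrite (ge0_integral_EFinsum P (index_enum 'I_n) (f := fun i o => h (X i o) * h (X n o))); last 2 first.
- by move=> i; exact: measurable_funM.
- by move=> i o; rewrite mulr_ge0.
under eq_bigr => i _.
  rewrite (integral_pair indep lawX)//; last by rewrite neq_ltn ltn_ord.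
  rewrite hm; over.
rewrite (integral_law lawX n (h := fun x => h x ^+ 2)); last 2 first.
- exact: measurable_funX.
- by move=> o; rewrite sqr_ge0.
rewrite hv -EFinM sumEFin sumr_const card_ord -!EFinM -!EFinD; congr EFin.
rewrite -mulr_natl -(natr1 n); ring.
Qed.

Lemma chebyshev_psum (h : E -> R) n (m v t : R) : measurable_fun setT h ->
  (forall x, 0 <= h x) ->
  (\int[mu]_x (h x)%:E = m%:E)%E -> (\int[mu]_x (h x ^+ 2)%:E = v%:E)%E ->
  0 < t ->
  (P [set o | (t <= `|psum h n o - n%:R * m|)%R] <= (n%:R * v / t ^+ 2)%:E)%E.
Proof.
move=> mh h0 hm hv t0.
have m0 : 0 <= m by rewrite -lee_fin -hm integral_ge0// => x _; rewrite lee_fin.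
have mps : measurable_fun setT (psum h n) by exact: measurable_psum.
pose D o := (psum h n o - n%:R * m) ^+ 2.
have mD : measurable_fun setT D.
  by apply: measurable_funX; apply: measurable_funB.
have D0 o : 0 <= D o by exact: sqr_ge0.
have ID : (\int[P]_o (D o)%:E = (n%:R * (v - m ^+ 2))%:E)%E.
  (* the square is expanded with the cross term moved to the left, so that only
     nonnegative functions are integrated *)
  have : (\int[P]_o (D o + 2 * (n%:R * m) * psum h n o)%:E =
          \int[P]_o (psum h n o ^+ 2 + (n%:R * m) ^+ 2)%:E)%E.
    by apply: eq_integral => o _; congr EFin; rewrite /D; ring.
  have ps0 o : 0 <= psum h n o by exact: psum_ge0.
  rewrite ge0_integral_EFinD//; last 2 first.
  - exact: measurable_funM.
  - by move=> o; rewrite !mulr_ge0.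
  rewrite ge0_integral_EFinZ//; last by rewrite !mulr_ge0.
  rewrite (integral_psum _ mh h0 hm) ge0_integral_EFinD//; last 3 first.
  - exact: measurable_funX.
  - by move=> o; rewrite sqr_ge0.
  - by move=> o; rewrite sqr_ge0.
  rewrite (integral_psum_sqr _ mh h0 hm hv).
  have -> : (\int[P]_x ((n%:R * m) ^+ 2)%:E = ((n%:R * m) ^+ 2)%:E)%E.
    by have := integral_cst P measurableT ((n%:R * m) ^+ 2)%:E; rewrite /= probability_setT mule1.
  rewrite -EFinM -EFinD.
  move=> /(congr1 (fun y => y - (2 * (n%:R * m) * (n%:R * m))%:E)%E).
  rewrite addeK// => ->; rewrite -EFinB; congr EFin; ring.
have H : ((t ^+ 2)%:E * P [set o | (t ^+ 2 <= D o)%R] <= (n%:R * v)%:E)%E.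
  apply: le_trans (markov_EFin P mD D0 (exprn_gt0 2 t0)) _.
  by rewrite ID lee_fin ler_wpM2l// lerBlDr lerDl sqr_ge0.
rewrite [X in (_ <= X%:E)%E]mulrC EFinM lee_pdivlMl ?exprn_gt0//; apply: le_trans H.
rewrite le_eqVlt; apply/orP; left; apply/eqP; congr (_ * P _)%E.
have tD o : (t <= `|psum h n o - n%:R * m|) = (t ^+ 2 <= D o).
  rewrite -(@ler_pXn2r _ 2 _ t)//; last by rewrite nnegrE ltW.
  by rewrite /D /= real_normK// num_real.
by apply/seteqP; split=> o; rewrite /= tD.
Qed.

End partial_sums.

Lemma nat_sqrt_exists (n : nat) : exists k, (k ^ 2 <= n < k.+1 ^ 2)%N.
Proof.
elim: n => [|n [k /andP[k1 k2]]]; first by exists 0%N.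
have [h|h] := ltnP n.+1 (k.+1 ^ 2).
  by exists k; rewrite h (leq_trans k1).
exists k.+1; rewrite h /=; have -> : n.+1 = (k.+1 ^ 2)%N by apply/eqP; rewrite eqn_leq h andbT.
by rewrite ltn_exp2r.
Qed.

(** A monotone sequence that is close to [n m] at the squares is close to it
    everywhere, since consecutive squares have ratio tending to 1.  If [k] is so
    large that [3 m <= d k], replacing [n] by a neighbouring square costs at most
    [3 m k <= d k^2], and the deviation allowed at [(k+1)^2] is at most
    [4 d k^2]; hence the constant 5. *)
Lemma interpolate_squares (R : realType) (S : nat -> R) (m d : R) :
  0 <= m -> 0 < d -> {homo S : i j / (i <= j)%N >-> i <= j} ->
  (\forall k \near \oo, `|S (k ^ 2)%N - (k ^ 2)%:R * m| <= d * (k ^ 2)%:R) ->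
  \forall n \near \oo, `|S n - n%:R * m| <= 5 * d * n%:R.
Proof.
move=> m0 d0 ndS [K _ HK].
pose L := maxn (maxn K 1) (Num.truncn (3 * m / d)).+1.
exists (L ^ 2)%N => // n /= Ln; have [k /andP[kn nk]] := nat_sqrt_exists n.
have Lk : (L <= k)%N by rewrite -ltnS -(ltn_exp2r _ _ (e := 2))//; exact: leq_ltn_trans nk.
have Kk : (K <= k)%N by rewrite (leq_trans _ Lk)// /L !leq_max leqnn.
have k1 : 1 <= k%:R :> R by rewrite ler1n (leq_trans _ Lk)// /L !leq_max leqnn orbT.
have mk : 3 * m <= d * k%:R.
  rewrite -ler_pdivrMl// mulrC ltW// (lt_le_trans (truncnS_gt _))// ler_nat.
  by rewrite (leq_trans _ Lk)// /L !leq_max leqnn orbT.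
have /= := HK k Kk; rewrite ler_norml => /andP[lo _].
have /= := HK k.+1 (leqW Kk); rewrite ler_norml => /andP[_ hi].
have S1 : S (k ^ 2)%N <= S n by exact: ndS.
have S2 : S n <= S (k.+1 ^ 2)%N by apply: ndS; exact: ltnW.
have n1 : k%:R ^+ 2 <= n%:R :> R by rewrite -natrX ler_nat.
have n2 : n%:R <= (k%:R + 1) ^+ 2 :> R by rewrite natr1 -natrX ler_nat ltnW.
rewrite !natrX in lo hi; rewrite -natr1 in hi.
have mk2 : 3 * m * k%:R <= d * k%:R ^+ 2.
  by rewrite expr2 mulrA ler_wpM2r.
have kk : k%:R <= k%:R ^+ 2 :> R by rewrite expr2 ler_peMr.
have dn : d * k%:R ^+ 2 <= d * n%:R by rewrite ler_wpM2l// ltW.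
have dk : d * k%:R <= d * k%:R ^+ 2 by rewrite ler_wpM2l// ltW.
have d1 : d <= d * k%:R by rewrite ler_peMr// ltW.
have mk1 : m <= m * k%:R by rewrite ler_peMr.
have mn1 : k%:R ^+ 2 * m <= n%:R * m by rewrite ler_wpM2r.
have mn2 : n%:R * m <= (k%:R + 1) ^+ 2 * m by rewrite ler_wpM2r.
rewrite ler_norml; apply/andP; split.
  have e1 : (k%:R + 1) ^+ 2 * m = k%:R ^+ 2 * m + 2 * (m * k%:R) + m by ring.
lra.
have e1 : (k%:R + 1) ^+ 2 * m = k%:R ^+ 2 * m + 2 * (m * k%:R) + m by ring.
have e2 : d * (k%:R + 1) ^+ 2 = d * k%:R ^+ 2 + 2 * (d * k%:R) + d by ring.
lra.
Qed.

Lemma sum_inv_squares (R : realType) (N : nat) :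
  \sum_(i < N) (i.+1%:R ^- 2 : R) <= 2.
Proof.
suff H n : \sum_(i < n.+1) (i.+1%:R ^- 2 : R) <= 2 - n.+1%:R^-1.
  case: N => [|N]; first by rewrite big_ord0.
  by rewrite (le_trans (H N))// lerBlDr lerDl invr_ge0.
elim: n => [|n IH]; first by rewrite big_ord1 expr1n invr1; lra.
rewrite big_ord_recr/= (le_trans (lerD IH (lexx _)))// -addrA lerD2l.
rewrite -(natr1 n.+1); have : (1 : R) <= n.+1%:R by rewrite ler1n.
set a : R := n.+1%:R => a1.
have -> : - a^-1 + (a + 1) ^- 2 = - ((a ^+ 2 + a + 1) / (a * (a + 1) ^+ 2)).
  by field; apply/andP; split; rewrite gt_eqF//; lra.
rewrite lerN2 ler_pdivlMr; last by rewrite mulr_gt0 ?exprn_gt0//; lra.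
rewrite mulrC ler_pdivrMr; last by lra.
by nra.
Qed.

Section slln.
Context {dO dE : measure_display} {Omega : measurableType dO}
  {E : measurableType dE} {R : realType}.
Variables (P : probability Omega R) (X : nat -> {RV P >-> E}).
Variable mu : probability E R.
Hypothesis indep : mutually_independent X.
Hypothesis lawX : forall i A, measurable A -> distribution P (X i) A = mu A.

Lemma measurable_deviation h n m t : measurable_fun setT h ->
  measurable [set o | t <= `|psum X h n o - n%:R * m|].
Proof.
move=> mh.
have -> : [set o | t <= `|psum X h n o - n%:R * m|] =
    setT `&` (fun o => `|psum X h n o - n%:R * m|) @^-1` `[t, +oo[.
  by apply/seteqP; split=> x /=; rewrite in_itv/= andbT ?setTI => //= -[].
have mf : measurable_fun setT (fun o => `|psum X h n o - n%:R * m|).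
  apply: measurableT_comp => //; apply: measurable_funB => //.
  exact: measurable_psum.
by apply: mf => //; exact: measurable_itv.
Qed.

Lemma psum_nd (h : E -> R) o : (forall x, 0 <= h x) ->
  {homo (fun n => psum X h n o) : i j / (i <= j)%N >-> i <= j}.
Proof.
move=> h0; apply/nondecreasing_seqP => n; rewrite /psum big_ord_recr/= lerDl.
exact: h0.
Qed.

(** Chebyshev's inequality bounds the probability of a deviation at rank [k^2] by
    a multiple of [1 / k^2], which is summable; Borel-Cantelli then applies at the
    squares and monotonicity fills the gaps. *)
Lemma slln_bounded (h : E -> R) (B m e : R) : measurable_fun setT h ->
  (forall x, 0 <= h x <= B) -> (\int[mu]_x (h x)%:E = m%:E)%E -> 0 < e ->
  {ae P, forall o, \forall n \near \oo, `|psum X h n o - n%:R * m| <= e * n%:R}.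
Proof.
move=> mh hB hm e0.
have h0 x : 0 <= h x by have /andP[] := hB x.
have m0 : 0 <= m by rewrite -lee_fin -hm integral_ge0// => x _; rewrite lee_fin.
have [v hv] : exists v, (\int[mu]_x (h x ^+ 2)%:E = v%:E)%E.
  exists (fine (\int[mu]_x (h x ^+ 2)%:E)); rewrite fineK//.
  rewrite ge0_fin_numE; last by apply: integral_ge0 => x _; rewrite lee_fin sqr_ge0.
  apply: (@le_lt_trans _ _ (\int[mu]_x (B ^+ 2)%:E)%E).
    apply: ge0_le_integral_EFin => //; first exact: measurable_funX.
    - by move=> x; exact: sqr_ge0.
    - move=> x; have /andP[a b] := hB x; rewrite ler_pXn2r ?nnegrE//.
      exact: le_trans a b.
  have := integral_cst mu measurableT (B ^+ 2)%:E; rewrite /= probability_setT mule1 => ->.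
  exact: ltry.
have v0 : 0 <= v.
  by rewrite -lee_fin -hv integral_ge0// => x _; rewrite lee_fin sqr_ge0.
pose d := e / 5; have d0 : 0 < d by rewrite /d; lra.
pose F k := [set o | d * (k.+1 ^ 2)%:R <= `|psum X h (k.+1 ^ 2) o - (k.+1 ^ 2)%:R * m|].
have PF k : (P (F k) <= (v / d ^+ 2 * k.+1%:R ^- 2)%:E)%E.
  have t0 : 0 < d * (k.+1 ^ 2)%:R by rewrite mulr_gt0// ltr0n expn_gt0.
  apply: le_trans (chebyshev_psum indep lawX (k.+1 ^ 2) mh h0 hm hv t0) _.
  rewrite lee_fin natrX le_eqVlt; apply/orP; left; apply/eqP; field.
  by rewrite !gt_eqF// ltr_pwDl.
have sF : (\sum_(n <oo) P (F n) < +oo)%E.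
  apply: (@le_lt_trans _ _ (v / d ^+ 2 * 2)%:E); last exact: ltry.
  apply: nneseries_le_bound => // N.
  apply: le_trans (lee_sum _ (fun (i : 'I_N) _ => PF i)) _.
  rewrite sumEFin lee_fin -mulr_sumr ler_wpM2l//.
    by rewrite divr_ge0// sqr_ge0.
  exact: sum_inv_squares.
have mF k : measurable (F k) by exact: measurable_deviation.
apply: filterS (borel_cantelli_ae mF sF) => o [K _ HK].
have -> : e = 5 * d by rewrite /d; lra.
apply: interpolate_squares => //; first exact: psum_nd.
exists K.+1 => // -[//|k] /= Kk; have /= /negP := HK k Kk.
by rewrite -ltNge => /ltW; rewrite natrX.
Qed.

End slln.

(** A geometric sum is at most twice its last term, which is here below [h].
    Integrated in [h], it bounds the probabilities that one of the first [2^k]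
    variables exceeds [2^k]. *)
Lemma sum_pow2_lt (R : realType) (h : R) (N : nat) : 0 <= h ->
  \sum_(i < N) 2 ^+ i * (2 ^+ i < h)%R%:R <= 2 * h :> R.
Proof.
move=> h0; suff [] : \sum_(i < N) 2 ^+ i * (2 ^+ i < h)%R%:R <= 2 * h :> R
    /\ \sum_(i < N) 2 ^+ i * (2 ^+ i < h)%R%:R <= 2 ^+ N :> R by [].
elim: N => [|N [IH1 IH2]]; first by rewrite big_ord0; split; rewrite ?mulr_ge0.
rewrite big_ord_recr/= exprS; case: ltP => hN; rewrite ?(mulr1, mulr0, addr0).
  by split; lra.
split => //; apply: le_trans IH2 _; rewrite ler_peMl ?ler1n// exprn_ge0.
Qed.

(** The geometric tail starting at the first [2^i >= h].  The proof by induction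
    keeps the whole tail from [N] on, [2 (2^N)^-1 h^2], in the bound.  Integrated
    in [h], it bounds the Chebyshev terms of the variables truncated at [2^k]. *)
Lemma sum_trunc_sqr (R : realType) (h : R) (N : nat) : 0 <= h ->
  \sum_(i < N) (2 ^+ i)^-1 * (h * (h <= 2 ^+ i)%R%:R) ^+ 2 <= 2 * h.
Proof.
move=> h0; set s := \sum_(i < N) _.
suff [] : (h <= 2 ^+ N -> s + 2 * (2 ^+ N)^-1 * h ^+ 2 <= 2 * h)
    /\ (2 ^+ N < h -> s = 0).
  move=> H1 H2; case: (leP h (2 ^+ N)) => [/H1|/H2 ->]; last by rewrite mulr_ge0.
  by apply: le_trans; rewrite lerDl mulr_ge0 ?sqr_ge0// mulr_ge0// invr_ge0 exprn_ge0.
rewrite /s {s}; elim: N => [|N [IH1 IH2]].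
  rewrite big_ord0 expr0 invr1; split => // h1; rewrite add0r mulr1.
  by rewrite ler_wpM2l// expr2 ler_piMl.
have p0 : 0 < 2 ^+ N :> R by rewrite exprn_gt0.
rewrite big_ord_recr/=; split.
  move=> hN; case: (leP h (2 ^+ N)) => [h1|h1].
    rewrite mulr1; apply: le_trans (IH1 h1); rewrite -addrA lerD2l (exprS (2:R) N) invfM.
    have -> : 2 * (2^-1 / 2 ^+ N) = (2 ^+ N)^-1 :> R by field; rewrite gt_eqF.
    lra.
  rewrite (IH2 h1) mulr0 expr0n mulr0 !add0r -mulrA ler_wpM2l//.
  rewrite expr2 mulrA ler_piMl// mulrC ler_pdivrMr ?mul1r// exprn_gt0//.
move=> hN; have h1 : 2 ^+ N < h by rewrite (le_lt_trans _ hN)// (exprS (2:R) N) ler_peMl ?ler1n// ltW.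
by rewrite (IH2 h1) leNgt h1 mulr0 expr0n mulr0 addr0.
Qed.

Lemma interpolate_dyadic (R : realType) (S : nat -> R) (a : R) :
  0 <= a -> {homo S : i j / (i <= j)%N >-> i <= j} ->
  (\forall k \near \oo, S (2 ^ k)%N <= a * 2 ^+ k) ->
  \forall n \near \oo, S n <= 2 * a * n%:R.
Proof.
move=> a0 ndS [K _ HK]; exists (2 ^ K)%N => // n /= Kn.
have n0 : (0 < n)%N by rewrite (leq_trans _ Kn)// expn_gt0.
have /andP[] := trunc_log_bounds (isT : (1 < 2)%N) n0.
move: (trunc_log 2 n) => k kn nk.
have Kk : (K <= k)%N.
  by rewrite -ltnS -(@ltn_exp2l 2)//; exact: leq_ltn_trans nk.
apply: le_trans (ndS _ _ (ltnW nk)) _.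
apply: le_trans (HK k.+1 (leqW Kk)) _.
rewrite exprS mulrA (mulrC 2 a) ler_wpM2l ?mulr_ge0//.
by rewrite -natrX ler_nat.
Qed.

Lemma measurable_bool_indic (d : measure_display) (T : measurableType d)
    (R : realType) (b : T -> bool) :
  measurable [set x | b x] -> measurable_fun setT (fun x => (b x)%:R : R).
Proof.
move=> mb; rewrite (_ : (fun x => _) = \1_[set x | b x]); first exact: measurable_indic.
by apply/funext => x; rewrite indicE mem_setE.
Qed.

Section slln_tail.
Context {dO dE : measure_display} {Omega : measurableType dO}
  {E : measurableType dE} {R : realType}.
Variables (P : probability Omega R) (X : nat -> {RV P >-> E}).
Variable mu : probability E R.
Hypothesis indep : mutually_independent X.
Hypothesis lawX : forall i A, measurable A -> distribution P (X i) A = mu A.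

(** An upper bound that needs only the first moment.  At rank [2^k] the variables
    are truncated at [2^k]; both the probability that a truncation acts and the
    probability that the truncated sum exceeds its mean by [e 2^k] are summable
    in [k].  Going from powers of 2 to all ranks costs the factor 2. *)
Lemma slln_tail (h : E -> R) (m e : R) : measurable_fun setT h ->
  (forall x, 0 <= h x) -> (\int[mu]_x (h x)%:E = m%:E)%E -> 0 < e ->
  {ae P, forall o, \forall n \near \oo, psum X h n o <= 2 * (m + e) * n%:R}.
Proof.
move=> mh h0 hm e0.
have m0 : 0 <= m by rewrite -lee_fin -hm integral_ge0// => x _; rewrite lee_fin.
pose hk k x := h x * (h x <= 2 ^+ k)%R%:R.
have mI k : measurable_fun setT (fun x => (h x <= 2 ^+ k)%R%:R : R).
  apply: measurable_bool_indic.
  have -> : [set x | (h x <= 2 ^+ k)%R] = setT `&` h @^-1` `]-oo, 2 ^+ k].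
    by apply/seteqP; split=> x; rewrite /= in_itv/= ?setTI => //= -[].
  by apply: mh.
have mhk k : measurable_fun setT (hk k) by exact: measurable_funM.
have hk0 k x : 0 <= hk k x by rewrite mulr_ge0.
have hkh k x : hk k x <= h x by rewrite ler_piMr// lern1 leq_b1.
have hkb k x : hk k x <= 2 ^+ k.
  rewrite /hk; case: (boolP (h x <= 2 ^+ k)%R) => hx; first by rewrite /= mulr1.
  by rewrite /= mulr0 exprn_ge0.
pose mk k := fine (\int[mu]_x (hk k x)%:E)%E.
have mkE k : (\int[mu]_x (hk k x)%:E = (mk k)%:E)%E.
  rewrite fineK// ge0_fin_numE ?integral_ge0//; last by move=> x _; rewrite lee_fin.
  apply: (@le_lt_trans _ _ m%:E); last exact: ltry.
  by rewrite -hm ge0_le_integral_EFin.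
have mkm k : mk k <= m by rewrite -lee_fin -mkE -hm ge0_le_integral_EFin.
pose vk k := fine (\int[mu]_x (hk k x ^+ 2)%:E)%E.
have vkE k : (\int[mu]_x (hk k x ^+ 2)%:E = (vk k)%:E)%E.
  rewrite fineK// ge0_fin_numE ?integral_ge0//; last by move=> x _; rewrite lee_fin sqr_ge0.
  apply: (@le_lt_trans _ _ (\int[mu]_x ((2 ^+ k) ^+ 2)%:E)%E).
    apply: ge0_le_integral_EFin => //; first exact: measurable_funX.
    - by move=> x; exact: sqr_ge0.
    - by move=> x; rewrite ler_pXn2r ?nnegrE// exprn_ge0.
  have := integral_cst mu measurableT ((2 ^+ k) ^+ 2)%:E.
  by rewrite /= probability_setT mule1 => ->; exact: ltry.
pose D k := [set x | 2 ^+ k < h x].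
have mD k : measurable (D k).
  have -> : D k = setT `&` h @^-1` `]2 ^+ k, +oo[.
    by apply/seteqP; split=> x; rewrite /D /= in_itv/= andbT ?setTI => //= -[].
  by apply: mh.
(* F1: a truncation acts; F2: the truncated sum is far from its mean *)
pose F1 k := \bigcup_(i in [set i | (i < 2 ^ k)%N]) (X i @^-1` D k).
pose F2 k := [set o | e * (2 ^ k)%:R <= `|psum X (hk k) (2 ^ k) o - (2 ^ k)%:R * mk k|].
have mXD i k : measurable (X i @^-1` D k).
  by rewrite -[X in measurable X]setTI; exact: measurable_funPT.
have mF1 k : measurable (F1 k) by apply: bigcup_measurable.
have mF2 k : measurable (F2 k) by exact: measurable_deviation.
have PF1 k : (P (F1 k) <= (2 ^+ k)%:E * mu (D k))%E.
  rewrite /F1 bigcup_mkord.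
  apply: (le_trans (Boole_inequality P (fun i _ => mXD i k))).
  rewrite (eq_bigr (fun=> mu (D k))); last by move=> i _; rewrite -(lawX i (mD k)).
  have [r0 ->] : exists r, mu (D k) = r%:E.
    by exists (fine (mu (D k))); rewrite fineK// fin_num_measure.
  by rewrite sumEFin sumr_const card_ord lee_fin -[r0 *+ _]mulr_natl natrX.
have PF2 k : (P (F2 k) <= (e ^- 2 * ((2 ^+ k)^-1 * vk k))%:E)%E.
  have p0 : 0 < 2 ^+ k :> R by rewrite exprn_gt0.
  have t0 : 0 < e * (2 ^ k)%:R by rewrite mulr_gt0// natrX.
  apply: le_trans (chebyshev_psum indep lawX (2 ^ k) (mhk k) (hk0 k) (mkE k) (vkE k) t0) _.
  rewrite lee_fin natrX le_eqVlt; apply/orP; left; apply/eqP; field.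
  by rewrite !gt_eqF.
have sF : (\sum_(k <oo) P (F1 k `|` F2 k) < +oo)%E.
  apply: (@le_lt_trans _ _ ((2 * m)%:E + (e ^- 2 * (2 * m))%:E)%E); last exact: ltry.
  apply: nneseries_le_bound => // N.
  apply: (@le_trans _ _ (\sum_(i < N) ((2 ^+ i)%:E * mu (D i) + (e ^- 2 * ((2 ^+ i)^-1 * vk i))%:E))%E).
    apply: lee_sum => i _; apply: le_trans (measureU2 P (mF1 i) (mF2 i)) _.
    by apply: leeD; [exact: PF1|exact: PF2].
  rewrite big_split/=; apply: leeD.
    rewrite (eq_bigr (fun i : 'I_N => \int[mu]_x (2 ^+ i * (2 ^+ i < h x)%R%:R)%:E)%E); last first.
      move=> i _; rewrite -[D i]setIT -integral_indic// -ge0_integral_EFinZ//.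
      apply: eq_integral => x _; congr (EFin (_ * _)); rewrite indicE /D.
      by rewrite mem_setE.
    rewrite -(ge0_integral_EFinsum mu (index_enum 'I_N) (f := fun i x => 2 ^+ i * (2 ^+ i < h x)%R%:R)); last 2 first.
    - move=> i; apply: measurable_funM => //.
      by apply: measurable_bool_indic; exact: mD.
    - by move=> i x; rewrite mulr_ge0// exprn_ge0.
    rewrite EFinM -hm -ge0_integral_EFinZ//.
    apply: ge0_le_integral_EFin.
    - apply: measurable_sum => i; apply: measurable_funM => //.
      by apply: measurable_bool_indic; exact: mD.
    - exact: measurable_funM.
    - by move=> x; apply: sumr_ge0 => i _; rewrite mulr_ge0// exprn_ge0.
    - by move=> x; exact: sum_pow2_lt.
  rewrite sumEFin -mulr_sumr !(EFinM (e ^- 2)).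
  have e20 : 0 <= e ^- 2 by rewrite invr_ge0 exprn_ge0// ltW.
  apply: lee_wpmul2l; first by rewrite lee_fin.
  rewrite -sumEFin EFinM -hm -ge0_integral_EFinZ//.
  rewrite (eq_bigr (fun i : 'I_N => \int[mu]_x ((2 ^+ i)^-1 * hk i x ^+ 2)%:E)%E); last first.
    move=> i _; rewrite EFinM -vkE -ge0_integral_EFinZ//.
    - exact: measurable_funX.
    - by move=> x; exact: sqr_ge0.
  have k0 i x : 0 <= (2 ^+ i)^-1 * hk i x ^+ 2.
    by apply: mulr_ge0; [rewrite invr_ge0 exprn_ge0|exact: sqr_ge0].
  have km (i : 'I_N) : measurable_fun setT (fun x => (2 ^+ i)^-1 * hk i x ^+ 2).
    by apply: measurable_funM => //; exact: measurable_funX.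
  rewrite -(ge0_integral_EFinsum mu (index_enum 'I_N) (f := fun i x => (2 ^+ i)^-1 * hk i x ^+ 2))//.
  apply: ge0_le_integral_EFin.
  - exact: measurable_sum.
  - exact: measurable_funM.
  - by move=> x; apply: sumr_ge0.
  - by move=> x; exact: sum_trunc_sqr.
have mF k : measurable (F1 k `|` F2 k) by exact: measurableU.
apply: filterS (borel_cantelli_ae mF sF) => o [K _ HK].
apply: interpolate_dyadic; [by rewrite addr_ge0// ltW|exact: psum_nd|].
exists K => // k /= Kk; have /not_orP[/= n1 /negP] := HK k Kk.
rewrite -ltNge => n2.
have -> : psum X h (2 ^ k) o = psum X (hk k) (2 ^ k) o.
  apply: eq_bigr => i _; rewrite /hk.
  have -> : h (X i o) <= 2 ^+ k; last by rewrite mulr1.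
  by rewrite leNgt; apply/negP => hi; apply: n1; exists i => /=.
have p0 : 0 < 2 ^+ k :> R by rewrite exprn_gt0.
move: n2; rewrite ltr_norml natrX => /andP[_ n2].
have : 2 ^+ k * mk k <= 2 ^+ k * m by rewrite ler_wpM2l// ltW.
lra.
Qed.

End slln_tail.

Section slln_final.
Context {dO dE : measure_display} {Omega : measurableType dO}
  {E : measurableType dE} {R : realType}.
Variables (P : probability Omega R) (X : nat -> {RV P >-> E}).
Variable mu : probability E R.
Hypothesis indep : mutually_independent X.
Hypothesis lawX : forall i A, measurable A -> distribution P (X i) A = mu A.

(** By monotone convergence the part of [g] above a large level has small mean. *)
Lemma truncation_integral (g : E -> R) (m e : R) : measurable_fun setT g ->
  (forall x, 0 <= g x) -> (\int[mu]_x (g x)%:E = m%:E)%E -> 0 < e ->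
  exists K m1 m2 : R,
    [/\ (\int[mu]_x (g x * (g x <= K)%R%:R)%:E = m1%:E)%E,
        (\int[mu]_x (g x * (K < g x)%R%:R)%:E = m2%:E)%E,
        measurable_fun setT (fun x => g x * (g x <= K)%R%:R),
        measurable_fun setT (fun x => g x * (K < g x)%R%:R) &
        m = m1 + m2 /\ 0 <= m2 < e].
Proof.
move=> mg g0 gm e0.
pose gk (k : nat) x := g x * (g x <= k%:R)%R%:R.
have mgk k : measurable_fun setT (gk k).
  apply: measurable_funM => //; apply: measurable_bool_indic.
  have -> : [set x | (g x <= k%:R)%R] = setT `&` g @^-1` `]-oo, k%:R].
    by apply/seteqP; split=> x; rewrite /= in_itv/= ?setTI => //= -[].
  by apply: mg.
have gk0 k x : 0 <= gk k x by rewrite mulr_ge0.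
have cv : (\int[mu]_x (gk k x)%:E @[k --> \oo] --> \int[mu]_x (g x)%:E)%E.
  have -> : (\int[mu]_x (g x)%:E = \int[mu]_x limn (fun k => (gk k x)%:E))%E.
    apply: eq_integral => x _; apply/esym/cvg_lim => //.
    apply: cvg_near_cst; exists (Num.truncn (g x)).+1 => // k /= xk.
    rewrite /gk; have -> : g x <= k%:R; last by rewrite mulr1.
    by rewrite ltW// (lt_le_trans (truncnS_gt _))// ler_nat.
  apply: cvg_monotone_convergence => //.
  - by move=> k; exact/measurable_EFinP.
  - by move=> k x _; rewrite lee_fin.
  - move=> x _ i j ij; rewrite lee_fin ler_wpM2l//.
    case: (boolP (g x <= i%:R)%R) => // gi.
    by rewrite (le_trans gi)// ler_nat.
have fk k : (\int[mu]_x (gk k x)%:E = (fine (\int[mu]_x (gk k x)%:E))%:E)%E.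
  rewrite fineK// ge0_fin_numE ?integral_ge0//; last by move=> x _; rewrite lee_fin.
  apply: (@le_lt_trans _ _ m%:E); last exact: ltry.
  rewrite -gm ge0_le_integral_EFin// => x.
  by rewrite ler_piMr// lern1 leq_b1.
have [k hk] : exists k, m - e < fine (\int[mu]_x (gk k x)%:E)%E.
  move: cv; rewrite gm => /fine_cvgP[_].
  move/cvgrPdist_lt => /(_ e e0)[k _ /(_ k (leqnn k))/=].
  by rewrite ltr_norml => /andP[_ H]; exists k; lra.
set m1 := fine _ in hk.
have mt : measurable_fun setT (fun x => g x * (k%:R < g x)%R%:R).
  apply: measurable_funM => //; apply: measurable_bool_indic.
  have -> : [set x | (k%:R < g x)%R] = setT `&` g @^-1` `]k%:R, +oo[.
    by apply/seteqP; split=> x; rewrite /= in_itv/= andbT ?setTI => //= -[].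
  by apply: mg.
have t0 x : 0 <= g x * (k%:R < g x)%R%:R by rewrite mulr_ge0.
have split_int : (m1%:E + \int[mu]_x (g x * (k%:R < g x)%R%:R)%:E = m%:E)%E.
  rewrite -gm /m1 -fk -ge0_integral_EFinD//.
  apply: eq_integral => x _; congr EFin; rewrite /gk ltNge.
  by case: (g x <= k%:R)%R => /=; rewrite mulr1 mulr0 ?addr0 ?add0r.
have It : (\int[mu]_x (g x * (k%:R < g x)%R%:R)%:E = (m - m1)%:E)%E.
  by rewrite EFinB -split_int addeAC subee// add0e.
exists k%:R, m1, (m - m1); split; [exact: fk|exact: It|exact: mgk|exact: mt|].
split; first by rewrite addrC subrK.
  apply/andP; split; last by lra.
  by rewrite -lee_fin -It integral_ge0// => x _; rewrite lee_fin.
Qed.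

(** The bounded part deviates by [e n], the tail contributes at most
    [2 (m2 + e) n <= 4 e n] to the sum and [m2 n <= e n] to the mean: [6 e n] in
    total. *)
Lemma slln (g : E -> R) (m : R) : measurable_fun setT g ->
  (forall x, 0 <= g x) -> (\int[mu]_x (g x)%:E = m%:E)%E ->
  {ae P, forall o, psum X g n o / n%:R @[n --> \oo] --> m}.
Proof.
move=> mg g0 gm.
have H (j : nat) : {ae P, forall o, \forall n \near \oo,
    `|psum X g n o - n%:R * m| <= 6 * j.+1%:R^-1 * n%:R}.
  pose e : R := j.+1%:R^-1; have e0 : 0 < e by rewrite invr_gt0.
  have [K [m1 [m2 [I1 I2 M1 M2 [mE /andP[m20 m2e]]]]]] := truncation_integral mg g0 gm e0.
  have b1 x : 0 <= g x * (g x <= K)%R%:R <= Num.max K 0.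
    rewrite mulr_ge0//=; case: (boolP (g x <= K)%R) => gK.
      by rewrite /= mulr1 le_max gK.
    by rewrite /= mulr0 le_max lexx orbT.
  have A1 := slln_bounded indep lawX M1 b1 I1 e0.
  have t0 x : 0 <= g x * (K < g x)%R%:R by rewrite mulr_ge0.
  have A2 := slln_tail indep lawX M2 t0 I2 e0.
  apply: filterS2 A1 A2 => o; apply: filterS2 => n h1 h2.
  have -> : psum X g n o = psum X (fun x => g x * (g x <= K)%R%:R) n o +
      psum X (fun x => g x * (K < g x)%R%:R) n o.
    rewrite /psum -big_split/=; apply: eq_bigr => i _; rewrite ltNge.
    by case: (g _ <= K)%R => /=; rewrite mulr1 mulr0 ?addr0 ?add0r.
  have := psum_ge0 X n o t0; set s2 := psum X (fun x => g x * (K < g x)%R%:R) n o in h2 *.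
  move: h1; set s1 := psum _ _ _ _; rewrite ler_norml -/e => /andP[h1 h1'] s20.
  have n0 : 0 <= n%:R :> R by [].
  have : n%:R * m2 <= n%:R * e by rewrite ler_wpM2l// ltW.
  have : 0 <= n%:R * m2 by rewrite mulr_ge0.
  rewrite ler_norml mE; move=> ? ?; apply/andP; split; nra.
move/ae_foralln : H; apply: filterS => o Ho.
apply/cvgrPdist_le => /= e e0; near=> n.
have n0 : 0 < n%:R :> R by rewrite ltr0n; near: n; exact: nbhs_infty_gt.
pose j := Num.truncn (6 / e).
have je : 6 * j.+1%:R^-1 <= e.
  by rewrite ler_pdivrMr// mulrC -ler_pdivrMr// ltW// truncnS_gt.
have -> : m - psum X g n o / n%:R = - ((psum X g n o - n%:R * m) / n%:R).
  by field; rewrite gt_eqF.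
rewrite normrN normrM normfV (gtr0_norm n0) ler_pdivrMr//.
apply: (@le_trans _ _ (6 * j.+1%:R^-1 * n%:R)); last by rewrite ler_wpM2r// ltW.
by near: n; exact: Ho.
Unshelve. all: by end_near. Qed.

End slln_final.

(** * Potentials of a cyclically monotone set *)

Section sup_measurable.
Context {R : realType} {d : nat}.
Local Notation E := 'rV[R]_d.

(** A supremum of continuous functions is lower semicontinuous, so it is
    measurable even when the index set is uncountable. *)
Lemma measurable_ereal_sup_continuous (I : Type) (D : set I) (F : I -> E -> R) :
  (forall i, D i -> continuous (F i)) ->
  measurable_fun setT (fun x => ereal_sup [set (F i x)%:E | i in D]).
Proof.
move=> cF; apply: (measurability _ (ErealGenOInfty.measurableE R)).
move=> _ [_ [a ->] <-]; rewrite setTI preimage_itvoy; apply: (@mx_open_measurable R 1 d).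
have : open ([set x | a%:E < ereal_sup [set (F i x)%:E | i in D]]%E : set E); last by [].
rewrite openE => x /=.
move=> /ereal_sup_gt[_ [i Di <-]]; rewrite lte_fin => aF.
have : \forall y \near x, a < F i y by apply: (cvgr_gt _ (cF i Di x)) aF.
apply: filterS => y /= aFy; apply: (@lt_le_trans _ _ (F i y)%:E); first by rewrite lte_fin.
by apply: ereal_sup_ubound; exists i.
Qed.

End sup_measurable.

Lemma cvg_sumr (R : realType) (I T : Type) (F : set_system T) {FF : Filter F}
    (s : seq I) (f : I -> T -> R) (l : I -> R) :
  (forall i, f i x @[x --> F] --> l i) ->
  \sum_(i <- s) f i x @[x --> F] --> \sum_(i <- s) l i.
Proof.
move=> fl; elim: s => [|i s IH].
  by rewrite big_nil; under eq_cvg do rewrite big_nil; exact: cvg_cst.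
by rewrite big_cons; under eq_cvg do rewrite big_cons; exact: cvgD.
Qed.

Section rockafellar.
Context {R : realType} {d : nat}.
Local Notation E := 'rV[R]_d.

Definition sqdist (x y : E) : R := \sum_j (x 0 j - y 0 j) ^+ 2.

Lemma sqdist_ge0 x y : 0 <= sqdist x y.
Proof. by apply: sumr_ge0 => j _; exact: sqr_ge0. Qed.

Lemma sqdistE x y : enorm (x - y) ^+ 2 = sqdist x y.
Proof.
rewrite /enorm sqr_sqrtr; last by apply: sumr_ge0 => j _; exact: sqr_ge0.
by apply: eq_bigr => j _; rewrite !mxE.
Qed.

Lemma sqdistC x y : sqdist x y = sqdist y x.
Proof. by apply: eq_bigr => j _; rewrite -sqrrN opprB. Qed.

Lemma measurable_sqdist dT (T : measurableType dT) (f g : T -> E) :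
  measurable_fun setT f -> measurable_fun setT g ->
  measurable_fun setT (fun t => sqdist (f t) (g t)).
Proof.
move=> mf mg; apply: measurable_sum => j; apply: measurable_funX.
apply: measurable_funB.
- exact: measurableT_comp (measurable_coord 0 j) mf.
- exact: measurableT_comp (measurable_coord 0 j) mg.
Qed.

Lemma continuous_sqdist (y : E) : continuous (sqdist^~ y).
Proof.
move=> x; rewrite /sqdist; apply: (@cvg_sumr R _ _ (nbhs x) (nbhs_filter x)) => j.
apply: (@cvgM _ _ _ _ (fun z : E => z 0 j - y 0 j) (fun z : E => z 0 j - y 0 j)).
- by apply: cvgB; [exact: coord_continuous|exact: cvg_cst].
- by apply: cvgB; [exact: coord_continuous|exact: cvg_cst].
Qed.

(** Cycles [z 0, ..., z k = z 0] of points of [M]: giving to each first component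
    the second component of its predecessor does not lower the total cost. *)
Definition cyc_monotone (M : set (E * E)) : Prop :=
  forall k (z : nat -> E * E), (forall i, M (z i)) -> z k = z 0%N ->
  \sum_(i < k) (sqdist (z i).1 (z i).2 - sqdist (z i.+1).1 (z i).2) <= 0.

Section potentials.
Variables (M : set (E * E)) (z0 : E * E).
Hypotheses (cmM : cyc_monotone M) (Mz0 : M z0).

Definition chains : set (nat * (nat -> E * E)) :=
  [set kz | kz.2 0%N = z0 /\ forall i, M (kz.2 i)].

(** Rockafellar's sum along a chain from [z0] to [x], to which [|x - y0|^2] is
    added.  The added term makes [pot] and [conj_pot] nonnegative, so that they
    can be integrated without a discussion of integrability. *)
Definition chain_value (kz : nat * (nat -> E * E)) (x : E) : R :=
  \sum_(i < kz.1) (sqdist (kz.2 i).1 (kz.2 i).2 - sqdist (kz.2 i.+1).1 (kz.2 i).2)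
  + sqdist (kz.2 kz.1).1 (kz.2 kz.1).2 - sqdist x (kz.2 kz.1).2
  + sqdist x z0.2.

Definition pot (x : E) : \bar R := ereal_sup [set (chain_value kz x)%:E | kz in chains].

Lemma pot_ge x : ((sqdist z0.1 z0.2)%:E <= pot x)%E.
Proof.
apply: ereal_sup_ubound; exists (0%N, fun=> z0); first by split.
by rewrite /chain_value big_ord0 /= add0r subrK.
Qed.

Lemma pot_ge0 x : (0 <= pot x)%E.
Proof. by apply: le_trans (pot_ge x); rewrite lee_fin sqdist_ge0. Qed.

(** A chain that ends at [a] can be prolonged to [x] through the point [(a, b)]. *)
Lemma pot_step a b x : M (a, b) ->
  (pot a + (sqdist a b + sqdist x z0.2 - sqdist a z0.2 - sqdist x b)%:E <= pot x)%E.
Proof.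
move=> Mab; rewrite -leeBrDr//; apply: ub_ereal_sup => _ [kz ckz <-].
rewrite leeBrDr// -EFinD; case: kz ckz => k z [/= z00 Mz].
pose z' i := if (i <= k)%N then z i else (a, b).
apply: ereal_sup_ubound; exists (k.+1, z').
  by split => [|i] /=; rewrite /z' ?leq0n//; case: ifP.
have zk : z' k = z k by rewrite /z' leqnn.
have zk1 : z' k.+1 = (a, b) by rewrite /z' ltnn.
congr EFin; rewrite /chain_value /= big_ord_recr/= zk zk1/=.
rewrite (eq_bigr (fun i : 'I_k => sqdist (z i).1 (z i).2 - sqdist (z i.+1).1 (z i).2)); last first.
  by move=> i _; rewrite /z' ltn_ord (ltnW (ltn_ord i)).
ring.
Qed.

(** A chain that returns to [z0] is a cycle: this is where cyclical monotonicity
    enters, and what makes the potential finite somewhere. *)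
Lemma pot_base : (pot z0.1 <= (sqdist z0.1 z0.2)%:E)%E.
Proof.
apply: ub_ereal_sup => _ [[k z] [/= zz0 Mz] <-]; rewrite lee_fin.
pose z' i := if (i <= k)%N then z i else z0.
have Mz' i : M (z' i) by rewrite /z'; case: ifP.
have zz : z' k.+1 = z' 0%N by rewrite /z' ltnn leq0n zz0.
have zk : z' k = z k by rewrite /z' leqnn.
have zk1 : z' k.+1 = z0 by rewrite /z' ltnn.
have := cmM Mz' zz; rewrite big_ord_recr/= zk zk1.
rewrite (eq_bigr (fun i : 'I_k => sqdist (z i).1 (z i).2 - sqdist (z i.+1).1 (z i).2)); last first.
  by move=> i _; rewrite /z' ltn_ord (ltnW (ltn_ord i)).
rewrite /chain_value/=; lra.
Qed.

Lemma measurable_pot : measurable_fun setT pot.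
Proof.
apply: measurable_ereal_sup_continuous => -[k z] _ x.
set A := \sum_(i < k) (sqdist (z i).1 (z i).2 - sqdist (z i.+1).1 (z i).2)
  + sqdist (z k).1 (z k).2.
apply: (@continuousD _ _ _ (cst A \- sqdist^~ (z k).2) (sqdist^~ z0.2)).
  by apply: (@continuousB _ _ _ (cst A)); [exact: cst_continuous|exact: continuous_sqdist].
exact: continuous_sqdist.
Qed.

(** Indexing the conjugate by real values of [pot] avoids subtracting infinite
    ones. *)
Definition conj_dom : set (E * R) := [set xr | pot xr.1 = (xr.2)%:E].

Definition conj_value (xr : E * R) (y : E) : R :=
  sqdist z0.1 y - sqdist xr.1 y - xr.2 + sqdist xr.1 z0.2.

Definition conj_pot (y : E) : \bar R :=
  ereal_sup [set (conj_value xr y)%:E | xr in conj_dom].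

Lemma pot_base_fin : exists2 r, pot z0.1 = r%:E & r <= sqdist z0.1 z0.2.
Proof.
exists (sqdist z0.1 z0.2) => //.
by apply/eqP; rewrite eq_le pot_base pot_ge.
Qed.

Lemma conj_pot_ge0 y : (0 <= conj_pot y)%E.
Proof.
have [r pr rle] := pot_base_fin.
apply: (@le_trans _ _ (conj_value (z0.1, r) y)%:E).
  by rewrite lee_fin /conj_value/=; lra.
by apply: ereal_sup_ubound; exists (z0.1, r).
Qed.

Lemma measurable_conj_pot : measurable_fun setT conj_pot.
Proof.
apply: measurable_ereal_sup_continuous => -[x r] _ y.
have c (u : E) : continuous (sqdist u).
  have -> : sqdist u = sqdist^~ u by apply/funext => v; rewrite sqdistC.
  exact: continuous_sqdist.
apply: (@continuousD _ _ _ ((sqdist z0.1 \- sqdist x) \- cst r) (cst (sqdist x z0.2))).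
  apply: (@continuousB _ _ _ _ (cst r)); last exact: cst_continuous.
  by apply: (@continuousB _ _ _ (sqdist z0.1)); exact: c.
exact: cst_continuous.
Qed.

Lemma pot_conj_ge x y :
  ((sqdist x z0.2 + sqdist z0.1 y)%:E <= pot x + conj_pot y + (sqdist x y)%:E)%E.
Proof.
have := pot_ge0 x; have h0 := conj_pot_ge0 y.
case px: (pot x) => [r| |] // _; last first.
  by rewrite addye ?gt_eqF// ?addye// ?leey// (lt_le_trans _ h0)// ltNy0.
have : ((conj_value (x, r) y)%:E <= conj_pot y)%E.
  by apply: ereal_sup_ubound; exists (x, r).
move=> hv; apply: (@le_trans _ _ (r%:E + (conj_value (x, r) y)%:E + (sqdist x y)%:E)%E).
  by rewrite -!EFinD lee_fin /conj_value/=; lra.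
by rewrite leeD2r// leeD2l.
Qed.

(** On [M] the inequality [pot_conj_ge] is an equality: [pot_step] at [(a, b)]
    says that [a] realises the supremum that defines [conj_pot b]. *)
Lemma pot_conj_eq a b : M (a, b) ->
  (pot a + conj_pot b + (sqdist a b)%:E = (sqdist a z0.2 + sqdist z0.1 b)%:E)%E.
Proof.
move=> Mab; apply/eqP; rewrite eq_le pot_conj_ge andbT.
have [r0 pr0 _] := pot_base_fin.
have := pot_step z0.1 Mab; rewrite pr0.
have := pot_ge0 a; case pa: (pot a) => [r| |]//= _ _.
have : (conj_pot b <= (sqdist z0.1 b - sqdist a b - r + sqdist a z0.2)%:E)%E.
  apply: ub_ereal_sup => _ [[x s] /= ps <-]; rewrite lee_fin /conj_value/=.
  have := pot_step x Mab; rewrite pa ps -EFinD lee_fin /= => H; lra.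
have := conj_pot_ge0 b; case: (conj_pot b) => [s| |]//= _; rewrite -!EFinD !lee_fin => H; lra.
Qed.

End potentials.

(** In terms of the usual dual variables, [|x - y0|^2 - f x] and
    [|x0 - y|^2 - h y] form a pair of Kantorovich potentials for the cost
    [|x - y|^2], with equality on [M]. *)
Lemma kantorovich_potentials (M : set (E * E)) (z0 : E * E) :
  cyc_monotone M -> M z0 ->
  exists f h : E -> \bar R,
  [/\ measurable_fun setT f /\ measurable_fun setT h,
      (forall x, 0 <= f x)%E /\ (forall y, 0 <= h y)%E,
      forall x y, ((sqdist x z0.2 + sqdist z0.1 y)%:E <=
                   f x + h y + (sqdist x y)%:E)%E &
      forall x y, M (x, y) -> (f x + h y + (sqdist x y)%:E =
                   (sqdist x z0.2 + sqdist z0.1 y)%:E)%E].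
Proof.
move=> cm M0; exists (pot M z0), (conj_pot M z0); split.
- by split; [exact: measurable_pot|exact: measurable_conj_pot].
- by split; [exact: pot_ge0|exact: conj_pot_ge0].
- exact: pot_conj_ge.
- exact: pot_conj_eq.
Qed.

End rockafellar.

(** * Uniqueness of the optimal map *)

Lemma ae_eq_of_le_integral (d : measure_display) (T : measurableType d)
    (R : realType) (mu : {measure set T -> \bar R}) (F : T -> \bar R) (g : T -> R) :
  measurable_fun setT F -> measurable_fun setT g -> (forall x, 0 <= g x) ->
  (forall x, (g x)%:E <= F x)%E -> (\int[mu]_x F x <= \int[mu]_x (g x)%:E)%E ->
  (\int[mu]_x (g x)%:E < +oo)%E -> {ae mu, forall x, F x = (g x)%:E}.
Proof.
move=> mF mg g0 gF Fg goo.
pose D x := (F x - (g x)%:E)%E.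
have mgE : measurable_fun setT (fun x => (g x)%:E) by exact/measurable_EFinP.
have mD : measurable_fun setT D by exact: emeasurable_funB.
have D0 x : (0 <= D x)%E by rewrite sube_ge0.
have gD x : ((g x)%:E + D x)%E = F x by rewrite /D addeC subeK.
have IF : (\int[mu]_x F x = \int[mu]_x (g x)%:E + \int[mu]_x D x)%E.
  rewrite -ge0_integralD//; first by apply: eq_integral => x _; rewrite gD.
  by move=> x _; rewrite lee_fin.
have ID : (\int[mu]_x `|D x| = 0)%E.
  apply/eqP; rewrite eq_le integral_ge0 ?andbT; last by move=> x _; exact: abse_ge0.
  under eq_integral do rewrite gee0_abs//.
  have gfin : (\int[mu]_x (g x)%:E)%E \is a fin_num.
    by rewrite ge0_fin_numE// integral_ge0// => x _; rewrite lee_fin.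
  by move: Fg; rewrite IF -leeBrDl// subee.
have /ae_eq_integral_abs := ID; move=> /(_ measurableT mD).
apply: filterS => x /(_ Logic.I)/= Dx.
by rewrite -gD Dx adde0.
Qed.

Section line_null.
Context {R : realType} {d : nat}.
Local Notation E := 'rV[R]_d.
Variable mu : probability E R.

(** The form in which absolute continuity enters: the exceptional sets of the
    argument meet the lines parallel to some axis at most once. *)
Definition line_null : Prop := forall (j : 'I_d) (A : set E), measurable A ->
  (forall u v, A u -> A v -> (forall k, k != j -> u 0 k = v 0 k) ->
    u 0 j = v 0 j) -> mu A = 0%E.

Lemma density_line_null (p : E -> R) : unnormalized_density mu p -> line_null.
Proof.
move=> [mp p0 [a a0 muE]] j A mA lA; rewrite muE//.
have A0 := lebesgue_rV_null mA lA.
apply: null_set_integral => //.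
by apply/measurable_EFinP/measurable_funTS; exact: measurable_funM.
Qed.

Lemma sqdist_swap (a b u v : E) :
  sqdist a v + sqdist b u - (sqdist a u + sqdist b v) =
  2 * \sum_j (a 0 j - b 0 j) * (u 0 j - v 0 j).
Proof.
rewrite /sqdist -!big_split/= -sumrB mulr_sumr; apply: eq_bigr => j _; ring.
Qed.

Section uniqueness.
Variables (f h : E -> \bar R) (z0 : E * E).
Hypotheses (mf : measurable_fun setT f) (mh : measurable_fun setT h).
Hypotheses (f0 : forall x, (0 <= f x)%E) (h0 : forall x, (0 <= h x)%E).
Hypothesis fh_ge : forall x y,
  ((sqdist x z0.2 + sqdist z0.1 y)%:E <= f x + h y + (sqdist x y)%:E)%E.

(** The set where the duality inequality is an equality, that is, the graph of the
    [c]-subdifferential of the potentials. *)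
Definition contact (x y : E) : Prop :=
  (f x + h y + (sqdist x y)%:E = (sqdist x z0.2 + sqdist z0.1 y)%:E)%E.

(** Adding the two equalities and subtracting the inequalities at the swapped
    pairs leaves only the mixed term of the squared distances. *)
Lemma contact_monotone a u b v : contact a u -> contact b v ->
  0 <= \sum_j (a 0 j - b 0 j) * (u 0 j - v 0 j).
Proof.
rewrite /contact => c1 c2.
have := fh_ge a v; have := fh_ge b u.
have fin x y r : (f x + h y + r%:E)%E \is a fin_num ->
    exists r1 r2, f x = r1%:E /\ h y = r2%:E.
  have := f0 x; have := h0 y; case: (f x) => [r1| |]//; case: (h y) => [r2| |]// _ _ _.
  by exists r1, r2.
have [|f1 [h1 [fa hu]]] := fin a u (sqdist a u); first by rewrite c1.
have [|f2 [h2 [fb hv]]] := fin b v (sqdist b v); first by rewrite c2.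
move: c1 c2; rewrite fa hu fb hv -!EFinD => -[c1] [c2]; rewrite !lee_fin => g1 g2.
have := sqdist_swap a b u v; lra.
Qed.

Hypothesis nullmu : line_null.

Lemma measurable_contact (W : E -> E) :
  measurable_fun setT W -> measurable [set x | contact x (W x)].
Proof.
move=> mW; rewrite -[X in measurable X]setTI.
apply: emeasurable_fun_eq => //.
  apply: emeasurable_funD; first apply: emeasurable_funD => //.
    exact: measurableT_comp mh mW.
  by apply/measurable_EFinP; apply: measurable_sqdist.
apply/measurable_EFinP; apply: measurable_funD; apply: measurable_sqdist => //.
Qed.

Lemma measurable_contact_gap (U V : E -> E) (j : 'I_d) (q : R) :
  measurable_fun setT U -> measurable_fun setT V ->
  measurable [set x | [/\ contact x (U x), contact x (V x), U x 0 j < q & q < V x 0 j]].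
Proof.
move=> mU mV.
rewrite [X in measurable X](_ : _ = [set x | contact x (U x)] `&` [set x | contact x (V x)] `&`
   (U @^-1` [set x | x 0 j < q] `&` V @^-1` [set x | q < x 0 j])); last first.
  by apply/seteqP; split=> x /=; [move=> [? ? ? ?]; split|move=> [[? ?] [? ?]]; split].
have mj (B : set R) : measurable B -> measurable [set x : E | B (x 0 j)].
  by move=> mB; rewrite -[X in measurable X]setTI; apply: (measurable_coord 0 j).
apply: measurableI; apply: measurableI.
- exact: measurable_contact.
- exact: measurable_contact.
- rewrite -[X in measurable X]setTI; apply: mU => //.
  rewrite [X in measurable X](_ : _ = [set x : E | `]-oo, q[%classic (x 0 j)]); first exact: mj.
  by apply/seteqP; split=> x /=; rewrite in_itv.
- rewrite -[X in measurable X]setTI; apply: mV => //.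
  rewrite [X in measurable X](_ : _ = [set x : E | `]q, +oo[%classic (x 0 j)]); first exact: mj.
  by apply/seteqP; split=> x /=; rewrite in_itv/= andbT.
Qed.

(** Two such points on a line parallel to the axis [j] would contradict
    monotonicity in one of the two orders: on that line only the [j]-th term of
    the scalar product survives. *)
Lemma contact_null (U V : E -> E) (j : 'I_d) (q : R) :
  measurable_fun setT U -> measurable_fun setT V ->
  mu [set x | [/\ contact x (U x), contact x (V x), U x 0 j < q & q < V x 0 j]] = 0%E.
Proof.
move=> mU mV; apply: (nullmu (j := j)); first exact: measurable_contact_gap.
move=> u v [cuU cuV uq qu] [cvU cvV vq qv] uv.
have key a b A B : contact a A -> contact b B -> (forall k, k != j -> a 0 k = b 0 k) ->
    A 0 j < q -> q < B 0 j -> a 0 j <= b 0 j.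
  move=> ca cb ab Aq qB; have := contact_monotone ca cb.
  rewrite (bigD1 j)//= big1 ?addr0; last by move=> k kj; rewrite ab// subrr mul0r.
  have : A 0 j - B 0 j < 0 by lra.
  move=> H; rewrite nmulr_lge0// subr_le0; exact.
apply/eqP; rewrite eq_le; apply/andP; split.
  exact: key cuU cvV uv uq qv.
by apply: key cvU cuV _ vq qu => k kj; rewrite uv.
Qed.

(** If two values differ, a rational separates them in some coordinate; there are
    countably many choices of both. *)
Lemma contact_unique (U V : E -> E) :
  measurable_fun setT U -> measurable_fun setT V ->
  {ae mu, forall x, contact x (U x)} -> {ae mu, forall x, contact x (V x)} ->
  {ae mu, forall x, U x = V x}.
Proof.
move=> mU mV cU cV.
have H (W W' : E -> E) : measurable_fun setT W -> measurable_fun setT W' ->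
    {ae mu, forall x, forall jq : 'I_d * rat, ~ [/\ contact x (W x), contact x (W' x),
      W x 0 jq.1 < ratr jq.2 & ratr jq.2 < W' x 0 jq.1]}.
  move=> mW mW'.
  suff : forall n : nat, {ae mu, forall x, forall jq : 'I_d * rat, unpickle n = Some jq ->
    ~ [/\ contact x (W x), contact x (W' x),
      W x 0 jq.1 < ratr jq.2 & ratr jq.2 < W' x 0 jq.1]}.
    move=> /ae_foralln; apply: filterS => x Hx jq; apply: (Hx (pickle jq)).
    by rewrite pickleK.
  move=> n; case: (unpickle n) => [jq|]; last by apply: aeW.
  apply: (@filterS _ _ _ (fun x => ~ [/\ contact x (W x), contact x (W' x),
      W x 0 jq.1 < ratr jq.2 & ratr jq.2 < W' x 0 jq.1])); first by move=> x Hx _ [<-].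
  exists [set x | [/\ contact x (W x), contact x (W' x),
      W x 0 jq.1 < ratr jq.2 & ratr jq.2 < W' x 0 jq.1]]; split.
  - exact: measurable_contact_gap.
  - exact: contact_null.
  - by move=> x /= /contrapT.
have H1 := H _ _ mU mV; have H2 := H _ _ mV mU.
have cUV : {ae mu, forall x, contact x (U x) /\ contact x (V x)}.
  by apply: filterS2 cU cV => x.
apply: filterS3 H1 H2 cUV => x {}H1 {}H2 [cUx cVx].
apply/rowP => j; apply/eqP; rewrite eq_le; apply/andP; split; rewrite leNgt; apply/negP => UV.
  have [q] := rat_in_itvoo UV; rewrite in_itv/= => /andP[q1 q2].
  by apply: (H2 (j, q)).
have [q] := rat_in_itvoo UV; rewrite in_itv/= => /andP[q1 q2].
by apply: (H1 (j, q)).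
Qed.

End uniqueness.
End line_null.

Section optimal_map.
Context {R : realType} {d : nat}.
Local Notation E := 'rV[R]_d.

Lemma sqdist_le2 (x y z : E) : sqdist x z <= 2 * sqdist x y + 2 * sqdist y z.
Proof.
rewrite /sqdist !mulr_sumr -big_split/=; apply: ler_sum => j _.
have := sqr_ge0 ((x 0 j - y 0 j) - (y 0 j - z 0 j)); lra.
Qed.

Lemma sqdistx0 (x : E) : sqdist x 0 = enorm x ^+ 2.
Proof. by rewrite -sqdistE subr0. Qed.

Lemma second_moment_sqdist (mu : probability E R) (y : E) :
  finite_second_moment mu -> (\int[mu]_x (sqdist x y)%:E < +oo)%E.
Proof.
rewrite /finite_second_moment; under eq_integral do rewrite -sqdistx0.
move=> mu2; have m0 y' : measurable_fun setT (fun x : E => sqdist x y').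
  by apply: measurable_sqdist.
apply: (@le_lt_trans _ _ (\int[mu]_x (2 * sqdist x 0 + 2 * sqdist 0 y)%:E)%E).
  apply: ge0_le_integral_EFin => //.
  - by apply: measurable_funD => //; exact: measurable_funM.
  - by move=> x; exact: sqdist_ge0.
  - by move=> x; exact: sqdist_le2.
rewrite ge0_integral_EFinD//; last 3 first.
- exact: measurable_funM.
- by move=> x; rewrite mulr_ge0// sqdist_ge0.
- by move=> x; rewrite mulr_ge0// sqdist_ge0.
rewrite ge0_integral_EFinZ//; last by move=> x; exact: sqdist_ge0.
have := integral_cst mu measurableT (2 * sqdist 0 y)%:E.
rewrite /= probability_setT mule1 => ->; rewrite lte_add_pinfty ?ltry//.
by rewrite lte_mul_pinfty.
Qed.

Lemma integral_transport (mu nu : probability E R) (T : E -> E) (k : E -> \bar R) :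
  transport_map mu nu T -> measurable_fun setT k -> (forall x, (0 <= k x)%E) ->
  (\int[mu]_x k (T x) = \int[nu]_y k y)%E.
Proof.
move=> [mT TE] mk k0.
have := ge0_integral_pushforward mT mu measurableT mk (fun y _ => k0 y).
rewrite preimage_setT => <-.
by apply: eq_measure_integral => A mA _; exact: TE.
Qed.

(** With [g W] the right-hand side of the duality inequality at [y = W x], the
    integral of [g W] is the same for all maps [W] from [mu] to [nu], and so is
    that of [f x + h (W x)].  As [S] attains equality and [T] costs no more than
    [S], the map [T] attains equality too, almost everywhere. *)
Lemma transport_map_unique (mu nu : probability E R) (M : set (E * E))
    (z0 : E * E) (S T : E -> E) :
  line_null mu -> finite_second_moment mu -> finite_second_moment nu ->
  cyc_monotone M -> M z0 ->
  transport_map mu nu S -> transport_map mu nu T ->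
  {ae mu, forall x, M (x, S x)} ->
  (\int[mu]_x (sqdist x (T x))%:E <= \int[mu]_x (sqdist x (S x))%:E)%E ->
  {ae mu, forall x, T x = S x}.
Proof.
move=> nullmu mu2 nu2 cmM Mz0 tS tT MS costTS.
have [f [h [[mf mh] [f0 h0] fh_ge fh_eq]]] := kantorovich_potentials cmM Mz0.
have [mS SE] := tS; have [mT TE] := tT.
pose F W x : \bar R := (f x + h (W x) + (sqdist x (W x))%:E)%E.
pose g (W : E -> E) x : R := sqdist x z0.2 + sqdist z0.1 (W x).
have mc (W : E -> E) : measurable_fun setT W -> measurable_fun setT (fun x : E => (sqdist x (W x))%:E).
  by move=> mW; apply/measurable_EFinP; apply: measurable_sqdist.
have mhW (W : E -> E) : measurable_fun setT W -> measurable_fun setT (fun x : E => h (W x)).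
  by move=> mW; exact: measurableT_comp mh mW.
have mF W : measurable_fun setT W -> measurable_fun setT (F W).
  move=> mW; apply: emeasurable_funD; last exact: mc.
  by apply: emeasurable_funD => //; exact: mhW.
have mg W : measurable_fun setT W -> measurable_fun setT (g W).
  by move=> mW; apply: measurable_funD; apply: measurable_sqdist.
have g0 W x : 0 <= g W x by rewrite addr_ge0 ?sqdist_ge0.
have c0 (W : E -> E) (x : E) : (0 <= (sqdist x (W x))%:E)%E by rewrite lee_fin sqdist_ge0.
have IF W : transport_map mu nu W -> (\int[mu]_x F W x =
    \int[mu]_x f x + \int[nu]_y h y + \int[mu]_x (sqdist x (W x))%:E)%E.
  move=> tW; have [mW _] := tW.
  rewrite ge0_integralD//; last 3 first.
  - by move=> x _; rewrite adde_ge0.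
  - by apply: emeasurable_funD => //; exact: mhW.
  - exact: mc.
  by rewrite ge0_integralD// ?(integral_transport tW)//; exact: mhW.
have mz : measurable_fun setT (fun y : E => sqdist z0.1 y) by apply: measurable_sqdist.
have Ig W : transport_map mu nu W -> (\int[mu]_x (g W x)%:E =
    \int[mu]_x (sqdist x z0.2)%:E + \int[nu]_y (sqdist z0.1 y)%:E)%E.
  move=> tW; have [mW _] := tW.
  rewrite ge0_integral_EFinD//; last 4 first.
  - by apply: measurable_sqdist.
  - by apply: measurable_sqdist.
  - by move=> x; exact: sqdist_ge0.
  - by move=> x; exact: sqdist_ge0.
  congr (_ + _)%E.
  apply: (integral_transport (k := fun y => (sqdist z0.1 y)%:E) tW).
    exact/measurable_EFinP.
  by move=> x; rewrite lee_fin sqdist_ge0.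
have Igoo W : transport_map mu nu W -> (\int[mu]_x (g W x)%:E < +oo)%E.
  move=> tW; rewrite Ig// lte_add_pinfty//; first exact: second_moment_sqdist.
  by under eq_integral do rewrite sqdistC; exact: second_moment_sqdist.
have cS : {ae mu, forall x, contact f h z0 x (S x)}.
  by apply: filterS MS => x; exact: fh_eq.
have FS : (\int[mu]_x F S x = \int[mu]_x (g S x)%:E)%E.
  apply: ge0_ae_eq_integral => //.
  - exact: mF.
  - by apply/measurable_EFinP; exact: mg.
  - by move=> x _; rewrite !adde_ge0.
  - by move=> x _; rewrite lee_fin.
  - by apply: filterS cS => x.
have FT : (\int[mu]_x F T x <= \int[mu]_x (g T x)%:E)%E.
  by rewrite (Ig T)// -(Ig S)// -FS IF// IF// leeD2l.
have cT : {ae mu, forall x, contact f h z0 x (T x)}.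
  have := ae_eq_of_le_integral (mF _ mT) (mg _ mT) (g0 T) (fun x => fh_ge x (T x)) FT (Igoo _ tT).
  by apply: filterS => x.
exact: contact_unique cT cS.
Qed.

End optimal_map.

(** * Limits of supports *)

Section limit_support.
Context {U V : topologicalType}.
Variables (F : set_system nat) (supp : nat -> set (U * V)).
Hypothesis UF : UltraFilter F.

Definition limit_support : set (U * V) :=
  [set z | forall W, nbhs z W -> \forall n \near F, supp n `&` W !=set0].

Lemma closed_limit_support : closed limit_support.
Proof.
move=> z clz W; rewrite nbhsE => -[N [opN Nz] NW].
have [w [Mw Nw]] := clz N (open_nbhs_nbhs (conj opN Nz)).
have := Mw N (open_nbhs_nbhs (conj opN Nw)).
by apply: filterS => n [v [sv Nv]]; exists v; split => //; exact: NW.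
Qed.

(** Each point of the compact set has a neighbourhood that the supports do not
    meet for [F]-many ranks (for an ultrafilter, not meeting it eventually is the
    negation of meeting it eventually); finitely many neighbourhoods suffice. *)
Lemma compact_escape (K : set (U * V)) : compact K -> K `&` limit_support = set0 ->
  \forall n \near F, K `&` supp n = set0.
Proof.
move=> /compact_near_coveringP cK KM.
suff : \forall n \near F, K `<=` (fun z => ~ supp n z).
  apply: filterS => n H; apply/seteqP; split => // z [/H].
  by [].
apply: (cK nat F (fun n z => ~ supp n z)) => z Kz.
have : ~ limit_support z.
  by move=> Mz; have : (K `&` limit_support) z by []; rewrite KM.
move=> /existsNP[W /not_implyP[zW nF]].
have FN : F [set n | supp n `&` W = set0].
  have [//|H] := in_ultra_setVsetC [set n | supp n `&` W !=set0] UF.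
  by apply: filterS H => n /= /set0P/negP/negPn/eqP.
exists (W, [set n | supp n `&` W = set0]) => //= -[v n] [/= Wv sn] sv.
by have : (supp n `&` W) v by []; rewrite sn.
Qed.

(** The set-valued preimage of [B] when [M] is read as a correspondence. *)
Definition section_hits (M : set (U * V)) (B : set V) : set U :=
  [set x | exists2 y, B y & M (x, y)].

(** The projection along a compact factor is a closed map. *)
Lemma closed_section_hits (M : set (U * V)) (B : set V) :
  closed M -> compact B -> closed (section_hits M B).
Proof.
move=> cM /compact_near_coveringP cB; rewrite -[section_hits _ _]setCK.
apply: open_closedC; rewrite openE => x /= nx.
suff : \forall x' \near x, B `<=` (fun y => ~ M (x', y)).
  by apply: filterS => x' H [y By My]; exact: H By My.
apply: (cB U (nbhs x) (fun x' y => ~ M (x', y))) => y By.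
have : nbhs (x, y) (~` M).
  apply: open_nbhs_nbhs; split; first exact: closed_openC.
  by move=> Mxy; apply: nx; exists y.
case=> -[A D] [xA yD] AD.
by exists (D, A) => //= -[y1 x1] [/= Dy1 Ax1]; apply: (AD (x1, y1)).
Qed.

End limit_support.

Section limit_cyc_monotone.
Context {R : realType} {d : nat}.
Local Notation E := 'rV[R]_d.

Lemma cvg_sqdist (T : Type) (F : set_system T) {FF : Filter F} (f g : T -> E) (a b : E) :
  f @ F --> a -> g @ F --> b -> sqdist (f t) (g t) @[t --> F] --> sqdist a b.
Proof.
move=> fa gb; rewrite /sqdist; apply: cvg_sumr => j.
have c1 : f t 0 j @[t --> F] --> a 0 j.
  by apply: (cvg_comp f (fun x : E => x 0 j) fa); exact: coord_continuous.
have c2 : g t 0 j @[t --> F] --> b 0 j.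
  by apply: (cvg_comp g (fun x : E => x 0 j) gb); exact: coord_continuous.
by apply: (@cvgM _ _ _ _ (fun t => f t 0 j - g t 0 j) (fun t => f t 0 j - g t 0 j)); exact: cvgB.
Qed.

(** One term of the sum in [cyc_monotone]. *)
Definition swap_gain (z w : E * E) : R := sqdist z.1 z.2 - sqdist w.1 z.2.

Lemma swap_gain_ball (z w : E * E) (e : R) : 0 < e ->
  \forall r \near 0^'+, forall z' w', ball z r z' -> ball w r w' ->
    swap_gain z w - e < swap_gain z' w'.
Proof.
move=> e0.
have c : (fun p : (E * E) * (E * E) => swap_gain p.1 p.2) @ (z, w) --> swap_gain z w.
  have f1 : fst @ (z, w) --> z by exact: cvg_fst.
  have f2 : snd @ (z, w) --> w by exact: cvg_snd.
  have z1 : (fst \o fst) @ (z, w) --> z.1 by apply: (cvg_comp _ _ f1); exact: cvg_fst.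
  have z2 : (snd \o fst) @ (z, w) --> z.2 by apply: (cvg_comp _ _ f1); exact: cvg_snd.
  have w1 : (fst \o snd) @ (z, w) --> w.1 by apply: (cvg_comp _ _ f2); exact: cvg_fst.
  by apply: cvgB; apply: cvg_sqdist.
have lt : swap_gain z w - e < swap_gain z w by rewrite ltrBlDr ltrDl.
have : nbhs ((z, w) : (E * E) * (E * E)) [set p | swap_gain z w - e < swap_gain p.1 p.2].
  exact: cvgr_gt _ c _ lt.
move=> /nbhs_ballP[r /= r0 H].
near=> s => z' w' zz' ww'; apply: (H (z', w')); split => /=.
  by apply: le_ball zz'; near: s; exact: nbhs_right_le.
by apply: le_ball ww'; near: s; exact: nbhs_right_le.
Unshelve. all: by end_near. Qed.

(** The points of a cycle of the limit are approached, at one common rank, by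
    points of the support at that rank; since the cost is continuous, the sum
    along the nearby cycle is close to the given one. *)
Lemma limit_support_cyc_monotone (F : set_system nat) (supp : nat -> set (E * E)) :
  ProperFilter F -> (\forall n \near F, cyc_monotone (supp n)) ->
  cyc_monotone (limit_support F supp).
Proof.
move=> PF cms k z Mz zk.
case: k zk => [|k] zk; first by rewrite big_ord0.
set G := \sum_(_ < _) _; apply/ler_addgt0Pr => e e0; rewrite add0r.
pose e' := e / k.+1%:R; have e'0 : 0 < e' by rewrite divr_gt0.
have Hi : \forall r \near (0 : R)^'+, forall i : 'I_k.+1, forall z' w',
    ball (z i) r z' -> ball (z i.+1) r w' ->
    swap_gain (z i) (z i.+1) - e' < swap_gain z' w'.
  exact: (@filter_forall R 'I_k.+1 (fun i r => forall z' w', ball (z i) r z' ->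
    ball (z i.+1) r w' -> swap_gain (z i) (z i.+1) - e' < swap_gain z' w')
    (0 : R)^'+ _ (fun i => swap_gain_ball _ _ e'0)).
have [r [r0 Hr]] := filter_ex (filterI (nbhs_right_gt (0 : R)) Hi).
have : \forall n \near F, cyc_monotone (supp n) /\
    forall i : 'I_k.+1, supp n `&` ball (z i) r !=set0.
  apply: filterI => //; apply: (@filter_forall _ _ (fun (i : 'I_k.+1) n => supp n `&` ball (z i) r !=set0)) => i.
  by apply: (Mz i); exact: nbhsx_ballx.
move=> /filter_ex[n [cmn sn]].
have /choice[w Hw] : forall i : 'I_k.+1, exists y, (supp n `&` ball (z i) r) y by exact: sn.
(* reducing the index modulo the length of the cycle closes the nearby cycle up *)
pose z' i := w (inord (i %% k.+1)).
have Mz' i : supp n (z' i) by have [] := Hw (inord (i %% k.+1)).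
have z'k : z' k.+1 = z' 0%N by rewrite /z' modnn mod0n.
have zmod i : (i <= k.+1)%N -> z i = z (i %% k.+1)%N.
  rewrite leq_eqVlt => /orP[/eqP ->|ik]; first by rewrite modnn.
  by rewrite modn_small.
have Bz' i : (i <= k.+1)%N -> ball (z i) r (z' i).
  move=> ik; rewrite zmod//; have [_] := Hw (inord (i %% k.+1)).
  by rewrite inordK// ltn_mod.
have := cmn k.+1 z' Mz' z'k; set G' := \sum_(_ < _) _ => G'0.
have : G - e <= G'.
  have -> : e = \sum_(i < k.+1) e'.
    by rewrite sumr_const card_ord -mulr_natr divfK.
  rewrite /G -sumrB; apply: ler_sum => i _; apply: ltW.
  by apply: Hr; apply: Bz'; rewrite // ltnW.
lra.
Qed.

End limit_cyc_monotone.

(** * Rational boxes *)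

Section closed_boxes.
Context {R : realType} {d : nat}.
Local Notation E := 'rV[R]_d.
Local Notation code := ('rV[rat]_d * nat)%type.

(** A code is a rational centre and a radius [1 / (k+1)].  The finite unions of
    such boxes are countably many compact sets, which approximate every open set
    from inside. *)
Definition cbox (c : code) : set E :=
  [set x | forall j, `|ratr (c.1 0 j) - x 0 j| <= c.2.+1%:R^-1].

Definition cboxes (s : seq code) : set E := [set x | exists2 c, c \in s & cbox c x].

Lemma cbox_compact c : compact (cbox c).
Proof.
have := @rV_compact R d (fun j => `[ratr (c.1 0 j) - c.2.+1%:R^-1, ratr (c.1 0 j) + c.2.+1%:R^-1]%classic).
move=> /(_ (fun j => @segment_compact _ _ _)).
congr compact; apply/seteqP; split=> x /= H j; have := H j;
  by rewrite /= in_itv/= -ler_distlC.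
Qed.

Lemma cboxes_cons c s : cboxes (c :: s) = cbox c `|` cboxes s.
Proof.
apply/seteqP; split=> x /=.
  move=> [c' c's c'x]; move: c's; rewrite inE => /orP[/eqP <-|c's]; first by left.
  by right; exists c'.
move=> [cx|[c' c's c'x]]; first by exists c => //; rewrite mem_head.
by exists c' => //; rewrite inE c's orbT.
Qed.

Lemma cboxes_compact s : compact (cboxes s).
Proof.
elim: s => [|c s IH]; last by rewrite cboxes_cons; apply: compactU => //; exact: cbox_compact.
rewrite (_ : cboxes [::] = set0); first exact: compact0.
by apply/seteqP; split=> x // [].
Qed.

Lemma closed_measurable_rV (A : set E) : closed A -> measurable A.
Proof.
move=> cA; rewrite -[A]setCK; apply: measurableC; apply: mx_open_measurable.
exact: closed_openC.
Qed.

Lemma cboxes_closed s : closed (cboxes s).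
Proof. by apply: compact_closed; [exact: norm_hausdorff|exact: cboxes_compact]. Qed.

Lemma cbox_closed c : closed (cbox c).
Proof. by apply: compact_closed; [exact: norm_hausdorff|exact: cbox_compact]. Qed.

Lemma measurable_cbox c : measurable (cbox c).
Proof. by apply: closed_measurable_rV; exact: cbox_closed. Qed.

Lemma measurable_cboxes s : measurable (cboxes s).
Proof. by apply: closed_measurable_rV; exact: cboxes_closed. Qed.

Lemma cbox_dense (x : E) (k : nat) : exists q, cbox (q, k) x.
Proof.
have k0 : 0 < k.+1%:R^-1 :> R by rewrite invr_gt0.
have hq j : {q : rat | `|ratr q - x 0 j| <= k.+1%:R^-1}.
  have : x 0 j - k.+1%:R^-1 < x 0 j + k.+1%:R^-1 by rewrite ltrBlDr -addrA ltrDl addr_gt0.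
  move=> /rat_in_itvoo/cid[q]; rewrite in_itv/= -ltr_distlC => Mq.
  by exists q; rewrite distrC ltW.
by exists (\row_j sval (hq j)) => j /=; rewrite mxE; exact: (svalP (hq j)).
Qed.

Lemma cbox_diam q k (x y : E) j : cbox (q, k) x -> cbox (q, k) y ->
  `|x 0 j - y 0 j| <= 2 * k.+1%:R^-1.
Proof.
move=> /(_ j)/= hx /(_ j)/= hy.
have -> : x 0 j - y 0 j = (ratr (q 0 j) - y 0 j) - (ratr (q 0 j) - x 0 j) by ring.
by rewrite (le_trans (ler_normB _ _))// mulr_natl mulr2n lerD.
Qed.

Lemma cbox_open_bigcup (U : set E) : open U ->
  U = \bigcup_(c in [set c | cbox c `<=` U]) cbox c.
Proof.
move=> oU; apply/seteqP; split=> [x Ux|x [c cU]]; last exact: cU.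
have /nbhs_ballP[e /= e0 eU] : nbhs x U by rewrite nbhsE; exists U.
have [k ke] : exists k : nat, 2 * k.+1%:R^-1 < e.
  exists (Num.truncn (2 / e)); rewrite ltr_pdivrMr// mulrC -ltr_pdivrMr//.
  exact: truncnS_gt.
have [q qx] := cbox_dense x k; exists (q, k) => // y qy; apply: eU; split => // i j.
rewrite (ord1 i); apply: le_lt_trans ke; exact: cbox_diam qx qy.
Qed.

Lemma cbox_setT k : [set: E] = \bigcup_(c in [set c | c.2 = k]) cbox c.
Proof.
apply/seteqP; split=> // x _; have [q qx] := cbox_dense x k.
by exists (q, k).
Qed.

(** Continuity from below along an enumeration of the codes. *)
Lemma cboxes_inner (lambda : probability E R) (D : set code) (e : R) : 0 < e ->
  exists s, (forall c, c \in s -> D c) /\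
    (lambda (\bigcup_(c in D) cbox c) <= lambda (cboxes s) + e%:E)%E.
Proof.
move=> e0.
pose s N := [seq c <- pmap (@choice.unpickle code) (iota 0 N) | `[<D c>]].
have sD N c : c \in s N -> D c by rewrite mem_filter => /andP[/asboolP].
have mem_s N c : D c -> (choice.pickle c < N)%N -> c \in s N.
  move=> Dc cN; rewrite mem_filter asboolT//=.
  rewrite mem_pmap; apply/mapP; exists (choice.pickle c); last by rewrite choice.pickleK.
  by rewrite mem_iota.
have nd : nondecreasing_seq (fun N => cboxes (s N)).
  move=> N N' NN'; apply/subsetPset => x [c cs cx]; exists c => //.
  move: cs; rewrite !mem_filter => /andP[-> /=]; rewrite !mem_pmap => /mapP[i].
  rewrite mem_iota => /andP[_ iN] ci; apply/mapP; exists i => //.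
  by rewrite mem_iota/= add0n (leq_trans _ NN').
have UE : \bigcup_N cboxes (s N) = \bigcup_(c in D) cbox c.
  apply/seteqP; split=> x.
    by move=> [N _ [c cs cx]]; exists c => //; exact: sD cs.
  by move=> [c Dc cx]; exists (choice.pickle c).+1 => //; exists c => //; exact: mem_s.
have mUE : measurable (\bigcup_N cboxes (s N)).
  by apply: bigcupT_measurable => N; exact: measurable_cboxes.
set l := lambda (\bigcup_(c in D) _).
have lf : l \is a fin_num by apply: fin_num_measure; rewrite -UE.
have : (lambda (cboxes (s N)) @[N --> \oo] --> (fine l)%:E)%E.
  rewrite (fineK lf) /l -UE.
  exact: (nondecreasing_cvg_mu (fun N => measurable_cboxes (s N)) mUE nd).
move=> /fine_cvgP[_] /cvgrPdist_lt /(_ e e0)[N _ /(_ N (leqnn N))/=].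
move=> lN; exists (s N); split; first exact: sD.
have sf : lambda (cboxes (s N)) \is a fin_num by apply: fin_num_measure; exact: measurable_cboxes.
rewrite -(fineK lf) -(fineK sf) -EFinD lee_fin -lerBlDl.
by move: lN; rewrite ltr_norml => /andP[_ /ltW].
Qed.

End closed_boxes.

Section real_probability.
Context {dT : measure_display} {T : measurableType dT} {R : realType}.
Variable lambda : probability T R.

(** Probabilities as real numbers, the form in which they enter limits. *)
Definition pr (A : set T) : R := fine (lambda A).

Lemma prE A : measurable A -> lambda A = (pr A)%:E.
Proof. by move=> mA; rewrite fineK// fin_num_measure. Qed.

Lemma pr_ge0 A : 0 <= pr A.
Proof. by rewrite /pr fine_ge0// measure_ge0. Qed.

Lemma pr_le A B : measurable A -> measurable B -> A `<=` B -> pr A <= pr B.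
Proof. by move=> mA mB AB; rewrite -lee_fin -!prE// le_measure// inE. Qed.

Lemma prC A : measurable A -> pr (~` A) = 1 - pr A.
Proof.
move=> mA; apply: EFin_inj; rewrite -prE; last exact: measurableC.
by rewrite probability_setC// prE.
Qed.

Lemma prDI A B : measurable A -> measurable B -> pr A = pr (A `\` B) + pr (A `&` B).
Proof.
move=> mA mB; apply: EFin_inj; rewrite EFinD -!prE//; first exact: measureDI.
- exact: measurableI.
- exact: measurableD.
Qed.

End real_probability.

Section box_probability.
Context {R : realType} {d : nat}.
Local Notation E := 'rV[R]_d.
Local Notation code := ('rV[rat]_d * nat)%type.

Lemma measurable_bigcup_cbox (D : set code) :
  measurable (\bigcup_(c in D) @cbox R d c).
Proof.
rewrite bigcup_mkcond; apply: countable_bigcupT_measurable => // c.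
by case: ifPn => // _; exact: measurable_cbox.
Qed.

Lemma cboxes_inner_pr (lambda : probability E R) (D : set code) (e : R) : 0 < e ->
  exists s, (forall c, c \in s -> D c) /\
    pr lambda (\bigcup_(c in D) cbox c) <= pr lambda (cboxes s) + e.
Proof.
move=> e0; have [s [sD le]] := cboxes_inner lambda D e0; exists s; split => //.
move: le; rewrite prE; last exact: measurable_bigcup_cbox.
by rewrite prE; [rewrite -EFinD lee_fin|exact: measurable_cboxes].
Qed.

Lemma cboxes_inner_open (lambda : probability E R) (U : set E) (e : R) :
  open U -> 0 < e ->
  exists s, cboxes s `<=` U /\ pr lambda U <= pr lambda (cboxes s) + e.
Proof.
move=> oU e0; rewrite {2}(cbox_open_bigcup oU).
have [s [sD le]] := cboxes_inner_pr lambda [set c | cbox c `<=` U] e0.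
by exists s; split => // x [c /sD]; exact.
Qed.

(** The inequality passes from box unions to open sets by inner approximation,
    hence in the other direction to closed sets by taking complements, and from
    these back to open sets: both measures agree on open sets, which generate. *)
Lemma probability_eq_cboxes (l1 l2 : probability E R) :
  (forall s, pr l1 (cboxes s) <= pr l2 (cboxes s)) ->
  forall A, measurable A -> l1 A = l2 A.
Proof.
move=> l12.
have le_open U : open U -> pr l1 U <= pr l2 U.
  move=> oU; apply/ler_addgt0Pr => e e0.
  have [s [sU /le_trans]] := cboxes_inner_open l1 oU e0; apply.
  rewrite lerD2r (le_trans (l12 s))// pr_le//; first exact: measurable_cboxes.
  exact: mx_open_measurable.
have le_closed C : closed C -> pr l2 C <= pr l1 C.
  move=> cC; have mC := closed_measurable_rV cC.
  have := le_open (~` C) (closed_openC cC); rewrite !prC//; lra.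
have ge_open U : open U -> pr l2 U <= pr l1 U.
  move=> oU; apply/ler_addgt0Pr => e e0.
  have [s [sU /le_trans]] := cboxes_inner_open l2 oU e0; apply.
  rewrite lerD2r (le_trans (le_closed _ (@cboxes_closed _ _ s)))// pr_le//.
    exact: measurable_cboxes.
  exact: mx_open_measurable.
apply: (@measure_unique _ R _ (open : set (set E)) (fun=> setT)) => //.
- by move=> A B; exact: openI.
- by move=> _; exact: openT.
- by rewrite bigcup_const.
- move=> A oA; have mA := mx_open_measurable oA.
  apply: etrans (prE l1 mA) _; apply: etrans _ (esym (prE l2 mA)).
  by congr EFin; apply/eqP; rewrite eq_le le_open// ge_open.
- by move=> _; apply: le_lt_trans (probability_le1 l1 measurableT) _; exact: ltry.
Qed.

End box_probability.

Section plans.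
Context {R : realType} {U V : Type}.

(** What the stability argument needs of a probability concentrated on [S]; it is
    stated for all sets, because the plans in question have finite support. *)
Definition plan_like (G : set (U * V) -> R) (S : set (U * V)) : Prop :=
  [/\ forall A, 0 <= G A, forall A B, G A = G (A `&` B) + G (A `\` B),
      forall A, A `&` S = set0 -> G A = 0 & G setT = 1].

Lemma plan_le G S A B : plan_like G S -> A `<=` B -> G A <= G B.
Proof.
move=> [G0 GD _ _] AB; rewrite (GD B A) setIidr// lerDl; exact: G0.
Qed.

(** If [Q * B] misses the support, the mass of [A * B] sits above the complement of
    [Q]: an upper bound by a marginal. *)
Lemma plan_escape G S (A : set U) (B : set V) (Q : set U) : plan_like G S ->
  (Q `*` B) `&` S = set0 -> G (A `*` B) <= G ((A `\` Q) `*` setT).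
Proof.
move=> pG QB; have [_ GD G0 _] := pG.
rewrite (GD _ (Q `*` setT)) (G0 (_ `&` _)); last first.
  apply/seteqP; split => // -[x y] [[[/= Ax By] [/= Qx _]] Sxy].
  by have : ((Q `*` B) `&` S) (x, y) by []; rewrite QB.
rewrite add0r; apply: (plan_le pG) => -[x y] /= [[Ax By] nQ]; split => //=; split => // Qx.
exact: nQ.
Qed.

End plans.

(** * The map carried by a closed cyclically monotone set *)

Section selection.
Context {R : realType} {d : nat}.
Local Notation E := 'rV[R]_d.
Local Notation code := ('rV[rat]_d * nat)%type.

Lemma cyc_monotone_pair (M : set (E * E)) a u b v : cyc_monotone M ->
  M (a, u) -> M (b, v) -> 0 <= \sum_j (a 0 j - b 0 j) * (u 0 j - v 0 j).
Proof.
move=> cm Mau Mbv.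
pose z (i : nat) := if odd i then (b, v) else (a, u).
have Mz i : M (z i) by rewrite /z; case: ifP.
have := cm 2%N z Mz erefl; rewrite big_ord_recr big_ord1 /z /= => H.
have := sqdist_swap a b u v; lra.
Qed.

Variables (mu : probability E R) (M : set (E * E)).
Hypotheses (nullmu : line_null mu) (cM : closed M) (cmM : cyc_monotone M).

(** A closed set is a countable union of compact ones, so that [section_hits M B]
    is a countable union of closed sets. *)
Lemma measurable_section_hits (B : set E) : closed B -> measurable (section_hits M B).
Proof.
move=> cB.
have -> : section_hits M B = \bigcup_(c : code) section_hits M (B `&` cbox c).
  apply/seteqP; split=> [x [y By Mxy]|x [c _ [y [By _] Mxy]]]; last by exists y.
  have [q qy] := cbox_dense y 0; exists (q, 0%N) => //; by exists y.
apply: countable_bigcupT_measurable => // c; apply: closed_measurable_rV.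
apply: closed_section_hits => //; rewrite setIC; apply: compact_closedI => //.
exact: cbox_compact.
Qed.

(** As for [contact_null]: the points above which [M] has two values separated in
    coordinate [j] meet each line parallel to the axis [j] at most once. *)
Lemma section_gap_null (j : 'I_d) (q r : R) : q < r ->
  mu (section_hits M [set y | y 0 j <= q] `&` section_hits M [set y | r <= y 0 j]) = 0%E.
Proof.
move=> qr.
have cj : continuous (fun y : E => y 0 j) by exact: coord_continuous.
have c1 : closed [set y : E | y 0 j <= q].
  by apply: (@closed_comp _ _ (fun y : E => y 0 j) [set t | t <= q]) => //; exact: closed_le.
have c2 : closed [set y : E | r <= y 0 j].
  by apply: (@closed_comp _ _ (fun y : E => y 0 j) [set t | r <= t]) => //; exact: closed_ge.
apply: (nullmu (j := j)).
  by apply: measurableI; exact: measurable_section_hits.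
move=> a b [[u1 /= u1q Mau1] [u2 /= u2r Mau2]] [[v1 /= v1q Mbv1] [v2 /= v2r Mbv2]] ab.
have key (a' b' A B : E) : M (a', A) -> M (b', B) -> (forall k, k != j -> a' 0 k = b' 0 k) ->
    A 0 j <= q -> r <= B 0 j -> a' 0 j <= b' 0 j.
  move=> Ma Mb ab' Aq rB; have := cyc_monotone_pair cmM Ma Mb.
  rewrite (bigD1 j)//= big1 ?addr0; last by move=> k kj; rewrite ab'// subrr mul0r.
  have AB : A 0 j - B 0 j < 0 by lra.
  by rewrite nmulr_lge0// subr_le0.
apply/eqP; rewrite eq_le; apply/andP; split.
  exact: key Mau1 Mbv2 ab u1q v2r.
by apply: key Mbv1 Mau2 _ v1q u2r => k kj; rewrite ab.
Qed.

(** Outside the null set where [M] has no value or two values, the preimage of a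
    closed set [B] by the selected map is [section_hits M B], hence measurable. *)
Lemma section_selection :
  (forall e, 0 < e -> exists s, 1 - e <= pr mu (section_hits M (cboxes s))) ->
  exists S : E -> E, measurable_fun setT S /\
    {ae mu, forall x, M (x, S x) /\ forall y, M (x, y) -> y = S x}.
Proof.
move=> big.
have /choice[s Hs] : forall n : nat, exists s,
    1 - n.+1%:R^-1 <= pr mu (section_hits M (cboxes s)).
  by move=> n; apply: big; rewrite invr_gt0.
have mH n : measurable (section_hits M (cboxes (s n))).
  by apply: measurable_section_hits; exact: cboxes_closed.
pose D0 := \bigcup_n section_hits M (cboxes (s n)).
have mD0 : measurable D0 by exact: bigcupT_measurable.
have D01 : mu (~` D0) = 0%E.
  rewrite prE; last exact: measurableC.
  congr EFin; apply/eqP; rewrite eq_le pr_ge0 andbT prC//.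
  apply/ler_addgt0Pr => e e0; rewrite add0r.
  have [n ne] : exists n : nat, n.+1%:R^-1 <= e.
    exists (Num.truncn e^-1); rewrite invf_ple ?posrE//.
    by rewrite ltW// truncnS_gt.
  have : pr mu (section_hits M (cboxes (s n))) <= pr mu D0.
    by apply: pr_le => // x Hx; exists n.
  have := Hs n => h1 h2; rewrite lerBlDr -lerBlDl.
  by apply: le_trans (le_trans _ h1) h2; rewrite lerD2l lerN2.
pose gap (t : 'I_d * (rat * rat)) : set E := if ratr t.2.1 < ratr t.2.2 :> R then
  section_hits M [set y | y 0 t.1 <= ratr t.2.1] `&`
  section_hits M [set y | ratr t.2.2 <= y 0 t.1] else set0.
have mgap t : measurable (gap t).
  rewrite /gap; case: ifPn => // _; apply: measurableI; apply: measurable_section_hits.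
    apply: (@closed_comp _ _ (fun y : E => y 0 t.1) [set r | r <= ratr t.2.1]); last exact: closed_le.
    by move=> y _; exact: coord_continuous.
  apply: (@closed_comp _ _ (fun y : E => y 0 t.1) [set r | ratr t.2.2 <= r]); last exact: closed_ge.
  by move=> y _; exact: coord_continuous.
pose N := (~` D0) `|` \bigcup_t gap t.
have mbg : measurable (\bigcup_t gap t) by exact: countable_bigcupT_measurable.
have mN : measurable N by apply: measurableU => //; exact: measurableC.
have gap0 : mu (\bigcup_t gap t) = 0%E.
  apply/negligibleP => //.
  pose g n := if @choice.unpickle ('I_d * (rat * rat))%type n is Some t then gap t else set0.
  apply: (@negligibleS _ _ _ _ (\bigcup_n g n)).
    by move=> x [t _ tx]; exists (choice.pickle t) => //; rewrite /g choice.pickleK.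
  apply: negligible_bigcup => n; rewrite /g; case: choice.unpickle => [t|]; last exact: negligible_set0.
  apply/negligibleP; first exact: mgap.
  rewrite /gap; case: ifPn => [lt|_]; last exact: measure0.
  exact: section_gap_null.
have N0 : mu N = 0%E.
  apply: null_set_setU => //; exact: measurableC.
have exM x : ~ N x -> exists y, M (x, y).
  move=> nN; have : D0 x by apply: contrapT => nD; apply: nN; left.
  by move=> [n _ [y _ Mxy]]; exists y.
have uniM x y y' : ~ N x -> M (x, y) -> M (x, y') -> y = y'.
  move=> nN.
  suff key y1 y2 j : M (x, y1) -> M (x, y2) -> y1 0 j <= y2 0 j.
    by move=> My My'; apply/rowP => j; apply/eqP; rewrite eq_le !key.
  move=> M1 M2; rewrite leNgt; apply/negP => lt.
  have [q] := rat_in_itvoo lt; rewrite in_itv/= => /andP[q1 q2].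
  have [r] := rat_in_itvoo q2; rewrite in_itv/= => /andP[r1 r2].
  apply: nN; right; exists (j, (q, r)) => //; rewrite /gap/= r1; split.
    by exists y2 => //=; exact: ltW.
  by exists y1 => //=; exact: ltW.
pose S x : E := if `[<N x>] then 0 else get [set y | M (x, y)].
have MS x : ~ N x -> M (x, S x).
  move=> nN; rewrite /S asboolF//; have [y My] := exM x nN.
  exact: (@getPex _ [set y | M (x, y)]) (ex_intro _ y My).
exists S; split; last first.
  exists N; split => // x /= H; apply: contrapT => nN; apply: H.
  by split; [exact: MS|move=> y My; exact: (uniM x _ _ nN My (MS x nN))].
have pre_closed B : closed B -> measurable (S @^-1` B).
  move=> cB.
  have -> : S @^-1` B = (section_hits M B `\` N) `|` (N `&` [set x | B 0]).
    apply/seteqP; split=> x /=.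
      move=> BSx; have [Nx|nN] := pselect (N x).
        by right; split => //; move: BSx; rewrite /S asboolT.
      by left; split => //; exists (S x) => //; exact: MS.
    move=> [[[y By Mxy] nN]|[Nx B0]]; first by rewrite -(uniM x _ _ nN Mxy (MS x nN)).
    by rewrite /S asboolT.
  apply: measurableU.
    by apply: measurableD => //; exact: measurable_section_hits.
  apply: measurableI => //; have [B0|nB0] := pselect (B 0).
    by rewrite (_ : [set _ | _] = setT)//; apply/seteqP; split.
  by rewrite (_ : [set _ | _] = set0)//; apply/seteqP; split.
apply: (measurability (open : set (set E))) => // _ [W opW <-]; rewrite setTI.
rewrite -[W]setCK preimage_setC; apply: measurableC.
exact: (pre_closed _ (open_closedC opW)).
Qed.

End selection.

(** * Stability of optimal plans *)

Lemma pr_le_ae (dT : measure_display) (T : measurableType dT) (R : realType)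
    (lambda : probability T R) (A B : set T) : measurable A -> measurable B ->
  {ae lambda, forall x, A x -> B x} -> pr lambda A <= pr lambda B.
Proof.
move=> mA mB [N [mN N0 AB]].
rewrite (prDI lambda mA mN); have -> : pr lambda (A `&` N) = 0.
  apply/eqP; rewrite eq_le pr_ge0 andbT.
  have -> : 0 = pr lambda N by rewrite /pr N0.
  by apply: pr_le => //; exact: measurableI.
rewrite addr0; apply: pr_le => //; first exact: measurableD.
move=> x [Ax nN]; apply: contrapT => nB; apply: nN; apply: AB => /= H.
exact: nB (H Ax).
Qed.

Section plan_stability.
Context {R : realType} {d : nat}.
Local Notation E := 'rV[R]_d.
Variables (mu nu : probability E R) (T : E -> E).
Hypotheses (nullmu : line_null mu).
Hypotheses (mu2 : finite_second_moment mu) (nu2 : finite_second_moment nu).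
Hypothesis tT : transport_map mu nu T.
Hypothesis T_optimal : forall S, transport_map mu nu S ->
  (\int[mu]_x (sqdist x (T x))%:E <= \int[mu]_x (sqdist x (S x))%:E)%E.
Variables (G : nat -> set (E * E) -> R) (supp : nat -> set (E * E)).

(** The hypotheses say that the marginals of the plans converge on the countably
    many sets in use.  The limit [M] of the supports is the graph of a map [S],
    which sends [mu] to [nu] since the mass that the plans send to a box union [B]
    comes, in the limit, from [section_hits M B]; thus [S = T] almost everywhere.  Now
    [section_hits M C] is almost everywhere contained in the preimage of the box
    [C] by [T], so the mass of [(T^-1 (~ C)) * C] has nowhere to come
    from. *)
Lemma plan_stability_ultra (F : set_system nat) : UltraFilter F ->
  (\forall n \near F, cyc_monotone (supp n) /\ plan_like (G n) (supp n)) ->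
  (forall s, G n ((setT `\` cboxes s) `*` setT) @[n --> F] --> pr mu (setT `\` cboxes s)) ->
  (forall s, G n (setT `*` cboxes s) @[n --> F] --> pr nu (cboxes s)) ->
  (forall c s, G n (((T @^-1` ~` cbox c) `\` cboxes s) `*` setT) @[n --> F] -->
     pr mu ((T @^-1` ~` cbox c) `\` cboxes s)) ->
  forall c, G n ((T @^-1` ~` cbox c) `*` cbox c) @[n --> F] --> 0.
Proof.
move=> UF HG H1 H2 H3.
have [mT _] := tT.
have PF : ProperFilter F by exact: ultra_proper.
have FF : Filter F by exact: filter_filter.
pose M := limit_support F supp.
have cM : closed M by exact: closed_limit_support.
have cmM : cyc_monotone M.
  by apply: limit_support_cyc_monotone; apply: filterS HG => n [].
have mC c : measurable (T @^-1` ~` cbox c).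
  by rewrite -[X in measurable X]setTI; apply: mT => //; apply: measurableC; exact: measurable_cbox.
have mH s : measurable (section_hits M (cboxes s)).
  by apply: measurable_section_hits => //; exact: cboxes_closed.
(* from boxes above which M does not meet B, the plans send nothing to B *)
have escape (A : set E) (B : set E) s : compact B ->
    cboxes s `<=` ~` section_hits M B ->
    \forall n \near F, G n (A `*` B) <= G n ((A `\` cboxes s) `*` setT).
  move=> cB sB.
  have cK := compact_setX (@cboxes_compact R d s) cB.
  have KM : (cboxes s `*` B) `&` M = set0.
    by apply/seteqP; split => // -[x y] [[/= sx By] Mxy]; apply: (sB x sx); exists y.
  apply: filterS2 HG (compact_escape UF cK KM) => n [_ pG] Ks.
  exact: plan_escape pG Ks.
have nu_le t : pr nu (cboxes t) <= pr mu (section_hits M (cboxes t)).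
  apply/ler_addgt0Pr => e e0.
  have cP : closed (section_hits M (cboxes t)).
    by apply: closed_section_hits => //; exact: cboxes_compact.
  have [s [sP le]] := cboxes_inner_open mu (closed_openC cP) e0.
  have := ler_cvg_to (H2 t) (H1 s) (escape setT (cboxes t) s (@cboxes_compact R d t) sP).
  rewrite setTD prC; last exact: measurable_cboxes.
  move: le; rewrite prC//.
  move: (pr mu (cboxes s)) (pr mu (section_hits M (cboxes t))) (pr nu (cboxes t)) => a b c h1 /(_ PF) h2.
  lra.
have big e : 0 < e -> exists s, 1 - e <= pr mu (section_hits M (cboxes s)).
  move=> e0; have [s [_]] := cboxes_inner_pr nu [set c | c.2 = 0%N] e0.
  rewrite -cbox_setT => le; exists s; apply: le_trans (nu_le s).
  by move: le; rewrite {1}/pr probability_setT/= lerBlDr.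
have [S [mS MS]] := section_selection nullmu cM cmM big.
have tS : transport_map mu nu S.
  split => // A mA.
  pose SM : {mfun E >-> E} := HB.pack S (isMeasurableFun.Build _ _ _ _ _ mS).
  symmetry; apply: (@probability_eq_cboxes _ _ nu (distribution mu SM)) => // s.
  apply: (le_trans (nu_le s)).
  have mpre : measurable (S @^-1` cboxes s).
    by rewrite -[X in measurable X]setTI; apply: (mS) => //; exact: measurable_cboxes.
  apply: pr_le_ae => //; apply: filterS MS => x [_ MS] [y sy My].
  by rewrite /= -(MS y My).
have TS : {ae mu, forall x, T x = S x}.
  have [z0 Mz0] : exists z, M z.
    have [x [Mx _]] : exists x, M (x, S x) /\ forall y, M (x, y) -> y = S x.
      have PAE : ProperFilter (almost_everywhere mu).
        apply: ae_properfilter_algebraOfSetsType.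
        by have := probability_setT mu; move=> /= ->.
      exact: (filter_ex MS).
    by exists (x, S x).
  apply: (transport_map_unique nullmu mu2 nu2 cmM Mz0 tS tT); last exact: T_optimal.
  by apply: filterS MS => x [].
move=> c.
have hit0 : pr mu ((T @^-1` ~` cbox c) `&` section_hits M (cbox c)) = 0.
  apply/eqP; rewrite eq_le pr_ge0 andbT.
  have -> : 0 = pr mu set0 by rewrite /pr measure0.
  apply: pr_le_ae => //.
    apply: measurableI => //; apply: measurable_section_hits => //; exact: cbox_closed.
  apply: filterS2 MS TS => x [_ MS] TS [/= nT [y cy My]]; apply: nT.
  by rewrite TS -(MS y My).
apply/cvgrPdist_lt => e e0.
have e20 : 0 < e / 2 by rewrite divr_gt0.
have cP : closed (section_hits M (cbox c)).
  by apply: closed_section_hits => //; exact: cbox_compact.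
have mP : measurable (section_hits M (cbox c)) by exact: closed_measurable_rV.
have [s [sP le]] := cboxes_inner_open mu (closed_openC cP) e20.
have ms : measurable (cboxes s : set E) by exact: measurable_cboxes.
have small : pr mu ((T @^-1` ~` cbox c) `\` cboxes s) < e.
  rewrite (@prDI _ _ _ mu _ (section_hits M (cbox c)))//; last exact: measurableD.
  have h1 : pr mu (((T @^-1` ~` cbox c) `\` cboxes s) `&` section_hits M (cbox c)) <= 0.
    rewrite -hit0; apply: pr_le.
    - by apply: measurableI => //; exact: measurableD.
    - exact: measurableI.
    - by move=> x [[]].
  have h2 : pr mu (((T @^-1` ~` cbox c) `\` cboxes s) `\` section_hits M (cbox c)) <=
      pr mu (~` section_hits M (cbox c) `\` cboxes s).
    apply: pr_le.
    - by apply: measurableD => //; exact: measurableD.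
    - by apply: measurableD => //; exact: measurableC.
    - by move=> x [[]].
  have h3 := @prDI _ _ _ mu _ (cboxes s) (measurableC mP) ms.
  have h4 : ~` section_hits M (cbox c) `&` cboxes s = cboxes s by rewrite setIidr.
  rewrite h4 in h3; move: h1 h2 le h3.
  move: (pr mu _) (pr mu _) (pr mu _) (pr mu _) (pr mu _) => a1 a2 a3 a4 a5 h1 h2 h3 h4'.
  lra.
have ev : \forall n \near F, G n (((T @^-1` ~` cbox c) `\` cboxes s) `*` setT) < e.
  exact: (cvgr_lt _ (H3 c s) _ small).
have esc := escape (T @^-1` ~` cbox c) (cbox c) s (@cbox_compact R d c) sP.
apply: filterS (filterI HG (filterI ev esc)) => n [[_ pG] [Gs le1]].
have [G0 _ _ _] := pG.
by rewrite sub0r normrN ger0_norm//; exact: le_lt_trans le1 Gs.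
Qed.

(** Were the limit not 0, an ultrafilter finer than the ranks where the value stays
    away from 0 would contradict the previous lemma. *)
Lemma plan_stability :
  (\forall n \near \oo, cyc_monotone (supp n) /\ plan_like (G n) (supp n)) ->
  (forall s, G n ((setT `\` cboxes s) `*` setT) @[n --> \oo] --> pr mu (setT `\` cboxes s)) ->
  (forall s, G n (setT `*` cboxes s) @[n --> \oo] --> pr nu (cboxes s)) ->
  (forall c s, G n (((T @^-1` ~` cbox c) `\` cboxes s) `*` setT) @[n --> \oo] -->
     pr mu ((T @^-1` ~` cbox c) `\` cboxes s)) ->
  forall c, G n ((T @^-1` ~` cbox c) `*` cbox c) @[n --> \oo] --> 0.
Proof.
move=> HG H1 H2 H3 c; apply/cvgrPdist_lt => e e0; apply: contrapT => nE.
set B := [set n | `|0 - G n ((T @^-1` ~` cbox c) `*` cbox c)| < e] in nE.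
have PW : ProperFilter (within (~` B) \oo).
  apply: Build_ProperFilter_ex.
  move=> Q; rewrite /within/= => nQ; apply: contrapT => noQ; apply: nE.
  apply: filterS nQ => n nQ; apply: contrapT => nB; apply: noQ; exists n.
  exact: nQ.
have [F [UF WF]] := ultraFilterLemma PW.
have PF : ProperFilter F by exact: ultra_proper.
have ooF Q : (\forall n \near \oo, Q n) -> F Q.
  by move=> oQ; apply: WF; rewrite /within/=; apply: filterS oQ.
have toF (u : nat -> R) (l : R) : u n @[n --> \oo] --> l -> u n @[n --> F] --> l.
  by move=> ul A lA; apply: ooF; exact: ul.
have FnB : F (~` B) by apply: WF; apply: nearW => n.
have cF := plan_stability_ultra UF (ooF _ HG) (fun s => toF _ _ (H1 s))
  (fun s => toF _ _ (H2 s)) (fun c s => toF _ _ (H3 c s)) c.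
have FB : F B by move/cvgrPdist_lt : cF => /(_ e e0).
have [n [Bn nBn]] := filter_ex (filterI FB FnB).
exact: nBn.
Qed.

End plan_stability.

(** * Optimal plans between discrete measures *)

Section finite_support.
Context {dT : measure_display} {T : measurableType dT} {R : realType}.

Definition wsum (s : seq T) (c f : T -> R) : R := \sum_(l <- s) c l * f l.

Lemma wsum_indic_measure (m : {measure set T -> \bar R}) (s : seq T) (c : T -> R) :
  uniq s -> (forall l : T, measurable [set l]) -> (forall l, m [set l] = (c l)%:E) ->
  m (~` [set` s]) = 0%E ->
  forall A, measurable A -> m A = (wsum s c \1_A)%:E.
Proof.
move=> us m1 mc ms A mA.
have setnil : [set` [::]] = set0 :> set T by apply/seteqP; split.
have setcons (l : T) (s' : seq T) : [set` l :: s'] = [set l] `|` [set` s'].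
  by apply/seteqP; split=> t /=; rewrite inE; [move=> /orP[/eqP ->|]; [left|right]|
    move=> [->|ts]; [rewrite eqxx|rewrite ts orbT]].
have mseq (s' : seq T) : measurable [set` s'].
  elim: s' => [|l s' IH]; first by rewrite setnil.
  by rewrite setcons; apply: measurableU.
have H (s' : seq T) : uniq s' -> m (A `&` [set` s']) = (wsum s' c \1_A)%:E.
  elim: s' => [|l s' IH] /=; first by rewrite /wsum big_nil setnil setI0 measure0.
  move=> /andP[ls' us']; rewrite setcons setIUr measureU//; last 3 first.
  - exact: measurableI.
  - by apply: measurableI.
  - apply/seteqP; split => // t [[_ /= tl] [_ /=]]; rewrite tl => ls.
    by rewrite ls in ls'.
  transitivity (m (A `&` [set l]) + m (A `&` [set` s']))%E; first by [].
  rewrite (IH us') /wsum big_cons EFinD; congr (_ + _)%E.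
  rewrite indicE; case: (boolP (l \in A)) => [/set_mem Al|/negP nAl].
    by rewrite mulr1 -mc; congr (m _); apply/seteqP; split => t /=; [case|move=> ->].
  rewrite mulr0; rewrite (_ : _ `&` _ = set0) ?measure0//.
  by apply/seteqP; split => t //= [At tl]; apply: nAl; rewrite inE -tl.
have D0 : m (A `\` [set` s]) = 0%E.
  apply/eqP; rewrite eq_le measure_ge0 andbT -ms le_measure ?inE//.
  - exact: measurableD.
  - exact: measurableC.
by rewrite -[RHS]add0e -D0 -(H s us); exact: (measureDI m mA (mseq s)).
Qed.

Section wmeasure.
Variables (s : seq T) (c : T -> R).
Hypothesis c0 : forall l, 0 <= c l.

Lemma wsum_ge0 f : (forall l, 0 <= f l) -> 0 <= wsum s c f.
Proof. by move=> f0; apply: sumr_ge0 => l _; rewrite mulr_ge0. Qed.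

Lemma exists_wmeasure : exists m : {measure set T -> \bar R},
  (forall A, m A = (wsum s c \1_A)%:E) /\
  (forall f : T -> R, measurable_fun setT f -> (forall x, 0 <= f x) ->
    (\int[m]_x (f x)%:E = (wsum s c f)%:E)%E).
Proof.
case: s => [|l0 s'].
  exists (mzero : {measure set T -> \bar R}); split => [A|f _ _].
    by rewrite /wsum big_nil.
  by rewrite integral_measure_zero /wsum big_nil.
pose s1 := l0 :: s'.
pose cn i : {nonneg R} := NngNum (c0 (nth l0 s1 i)).
exists (msum (fun i => mscale (cn i) (dirac (nth l0 s1 i))) (size s1)); split => [A|f mf f0].
  rewrite /wsum (big_nth l0) big_mkord -sumEFin /msum/=.
  by apply: eq_bigr => i _; rewrite EFinM.
rewrite ge0_integral_measure_sum//; last 2 first.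
- by move=> x _; rewrite lee_fin.
- exact/measurable_EFinP.
rewrite /wsum (big_nth l0) big_mkord -sumEFin; apply: eq_bigr => i _.
rewrite ge0_integral_mscale//; last 2 first.
- exact/measurable_EFinP.
- by move=> x _; rewrite lee_fin.
rewrite integral_dirac//; last exact/measurable_EFinP.
by rewrite diracT mul1e EFinM.
Qed.

Lemma integral_wsum (m : {measure set T -> \bar R}) (f : T -> R) :
  (forall A, measurable A -> m A = (wsum s c \1_A)%:E) ->
  measurable_fun setT f -> (forall x, 0 <= f x) ->
  (\int[m]_x (f x)%:E = (wsum s c f)%:E)%E.
Proof.
move=> mE mf f0; have [m' [m'E <-//]] := exists_wmeasure.
by apply: eq_measure_integral => A mA _; rewrite m'E mE.
Qed.

Lemma integral_wsum_signed (m : {measure set T -> \bar R}) (f : T -> R) :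
  (forall A, measurable A -> m A = (wsum s c \1_A)%:E) ->
  measurable_fun setT f ->
  (\int[m]_x (f x)%:E = (wsum s c f)%:E)%E.
Proof.
move=> mE mf; rewrite integralE.
pose fp x := Num.max (f x) 0; pose fm x := Num.max (- f x) 0.
have mfp : measurable_fun setT fp by apply: measurable_maxr.
have mfm : measurable_fun setT fm by apply: measurable_maxr => //; exact: measurableT_comp.
have -> : ((EFin \o f)^\+ = fun x => (fp x)%:E)%E.
  by apply/funext => x; rewrite funeposE /fp /= EFin_max.
have -> : ((EFin \o f)^\- = fun x => (fm x)%:E)%E.
  by apply/funext => x; rewrite funenegE /fm /= EFin_max EFinN.
rewrite !(integral_wsum mE)//; last 2 first.
- by move=> x; rewrite /fm le_max lexx orbT.
- by move=> x; rewrite /fp le_max lexx orbT.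
rewrite -EFinB; congr EFin; rewrite /wsum -sumrB; apply: eq_bigr => l _.
rewrite -mulrBr; congr (_ * _); rewrite /fp /fm.
by case: (leP (f l) 0) => h; case: (leP (- f l) 0) => h'; lra.
Qed.

(** Normalisation changes nothing for total mass 1; it serves to turn the measure
    into a probability. *)
Lemma exists_wprobability : wsum s c (fun=> 1) = 1 ->
  exists m : probability T R, forall A, m A = (wsum s c \1_A)%:E.
Proof.
move=> c1; have [m [mE _]] := exists_wmeasure.
have m1 : m setT = 1%E by rewrite mE indicT c1.
have [l0 _] : exists l0, l0 \in s.
  case: (s) c1 => [|l0 s' _]; last by exists l0; rewrite mem_head.
  by rewrite /wsum big_nil => /eqP; rewrite eq_sym oner_eq0.
exists (mnormalize m (dirac l0)) => A; rewrite -mE.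
suff : @mnormalize _ _ _ m (dirac l0) A = m A by [].
by rewrite /mnormalize m1 onee_eq0/= invr1 mule1.
Qed.

End wmeasure.
End finite_support.

Lemma eq_indic (R : realType) (T U : Type) (A : set T) (B : set U) u v :
  (A u <-> B v) -> \1_A u = \1_B v :> R.
Proof.
move=> AB; rewrite !indicE; congr (_%:R); congr nat_of_bool.
by apply/idP/idP => /set_mem h; apply/mem_set/AB.
Qed.

Lemma sqdist0E (R : realType) (d : nat) (y : 'rV[R]_d) :
  sqdist y 0 = \sum_j y 0 j ^+ 2.
Proof. by apply: eq_bigr => j _; rewrite [(0 : 'rV_d) 0 j]mxE subr0. Qed.

Section discrete_plan.
Context {R : realType} {d : nat}.
Local Notation E := 'rV[R]_d.

Lemma measurable_set1_rV (a : E) : measurable [set a].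
Proof.
by apply: closed_measurable_rV; apply: accessible_closed_set1; apply: hausdorff_accessible; exact: norm_hausdorff.
Qed.

Lemma measurable_set1_pair (l : E * E) : measurable [set l].
Proof.
rewrite (_ : [set l] = [set l.1] `*` [set l.2]); last first.
  by apply/seteqP; split=> -[u v] /=; [move=> <-|case: l => a b /= [-> ->]].
by apply: measurableX; exact: measurable_set1_rV.
Qed.

Lemma measurable_seq_rV (s : seq E) : measurable [set` s].
Proof.
have -> : [set` s] = \big[setU/set0]_(a <- s) [set a].
  apply/seteqP; split=> y /=.
    by move=> ys; rewrite -bigcup_seq; exists y.
  by rewrite -bigcup_seq => -[a /= ys ->].
by apply: bigsetU_measurable => a _; exact: measurable_set1_rV.
Qed.

Lemma sum_indic_points (s : seq E) (f : E -> R) y : uniq s -> y \in s ->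
  f y = \sum_(a <- s) f a * \1_[set a] y.
Proof.
move=> us ys; rewrite (bigD1_seq y)//= indicE mem_set// mulr1 big1 ?addr0// => a ay.
rewrite indicE memNset ?mulr0//= => ya; by rewrite ya eqxx in ay.
Qed.

Variables (x : nat -> E) (w : nat -> R) (n : nat).

Lemma empirical_measureE A :
  empirical_measure x n A = (n%:R^-1 * \sum_(i < n) \1_A (x i))%:E.
Proof.
rewrite /empirical_measure /mscale/= /msum EFinM; congr (_ * _)%E.
by rewrite -sumEFin.
Qed.

Lemma weighted_empirical_measureE A :
  weighted_empirical_measure w x n A =
  (\sum_(i < n) (w i / \sum_(j < n) w j) * \1_A (x i))%:E.
Proof. by rewrite /weighted_empirical_measure -sumEFin; apply: eq_bigr => i _; rewrite EFinM. Qed.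

Hypothesis n0 : (0 < n)%N.
Let W := \sum_(j < n) w j.
Variables (gamma : probability (E * E)%type R) (kappa : R.-pker E ~> E).
Hypothesis opt : optimal_plan (empirical_measure x n) (weighted_empirical_measure w x n) gamma.
Hypothesis cond : conditional_distribution gamma kappa.

Let pts := undup [seq x i | i <- iota 0 n].
Let L := [seq (a, b) | a <- pts, b <- pts].
Let g l := fine (gamma [set l]).

Lemma pts_uniq : uniq pts. Proof. exact: undup_uniq. Qed.

Lemma x_pts (i : 'I_n) : x i \in pts.
Proof. by rewrite mem_undup; apply: map_f; rewrite mem_iota/=. Qed.

Lemma pts_L l : (l \in L) = (l.1 \in pts) && (l.2 \in pts).
Proof.
apply/allpairsP/andP => [[p [p1 p2 ->]]|[l1 l2]] //.
by exists l; split => //; case: (l).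
Qed.

Lemma L_uniq : uniq L.
Proof. by apply: allpairs_uniq; [exact: pts_uniq|exact: pts_uniq|case=> a b [a' b']]. Qed.

Lemma g_ge0 l : 0 <= g l.
Proof. by rewrite /g fine_ge0// measure_ge0. Qed.

Lemma gammaE A : measurable A -> gamma A = (wsum L g \1_A)%:E.
Proof.
move=> mA; have [[m1 m2] _] := opt.
apply: wsum_indic_measure => //.
- exact: L_uniq.
- exact: measurable_set1_pair.
- by move=> l; rewrite /g fineK// fin_num_measure//; exact: measurable_set1_pair.
have mp : measurable (~` [set` pts] : set E) by apply: measurableC; exact: measurable_seq_rV.
have np (i : 'I_n) : \1_(~` [set` pts]) (x i) = 0 :> R.
  by rewrite indicE memNset//=; apply; exact: x_pts.
apply/eqP; rewrite eq_le measure_ge0 andbT.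
apply: (@le_trans _ _ (gamma ((~` [set` pts]) `*` setT `|` setT `*` (~` [set` pts])))).
  rewrite le_measure// ?inE.
  - apply: measurableC.
    rewrite (_ : [set` L] = [set` pts] `*` [set` pts]).
      by apply: measurableX; exact: measurable_seq_rV.
    by apply/seteqP; split=> l /=; rewrite pts_L => /andP.
  - by apply: measurableU; apply: measurableX.
  - move=> l /= nL; apply: contrapT => /not_orP[h1 h2]; apply: nL.
    by rewrite pts_L; apply/andP; split; apply: contrapT => h; [apply: h1|apply: h2].
apply: le_trans (measureU2 _ _ _) _; [exact: measurableX|exact: measurableX|].
have z1 : gamma ((~` [set` pts]) `*` setT) = 0%E.
  by rewrite m1// empirical_measureE big1 ?mulr0// => i _; rewrite np.
have z2 : gamma (setT `*` (~` [set` pts])) = 0%E.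
  by rewrite m2// weighted_empirical_measureE big1// => i _; rewrite np mulr0.
suff : (gamma ((~` [set` pts]) `*` setT) + gamma (setT `*` (~` [set` pts])) <= 0)%E by [].
by rewrite z1 z2 adde0.
Qed.

Lemma fst_marginal (f : E -> R) :
  wsum L g (fun l => f l.1) = n%:R^-1 * \sum_(i < n) f (x i).
Proof.
have [[m1 _] _] := opt.
have ind a : wsum L g (fun l => \1_[set a] l.1) = n%:R^-1 * \sum_(i < n) \1_[set a] (x i).
  apply: EFin_inj; rewrite -empirical_measureE -m1; last exact: measurable_set1_rV.
  rewrite gammaE; last by apply: measurableX => //; exact: measurable_set1_rV.
  congr EFin; apply: eq_bigr => l _; congr (_ * _); rewrite !indicE; congr (_%:R).
  by congr nat_of_bool; apply/idP/idP; rewrite !inE /=; [|move=> []].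
transitivity (\sum_(a <- pts) f a * wsum L g (fun l => \1_[set a] l.1)).
  under eq_bigr do rewrite mulr_sumr.
  rewrite exchange_big/= /wsum; apply: eq_big_seq => l.
  rewrite pts_L => /andP[l1 _]; rewrite {1}(sum_indic_points f pts_uniq l1) mulr_sumr.
  by apply: eq_bigr => a _; ring.
under eq_bigr do rewrite ind mulrCA mulr_sumr.
rewrite -mulr_sumr exchange_big/=; congr (_ * _); apply: eq_bigr => i _.
by rewrite (sum_indic_points f pts_uniq (x_pts i)).
Qed.

Lemma snd_marginal (f : E -> R) :
  wsum L g (fun l => f l.2) = \sum_(i < n) (w i / W) * f (x i).
Proof.
have [[_ m2] _] := opt.
have ind a : wsum L g (fun l => \1_[set a] l.2) = \sum_(i < n) (w i / W) * \1_[set a] (x i).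
  apply: EFin_inj; rewrite -weighted_empirical_measureE -m2; last exact: measurable_set1_rV.
  rewrite gammaE; last by apply: measurableX => //; exact: measurable_set1_rV.
  congr EFin; apply: eq_bigr => l _; congr (_ * _); rewrite !indicE; congr (_%:R).
  by congr nat_of_bool; apply/idP/idP; rewrite !inE /=; [|move=> []].
transitivity (\sum_(a <- pts) f a * wsum L g (fun l => \1_[set a] l.2)).
  under eq_bigr do rewrite mulr_sumr.
  rewrite exchange_big/= /wsum; apply: eq_big_seq => l.
  rewrite pts_L => /andP[_ l2]; rewrite {1}(sum_indic_points f pts_uniq l2) mulr_sumr.
  by apply: eq_bigr => a _; ring.
under eq_bigr do rewrite ind mulr_sumr.
rewrite exchange_big/=; apply: eq_bigr => i _.
rewrite (sum_indic_points f pts_uniq (x_pts i)) mulr_sumr.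
by apply: eq_bigr => a _; ring.
Qed.

Lemma wsum_g1 : wsum L g (fun=> 1) = 1.
Proof.
by rewrite (fst_marginal (fun=> 1)) sumr_const card_ord mulVf// pnatr_eq0 -lt0n.
Qed.

Lemma exists_min_weight k (u : nat -> R) : (forall i, 0 < u i) ->
  exists2 e, 0 < e & forall i, (i < k)%N -> e <= u i.
Proof.
move=> u0; elim: k => [|k [e e0 H]]; first by exists 1.
exists (Num.min e (u k)); first by rewrite lt_min e0 u0.
move=> i; rewrite ltnS leq_eqVlt => /orP[/eqP ->|ik]; first by rewrite ge_min lexx orbT.
by rewrite ge_min H.
Qed.

(** Along a cycle of atoms of positive mass, move the mass [e] from each [z i] to
    [((z (i+1)).1, (z i).2)].  The marginals are unchanged, and optimality says
    that the cost does not decrease.  The atoms may repeat within the cycle, so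
    [e] is the least mass of an atom divided by the length of the cycle. *)
Lemma optimal_support_cyc_monotone : cyc_monotone [set l | l \in L /\ 0 < g l].
Proof.
move=> k z Mz zk; case: k zk => [|k] zk; first by rewrite big_ord0.
have zL i : z i \in L by have [] := Mz i.
pose z' i := ((z i.+1).1, (z i).2).
have z'L i : z' i \in L.
  by move: (zL i) (zL i.+1); rewrite !pts_L /= => /andP[_ ->] /andP[-> _].
have [e0 e00 He0] := @exists_min_weight k.+1 (fun i => g (z i)) (fun i => (Mz i).2).
pose e := e0 / k.+1%:R; have epos : 0 < e by rewrite divr_gt0.
pose g' l := g l + e * \sum_(i < k.+1) ((l == z' i)%:R - (l == z i)%:R).
have g'0 l : 0 <= g' l.
  rewrite /g' sumrB mulrBr addrCA; apply: addr_ge0.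
    by apply: mulr_ge0; [exact: ltW|exact: sumr_ge0].
  rewrite subr_ge0.
  have [/existsP[i /eqP li]|/existsPn nl] := boolP [exists i : 'I_k.+1, l == z i].
    apply: (@le_trans _ _ (e * k.+1%:R)).
      apply: ler_wpM2l; first exact: ltW.
      have <- : \sum_(i' < k.+1) (1 : R) = k.+1%:R by rewrite sumr_const card_ord.
      by apply: ler_sum => i' _; case: (_ == _).
    by rewrite /e divfK// li He0.
  by rewrite big1 ?mulr0 ?g_ge0// => i _; rewrite (negbTE (nl i)).
have pick (f : E * E -> R) l : l \in L -> \sum_(l' <- L) (l' == l)%:R * f l' = f l.
  move=> lL; rewrite (bigD1_seq l)//=; last exact: L_uniq.
  by rewrite eqxx mul1r big1 ?addr0// => l' /negbTE ->; rewrite mul0r.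
have wg' f : wsum L g' f = wsum L g f + e * \sum_(i < k.+1) (f (z' i) - f (z i)).
  rewrite /wsum /g'; under eq_bigr do rewrite mulrDl.
  rewrite big_split/=; congr (_ + _).
  under eq_bigr do rewrite -mulrA mulr_suml.
  rewrite -mulr_sumr exchange_big/=; congr (_ * _); apply: eq_bigr => i _.
  under eq_bigr do rewrite mulrBl.
  by rewrite sumrB !pick.
have tele (u : nat -> R) : u k.+1 = u 0%N -> \sum_(i < k.+1) (u i.+1 - u i) = 0.
  by move=> uk; rewrite -(big_mkord xpredT (fun i => u i.+1 - u i)) telescope_sumr// uk subrr.
have [h hE] : exists m : probability (E * E)%type R, forall A, m A = (wsum L g' \1_A)%:E.
  apply: exists_wprobability => //.
  by rewrite wg' wsum_g1 big1 ?mulr0 ?addr0// => i _; rewrite subrr.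
have [[m1 m2] cost] := opt.
have hC : couplings (empirical_measure x n) (weighted_empirical_measure w x n) h.
  split => A mA.
    rewrite hE -m1// gammaE; last exact: measurableX.
    rewrite wg' (_ : \sum_(i < _) _ = 0) ?mulr0 ?addr0//.
    rewrite -[RHS](tele (fun i => \1_A (z i).1)); last by rewrite zk.
    apply: eq_bigr => i _; congr (_ - _); apply: eq_indic; split => //=; first by case.
    by case.
  rewrite hE -m2// gammaE; last exact: measurableX.
  rewrite wg' (_ : \sum_(i < _) _ = 0) ?mulr0 ?addr0// big1// => i _.
  apply/eqP; rewrite subr_eq0; apply/eqP; apply: eq_indic.
  by split => -[].
have mc : measurable_fun setT (fun l : E * E => sqdist l.1 l.2).
  by apply: measurable_sqdist; [exact: measurable_fst|exact: measurable_snd].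
have costE (m : probability (E * E)%type R) c : (forall l, 0 <= c l) ->
    (forall A, measurable A -> m A = (wsum L c \1_A)%:E) ->
    kantorovich_cost m = (wsum L c (fun l => sqdist l.1 l.2))%:E.
  move=> c0 mE; rewrite /kantorovich_cost; under eq_integral do rewrite sqdistE.
  by apply: integral_wsum => // l; exact: sqdist_ge0.
have : (kantorovich_cost gamma <= kantorovich_cost h)%E.
  by rewrite cost; apply: ereal_inf_lbound; exists h.
rewrite (costE gamma g)//; last 2 first.
- exact: g_ge0.
- exact: gammaE.
rewrite (costE h g')// lee_fin wg' lerDl pmulr_rge0// => H.
rewrite -oppr_ge0 -sumrN; apply: le_trans H _; rewrite le_eqVlt; apply/orP; left; apply/eqP.
by apply: eq_bigr => i _; rewrite opprB.
Qed.

Let m a := \sum_(b <- pts) g (a, b).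

Lemma wsum_pairs (f : E * E -> R) :
  wsum L g f = \sum_(a <- pts) \sum_(b <- pts) g (a, b) * f (a, b).
Proof. by rewrite /wsum /L big_allpairs. Qed.

Lemma pts_xP a : a \in pts -> exists i : 'I_n, a = x i.
Proof.
rewrite mem_undup => /mapP[i]; rewrite mem_iota add0n => /andP[_ i_n] ->.
by exists (Ordinal i_n).
Qed.

Lemma mass_gt0 a : a \in pts -> 0 < m a.
Proof.
move=> ap; have -> : m a = wsum L g (fun l => \1_[set a] l.1).
  rewrite wsum_pairs (bigD1_seq a)//=; last exact: pts_uniq.
  rewrite [X in _ + X]big1 ?addr0; last first.
    move=> a' a'a; rewrite big1// => b _; rewrite indicE memNset ?mulr0//= => aa'.
    by rewrite aa' eqxx in a'a.
  by apply: eq_bigr => b _; rewrite indicE mem_set// mulr1.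
rewrite fst_marginal mulr_gt0 ?invr_gt0 ?ltr0n//.
have [i ->] := pts_xP ap; rewrite (bigD1 i)//= ltr_pwDl ?sumr_ge0//.
by rewrite indicE mem_set.
Qed.

(** Conditional distributions are determined only almost everywhere, but every
    sample point is an atom of the first marginal. *)
Lemma kernel_atom a B : a \in pts -> measurable B ->
  kappa a B = (wsum pts (fun b => g (a, b) / m a) \1_B)%:E.
Proof.
move=> ap mB; have ma0 := mass_gt0 ap.
have ma1 := measurable_set1_rV a.
have rect C : measurable C -> gamma ([set a] `*` C) = (wsum pts (fun b => g (a, b)) \1_C)%:E.
  move=> mC; rewrite gammaE; last exact: measurableX.
  congr EFin; rewrite wsum_pairs (bigD1_seq a)//=; last exact: pts_uniq.
  rewrite [X in _ + X]big1 ?addr0; last first.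
    move=> a' a'a; rewrite big1// => b _; rewrite indicE memNset ?mulr0//= => -[/= aa' _].
    by rewrite aa' eqxx in a'a.
  apply: eq_bigr => b _; rewrite !indicE; congr (_ * _%:R); congr nat_of_bool.
  by apply/idP/idP; rewrite !inE /=; [move=> []|].
have := cond ma1 mB; rewrite rect//.
rewrite (eq_integral (cst (kappa a B))); last by move=> y; rewrite inE /= => ->.
rewrite integral_cst// => H1.
have pE : pushforward gamma fst [set a] = (m a)%:E.
  rewrite /pushforward (_ : fst @^-1` [set a] = [set a] `*` setT); last first.
    by apply/seteqP; split=> -[u v] //= [].
  rewrite rect// /wsum /m; congr EFin; apply: eq_bigr => b _.
  by rewrite indicT mulr1.
have H : ((wsum pts (fun b => g (a, b)) \1_B)%:E = kappa a B * (m a)%:E)%E.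
  by rewrite -pE; exact: H1.
case: (kappa a B) H => [r [rE]| |]; last 2 first.
- by rewrite gt0_mulye ?lte_fin.
- by rewrite gt0_mulNye ?lte_fin.
congr EFin.
rewrite /wsum; under eq_bigr do rewrite mulrAC.
by rewrite -mulr_suml -/(wsum _ _ _) rE mulfK// gt_eqF.
Qed.

Lemma barycenter_atom a j : a \in pts ->
  m a * barycentric_projection kappa a 0 j = \sum_(b <- pts) g (a, b) * b 0 j.
Proof.
move=> ap; have ma0 := mass_gt0 ap.
rewrite /barycentric_projection mxE /Rintegral.
have c0 b : 0 <= g (a, b) / m a by rewrite divr_ge0 ?g_ge0// ltW.
rewrite (integral_wsum_signed c0 (f := fun y : E => y 0 j) (fun B => kernel_atom ap)); last exact: measurable_coord.
rewrite /wsum mulr_sumr; apply: eq_bigr => b _; field.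
by rewrite gt_eqF.
Qed.

(** Jensen's inequality for the absolute value, atom by atom. *)
Lemma barycenter_dist (j : 'I_d) (t : E -> R) :
  n%:R^-1 * \sum_(i < n) `|barycentric_projection kappa (x i) 0 j - t (x i)|
  <= wsum L g (fun l => `|l.2 0 j - t l.1|).
Proof.
rewrite -(fst_marginal (fun a => `|barycentric_projection kappa a 0 j - t a|)) !wsum_pairs.
rewrite big_seq_cond [leRHS]big_seq_cond; apply: ler_sum => a /andP[ap _]; rewrite /= -mulr_suml -/(m a).
have ma0 := mass_gt0 ap.
rewrite -[X in X * _](gtr0_norm ma0) -normrM mulrBr barycenter_atom// mulr_suml -sumrB.
apply: le_trans (ler_norm_sum _ _ _) _; apply: ler_sum => b _.
by rewrite -mulrBr normrM ger0_norm// g_ge0.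
Qed.

(** Jensen's inequality for the square, in the form of the nonnegativity of the
    conditional variance. *)
Lemma barycenter_sqr :
  n%:R^-1 * \sum_(i < n) sqdist (barycentric_projection kappa (x i)) 0
  <= wsum L g (fun l => sqdist l.2 0).
Proof.
rewrite -(fst_marginal (fun a => sqdist (barycentric_projection kappa a) 0)) !wsum_pairs.
rewrite big_seq_cond [leRHS]big_seq_cond; apply: ler_sum => a /andP[ap _]; rewrite /= -mulr_suml -/(m a) sqdist0E.
under [leRHS]eq_bigr do rewrite sqdist0E mulr_sumr.
rewrite exchange_big mulr_sumr; apply: ler_sum => j _.
set u := barycentric_projection kappa a 0 j.
have : 0 <= \sum_(b <- pts) g (a, b) * (b 0 j - u) ^+ 2.
  by apply: sumr_ge0 => b _; rewrite mulr_ge0 ?sqr_ge0 ?g_ge0.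
have -> : \sum_(b <- pts) g (a, b) * (b 0 j - u) ^+ 2 =
    \sum_(b <- pts) g (a, b) * (b 0 j) ^+ 2 - 2 * u * (\sum_(b <- pts) g (a, b) * b 0 j)
    + m a * u ^+ 2.
  rewrite mulr_sumr /m mulr_suml -sumrB -big_split/=; apply: eq_bigr => b _; ring.
rewrite -barycenter_atom// -/u => H.
rewrite -subr_ge0; apply: le_trans H _; rewrite le_eqVlt; apply/orP; left; apply/eqP; ring.
Qed.

End discrete_plan.

(** All that is used later about an optimal plan between the empirical measures, as
    statements on finite sums over its atoms [L] with masses [g]: the marginals,
    cyclical monotonicity, and two instances of Jensen's inequality for the
    barycentric projection. *)
Definition discrete_plan (R : realType) (d : nat) (x : nat -> 'rV[R]_d)
    (w : nat -> R) (n : nat) (kappa : R.-pker 'rV[R]_d ~> 'rV[R]_d)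
    (L : seq ('rV[R]_d * 'rV[R]_d)) (g : 'rV[R]_d * 'rV[R]_d -> R) : Prop :=
  [/\ forall l, 0 <= g l,
      (forall f, wsum L g (fun l => f l.1) = n%:R^-1 * \sum_(i < n) f (x i)) /\
      (forall f, wsum L g (fun l => f l.2) =
         \sum_(i < n) (w i / \sum_(j < n) w j) * f (x i)),
      cyc_monotone [set l | l \in L /\ 0 < g l],
      (forall j t, n%:R^-1 * \sum_(i < n)
          `|barycentric_projection kappa (x i) 0 j - t (x i)|
        <= wsum L g (fun l => `|l.2 0 j - t l.1|)) &
      n%:R^-1 * \sum_(i < n) sqdist (barycentric_projection kappa (x i)) 0
        <= wsum L g (fun l => sqdist l.2 0)].

Lemma optimal_plan_discrete (R : realType) (d : nat) (x : nat -> 'rV[R]_d)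
    (w : nat -> R) (n : nat) (gamma : probability ('rV[R]_d * 'rV[R]_d)%type R)
    (kappa : R.-pker 'rV[R]_d ~> 'rV[R]_d) :
  (0 < n)%N ->
  optimal_plan (empirical_measure x n) (weighted_empirical_measure w x n) gamma ->
  conditional_distribution gamma kappa ->
  exists L g, discrete_plan x w n kappa L g.
Proof.
move=> n0 opt cond.
pose pts := undup [seq x i | i <- iota 0 n].
exists [seq (a, b) | a <- pts, b <- pts], (fun l => fine (gamma [set l])); split.
- exact: g_ge0.
- split; [exact: (fst_marginal opt)|exact: (snd_marginal opt)].
- exact: (optimal_support_cyc_monotone n0 opt).
- exact: (barycenter_dist n0 opt cond).
- exact: (barycenter_sqr n0 opt cond).
Qed.

(** * Weak convergence of averages *)

Lemma continuous_measurable_rV (R : realType) (d : nat) (f : 'rV[R]_d -> R) :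
  continuous f -> measurable_fun setT f.
Proof.
move=> cf; apply: (measurability _ (measurable_realfun.RGenOpens.measurableE R)).
move=> _ [_ [a [b ->] <-]]; rewrite setTI; apply: mx_open_measurable.
by apply: open_comp; [move=> u _; exact: cf|exact: interval_open].
Qed.

(** The number of positive integers below [s] is [s] up to an error of 1; this
    approximates a bounded function by indicators of its superlevel sets. *)
Lemma level_count (R : realType) (s : R) (N : nat) : 0 <= s ->
  \sum_(k < N) (k.+1%:R < s)%R%:R <= s /\
  (s <= N%:R -> s <= \sum_(k < N) (k.+1%:R < s)%R%:R + 1 :> R).
Proof.
move=> s0; have Hlt n : n%:R < s -> \sum_(k < n) (k.+1%:R < s)%R%:R = n%:R :> R.
  move=> ns; rewrite (eq_bigr (fun=> 1)) ?sumr_const ?card_ord// => i _.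
  by rewrite (le_lt_trans _ ns)// ler_nat.
elim: N => [|N [IH1 IH2]].
  by rewrite big_ord0; split => // s0'; rewrite add0r (le_trans s0').
rewrite big_ord_recr/=; case: (ltP N.+1%:R s) => h /=.
  have NS : N%:R < s by apply: le_lt_trans h; rewrite ler_nat.
  by rewrite Hlt// natr1 ltW//; split => // h'; rewrite (le_trans h')// lerDl.
rewrite addr0; split => // _; case: (leP s N%:R) => [/IH2//|/Hlt ->].
by rewrite natr1.
Qed.

Section portmanteau.
Context {R : realType} {d : nat}.
Local Notation E := 'rV[R]_d.
Variables (lambda : probability E R) (y : nat -> nat -> E).

Definition av n (f : E -> R) : R := n%:R^-1 * \sum_(i < n) f (y n i).

Lemma av_le n f g : (forall u, f u <= g u) -> av n f <= av n g.
Proof. by move=> fg; rewrite ler_wpM2l ?invr_ge0//; apply: ler_sum. Qed.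

Lemma av_sum n K (f : nat -> E -> R) :
  av n (fun u => \sum_(k < K) f k u) = \sum_(k < K) av n (f k).
Proof. by rewrite /av exchange_big/= mulr_sumr. Qed.

Lemma avZ n c f : av n (fun u => c * f u) = c * av n f.
Proof. by rewrite /av -mulr_sumr mulrCA. Qed.

Lemma avB_cst n c f : (0 < n)%N -> av n (fun u => c - f u) = c - av n f.
Proof.
move=> n0; rewrite /av sumrB mulrBr sumr_const card_ord; congr (_ - _).
by rewrite -[c *+ n]mulr_natl mulrA mulVf ?mul1r// pnatr_eq0 -lt0n.
Qed.

Hypothesis open_liminf : forall U, open U -> forall e : R, 0 < e ->
  \forall n \near \oo, pr lambda U - e <= av n \1_U.

(** With [U k] the open set where [K f > k + 1], the average [F] of the
    indicators of the [U k] satisfies [F <= f <= F + 1 / K]. *)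
Lemma liminf_unit (f : E -> R) (m : R) : continuous f -> (forall u, 0 <= f u <= 1) ->
  (\int[lambda]_u (f u)%:E = m%:E)%E -> forall e, 0 < e ->
  \forall n \near \oo, m - e <= av n f.
Proof.
move=> cf f01 fm e e0.
have mf : measurable_fun setT f by exact: continuous_measurable_rV.
have [K K0 Ke] : exists2 K : nat, (0 < K)%N & (K%:R^-1 : R) <= e / 2.
  exists (Num.truncn (e / 2)^-1).+1 => //; rewrite invf_ple ?posrE ?divr_gt0//.
  by rewrite ltW// truncnS_gt.
have KR0 : 0 < K%:R :> R by rewrite ltr0n.
pose U k := [set u | k.+1%:R < K%:R * f u].
have oU k : open (U k).
  have -> : U k = (fun u => K%:R * f u) @^-1` [set t | k.+1%:R < t] by [].
  apply: open_comp; last exact: open_gt.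
  by move=> u _; apply: (@continuousM _ _ (cst K%:R) f); [exact: cst_continuous|exact: cf].
have mU k : measurable (U k) by exact: mx_open_measurable.
pose F u : R := K%:R^-1 * \sum_(k < K) \1_(U k) u.
have indU k u : \1_(U k) u = (k.+1%:R < K%:R * f u)%R%:R :> R.
  by rewrite indicE mem_setE.
have Kf u : 0 <= K%:R * f u <= K%:R.
  by have /andP[a b] := f01 u; rewrite mulr_ge0//= ler_piMr.
have Ff u : F u <= f u /\ f u <= F u + K%:R^-1.
  have /andP[k0 k1] := Kf u; have [] := level_count K k0.
  have SE : \sum_(k < K) \1_(U k) u = \sum_(k < K) (k.+1%:R < K%:R * f u)%R%:R :> R.
    by apply: eq_bigr => k _; exact: indU.
  rewrite /F SE => h1 /(_ k1) h2; rewrite ler_pdivrMl//; split => //.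
  by rewrite -[X in _ + X]mulr1 -mulrDr ler_pdivlMl.
have mF : (\int[lambda]_u (F u)%:E = (K%:R^-1 * \sum_(k < K) pr lambda (U k))%:E)%E.
  have ms : measurable_fun setT (fun u => \sum_(k < K) \1_(U k) u : R).
    by apply: measurable_sum => k; exact: measurable_indic.
  have s0 u : 0 <= \sum_(k < K) \1_(U k) u :> R by exact: sumr_ge0.
  have K1 : 0 <= K%:R^-1 :> R by rewrite invr_ge0.
  rewrite (ge0_integral_EFinZ _ ms s0 K1).
  rewrite (ge0_integral_EFinsum lambda (index_enum 'I_K) (f := fun k u => \1_(U k) u))//; last first.
    by move=> k; exact: measurable_indic.
  rewrite EFinM -sumEFin; congr (_ * _)%E; apply: eq_bigr => k _.
  by rewrite integral_indic// setIT; exact: prE.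
have mFm : m <= K%:R^-1 * (\sum_(k < K) pr lambda (U k)) + K%:R^-1.
  have F0 u : 0 <= F u by rewrite mulr_ge0 ?invr_ge0// sumr_ge0.
  have mFf : measurable_fun setT F.
    by apply: measurable_funM => //; apply: measurable_sum => k; exact: measurable_indic.
  have : (\int[lambda]_u (f u)%:E <= \int[lambda]_u (F u + K%:R^-1)%:E)%E.
    apply: ge0_le_integral_EFin => //.
    - exact: measurable_funD.
    - by move=> u; have /andP[] := f01 u.
    - by move=> u; have [] := Ff u.
  rewrite fm ge0_integral_EFinD// mF.
  have := integral_cst lambda measurableT (K%:R^-1 : R)%:E.
  by rewrite /= probability_setT mule1 => ->; rewrite -EFinD lee_fin.
have : \forall n \near \oo, forall k : 'I_K, pr lambda (U k) - e / 2 <= av n \1_(U k).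
  apply: (@filter_forall _ _ (fun (k : 'I_K) n => pr lambda (U k) - e / 2 <= av n \1_(U k))) => k.
  by apply: open_liminf; rewrite ?divr_gt0.
apply: filterS => n Hn.
have h1 : av n F <= av n f by apply: av_le => u; have [] := Ff u.
apply: le_trans h1; rewrite /F avZ (av_sum n K (fun k => \1_(U k))).
have h2 : K%:R^-1 * \sum_(k < K) (pr lambda (U k) - e / 2) <= K%:R^-1 * \sum_(k < K) av n \1_(U k).
  by rewrite ler_wpM2l ?invr_ge0//; apply: ler_sum => k _; exact: Hn.
apply: le_trans h2; rewrite sumrB mulrBr sumr_const card_ord -[(e / 2) *+ K]mulr_natl mulKf ?gt_eqF//.
move: mFm; move: (K%:R^-1 * _) => A hA.
rewrite lerBlDr; apply: le_trans hA _; rewrite -addrA lerD2l.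
by move: Ke; move: (K%:R^-1) => B; lra.
Qed.

(** A lower bound on the averages of all open sets gives convergence: apply
    [liminf_unit] to an affine image [F] of [f] with values in [0, 1] and to
    [1 - F]. *)
Lemma portmanteau (f : E -> R) (M : R) : continuous f -> (forall u, `|f u| <= M) ->
  (av n f)%:E @[n --> \oo] --> (\int[lambda]_u (f u)%:E)%E.
Proof.
move=> cf fM.
pose M1 := M + 1.
have M10 : 0 < M1.
  by rewrite /M1 ltr_wpDl// (le_trans _ (fM 0)).
have fM1 u : - M1 < f u < M1 by rewrite -ltr_norml (le_lt_trans (fM u))// /M1 ltrDl.
pose F u := (2 * M1)^-1 * (M1 + f u).
have cF : continuous F.
  move=> u; apply: (@continuousM _ _ (cst (2 * M1)^-1) (cst M1 \+ f)); first exact: cst_continuous.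
  by apply: (@continuousD _ _ _ (cst M1) f); [exact: cst_continuous|exact: cf].
have F01 u : 0 <= F u <= 1.
  have /andP[a b] := fM1 u; rewrite /F mulr_ge0 ?invr_ge0 ?mulr_ge0//; [|lra|lra].
  by rewrite ler_pdivrMl ?mulr1//; lra.
have mf : measurable_fun setT f by exact: continuous_measurable_rV.
have mF : measurable_fun setT F.
  by apply: measurable_funM => //; exact: measurable_funD.
have [m Fm] : exists m, (\int[lambda]_u (F u)%:E = m%:E)%E.
  exists (fine (\int[lambda]_u (F u)%:E)); rewrite fineK// ge0_fin_numE ?integral_ge0//; last first.
    by move=> u _; rewrite lee_fin; have /andP[] := F01 u.
  apply: (@le_lt_trans _ _ (\int[lambda]_u 1%:E)%E).
    apply: ge0_le_integral_EFin => //.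
    - by move=> u; have /andP[] := F01 u.
    - by move=> u; have /andP[] := F01 u.
  have := integral_cst lambda measurableT (1%:E : \bar R).
  by rewrite /= probability_setT mule1 => ->; exact: ltry.
have int1 (c : R) : (\int[lambda]_u c%:E = c%:E)%E.
  have := integral_cst lambda measurableT (c%:E : \bar R).
  by rewrite /= probability_setT mule1.
have CFm : (\int[lambda]_u (1 - F u)%:E = (1 - m)%:E)%E.
  have : (\int[lambda]_u (F u + (1 - F u))%:E = 1%:E)%E.
    by under eq_integral do rewrite addrC subrK; exact: int1.
  rewrite ge0_integral_EFinD//; last 3 first.
  - exact: measurable_funB.
  - by move=> u; have /andP[] := F01 u.
  - by move=> u; have /andP[] := F01 u; rewrite subr_ge0.
  rewrite Fm => /(congr1 (fun z => z - m%:E)%E); rewrite addeAC subee// add0e => ->.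
  by rewrite -EFinB.
have fE u : f u = 2 * M1 * F u - M1.
  by rewrite /F mulrA divff ?gt_eqF ?mulr_gt0// mul1r addrC addKr.
have intf : lambda.-integrable setT (EFin \o f).
  apply: measurable_bounded_integrable => //.
    by apply: (le_lt_trans (probability_le1 lambda measurableT)); exact: ltry.
  by exists M; split; [exact: num_real|move=> z Mz u _; apply: le_trans (fM u) (ltW Mz)].
have If : (\int[lambda]_u (f u)%:E = (2 * M1 * m - M1)%:E)%E.
  have : (\int[lambda]_u (f u + M1)%:E = (2 * M1 * m)%:E)%E.
    under eq_integral do rewrite fE subrK.
    rewrite ge0_integral_EFinZ// ?Fm//; first by move=> u; have /andP[] := F01 u.
    by rewrite mulr_ge0// ltW.
  under eq_integral do rewrite EFinD.
  rewrite integralD//; last by apply: finite_measure_integrable_cst.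
  rewrite int1 => /(congr1 (fun z => z - M1%:E)%E); rewrite addeK// => ->.
rewrite If.
have avF : av n F @[n --> \oo] --> m.
  apply/cvgrPdist_le => e e0.
  have H1 := liminf_unit cF F01 Fm e0.
  have cCF : continuous (fun u => 1 - F u).
    have -> : (fun u => 1 - F u) = cst (1 : R) \- F by [].
    by move=> u; apply: (@continuousB _ _ _ (cst (1 : R)) F); [exact: cst_continuous|exact: cF].
  have CF01 u : 0 <= 1 - F u <= 1.
    by have /andP[a b] := F01 u; rewrite subr_ge0 b/= lerBlDr lerDl.
  have H2 := liminf_unit cCF CF01 CFm e0.
  near=> n; have n0 : (0 < n)%N by near: n; exact: nbhs_infty_gt.
  have h1 : m - e <= av n F by near: n; exact: H1.
  have : 1 - m - e <= av n (fun u => 1 - F u) by near: n; exact: H2.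
  rewrite avB_cst// => h2; rewrite ler_norml; apply/andP; split; lra.
apply: cvg_EFin; first exact: nearW.
have avf : \forall n \near \oo, 2 * M1 * av n F - M1 = av n f.
  near=> n; have n0 : (0 < n)%N by near: n; exact: nbhs_infty_gt.
  rewrite -avZ -[RHS]opprK -[in RHS](mulN1r (av n f)) -avZ.
  rewrite -(opprB M1) -avB_cst//; congr (- _).
  by rewrite /av; congr (_ * _); apply: eq_bigr => i _; rewrite (fE (y n i)); ring.
apply: (cvg_trans (near_eq_cvg avf)).
by apply: cvgB; [apply: cvgM => //; exact: cvg_cst|exact: cvg_cst].
Unshelve. all: by end_near. Qed.

End portmanteau.

Section wsum_theory.
Context {dU dV : measure_display} {U : measurableType dU} {V : measurableType dV}
  {R : realType}.
Local Notation T := (U * V)%type.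
Variables (s : seq T) (c : T -> R).
Hypothesis c0 : forall l, 0 <= c l.

Lemma wsum_le f g : (forall l, f l <= g l) -> wsum s c f <= wsum s c g.
Proof. by move=> fg; apply: ler_sum => l _; rewrite ler_wpM2l. Qed.

Lemma wsumD f g : wsum s c (fun l => f l + g l) = wsum s c f + wsum s c g.
Proof. by rewrite /wsum -big_split/=; apply: eq_bigr => l _; rewrite mulrDr. Qed.

Lemma wsumZ k f : wsum s c (fun l => k * f l) = k * wsum s c f.
Proof. by rewrite /wsum mulr_sumr; apply: eq_bigr => l _; rewrite mulrCA. Qed.

Lemma wsum_sum (I : Type) (r : seq I) (f : I -> T -> R) :
  wsum s c (fun l => \sum_(i <- r) f i l) = \sum_(i <- r) wsum s c (f i).
Proof. by rewrite /wsum exchange_big/=; apply: eq_bigr => l _; rewrite mulr_sumr. Qed.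

Lemma wsum_plan_like : wsum s c (fun=> 1) = 1 ->
  plan_like (fun A => wsum s c \1_A) [set l | l \in s /\ 0 < c l].
Proof.
move=> c1; split.
- by move=> A; apply: wsum_ge0 => // l; rewrite indicE.
- move=> A B; rewrite -wsumD; apply: eq_bigr => l _; congr (_ * _).
  rewrite !indicE in_setI in_setD.
  by case: (l \in A) (l \in B) => -[]; rewrite /= ?addr0 ?add0r.
- move=> A A0; rewrite /wsum big_seq big1// => l ls.
  have := c0 l; rewrite le_eqVlt => /orP[/eqP <-|cl]; first by rewrite mul0r.
  rewrite indicE memNset ?mulr0// => Al.
  by have : (A `&` [set l | l \in s /\ 0 < c l]) l by []; rewrite A0.
- by rewrite -[RHS]c1; apply: eq_bigr => l _; rewrite indicT.
Qed.

End wsum_theory.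

(** Small values of [t], values between [e] and [K], and values above [K] in turn
    are bounded by the three terms. *)
Lemma markov_linear (R : realType) (t e K : R) : 0 <= t -> 0 <= e -> 0 < K ->
  t <= e + K * (e <= t)%R%:R + K^-1 * t ^+ 2.
Proof.
move=> t0 e0 K0.
have sq : 0 <= K^-1 * t ^+ 2 by rewrite mulr_ge0 ?sqr_ge0// invr_ge0 ltW.
case: (boolP (e <= t)%R) => [et|]; last first.
  rewrite -ltNge mulr0 addr0 => te; rewrite (le_trans (ltW te))// lerDl//.
rewrite /= mulr1; case: (leP t K) => tK.
  by rewrite (le_trans tK)// -addrA addrCA lerDl addr_ge0.
have : t <= K^-1 * t ^+ 2.
  by rewrite expr2 mulrA ler_peMl// mulrC ler_pdivlMr// mul1r ltW.
by lra.
Qed.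

(** Finitely many of the balls that witness openness, taken with half their radius,
    cover the compact set. *)
Lemma compact_open_margin (R : realType) (d : nat) (C U : set 'rV[R]_d) :
  compact C -> open U -> C `<=` U ->
  exists2 r : R, 0 < r & forall u v : 'rV[R]_d, C u -> (forall j, `|u 0 j - v 0 j| < r) -> U v.
Proof.
move=> /compact_near_coveringP cC oU CU.
have H : \forall r \near (0 : R)^'+, C `<=` (fun u => forall v : 'rV[R]_d, (forall j, `|u 0 j - v 0 j| < r) -> U v).
  apply: (cC R (0 : R)^'+ (fun r u => forall v : 'rV[R]_d, (forall j, `|u 0 j - v 0 j| < r) -> U v)) => u Cu.
  have /nbhs_ballP[e /= e0 eU] : nbhs u U by rewrite nbhsE; exists U => //; split => //; exact: CU.
  have e20 : 0 < e / 2 by rewrite divr_gt0.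
  exists (ball u (e / 2), [set r | r <= e / 2]).
    by split => /=; [exact: nbhsx_ballx|exact: nbhs_right_le].
  move=> [u' r] /= [uu' re] v vr; apply: eU; split => // i j; rewrite (ord1 i).
  have [_ /(_ 0 j)] := uu'; rewrite /ball/= => h1.
  have h2 := vr j; have -> : u 0 j - v 0 j = (u 0 j - u' 0 j) + (u' 0 j - v 0 j) by ring.
  by rewrite (le_lt_trans (ler_normD _ _))//; lra.
have [r [r0 Hr]] := filter_ex (filterI (nbhs_right_gt (0 : R)) H).
by exists r => // u v Cu; exact: Hr.
Qed.

(** * Barycentric projections along a sample *)

Section sample_convergence.
Context {R : realType} {d : nat}.
Local Notation E := 'rV[R]_d.
Variables (mu nu : probability E R) (T : E -> E).
Hypotheses (nullmu : line_null mu).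
Hypotheses (mu2 : finite_second_moment mu) (nu2 : finite_second_moment nu).
Hypothesis tT : transport_map mu nu T.
Hypothesis T_optimal : forall S, transport_map mu nu S ->
  (\int[mu]_x (sqdist x (T x))%:E <= \int[mu]_x (sqdist x (S x))%:E)%E.
Variables (x : nat -> E) (w : nat -> R).
Variables (gamma : nat -> probability (E * E)%type R) (kappa : nat -> R.-pker E ~> E).
Hypothesis plan : forall n, 0 < \sum_(i < n) w i ->
  optimal_plan (empirical_measure x n) (weighted_empirical_measure w x n) (gamma n) /\
  conditional_distribution (gamma n) (kappa n).
Variables (c0 m2 : R).
Hypothesis c0_gt0 : 0 < c0.
(* A fixed sample for which the strong law holds for the countably many functions
   in use.  [c0] is the limit of the mean weight and [m2] the second moment of
   [nu]. *)
Hypothesis S0 : (\sum_(i < n) w i) / n%:R @[n --> \oo] --> c0.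
Hypothesis S1 : forall s, (\sum_(i < n) \1_(setT `\` cboxes s) (x i)) / n%:R @[n --> \oo]
  --> pr mu (setT `\` cboxes s).
Hypothesis S2 : forall s, (\sum_(i < n) w i * \1_(cboxes s) (x i)) / n%:R @[n --> \oo]
  --> c0 * pr nu (cboxes s).
Hypothesis S3 : forall c s, (\sum_(i < n) \1_((T @^-1` ~` cbox c) `\` cboxes s) (x i)) / n%:R @[n --> \oo]
  --> pr mu ((T @^-1` ~` cbox c) `\` cboxes s).
Hypothesis S4 : (\sum_(i < n) w i * sqdist (x i) 0) / n%:R @[n --> \oo] --> c0 * m2.
Hypothesis S5 : (\sum_(i < n) sqdist (T (x i)) 0) / n%:R @[n --> \oo] --> m2.
Hypothesis S6 : forall s, (\sum_(i < n) \1_(cboxes s) (T (x i))) / n%:R @[n --> \oo]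
  --> pr nu (cboxes s).

Let T_ n := barycentric_projection (kappa n).

(** The total weight is eventually positive because [c0] is. *)
Lemma eventually_plan : exists Lg : nat -> seq (E * E) * (E * E -> R),
  \forall n \near \oo, (0 < n)%N /\ discrete_plan x w n (kappa n) (Lg n).1 (Lg n).2.
Proof.
have good : \forall n \near \oo, (0 < n)%N /\ 0 < \sum_(i < n) w i.
  have ev := cvgr_gt _ S0 _ c0_gt0.
  near=> n.
  have n0 : (0 < n)%N by near: n; exact: nbhs_infty_gt.
  split => //.
  have : 0 < (\sum_(i < n) w i) / n%:R by near: n; exact: ev.
  by rewrite pmulr_lgt0// invr_gt0 ltr0n.
have ex n : exists Lg, (0 < n)%N /\ 0 < \sum_(i < n) w i ->
    discrete_plan x w n (kappa n) Lg.1 Lg.2.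
  have [[n0 W0]|ng] := pselect ((0 < n)%N /\ 0 < \sum_(i < n) w i); last first.
    by exists ([::], fun=> 0).
  have [opt cond] := plan W0.
  have [L [g H]] := optimal_plan_discrete n0 opt cond.
  by exists (L, g).
have [Lg HLg] := choice ex.
exists Lg; apply: filterS good => n gn; split; first by case: gn.
exact: HLg.
Unshelve. all: by end_near. Qed.

Let ratio f n : \sum_(i < n) (w i / \sum_(j < n) w j) * f (x i) =
  ((\sum_(i < n) w i * f (x i)) / n%:R) / ((\sum_(i < n) w i) / n%:R).
Proof.
have [->|n0] := posnP n; first by rewrite !big_ord0 !mul0r.
have nR : n%:R != 0 :> R by rewrite pnatr_eq0 -lt0n.
rewrite invf_div -[RHS]mulrA mulKf// mulr_suml.
by apply: eq_bigr => i _; rewrite mulrAC.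
Qed.

Let cvg_ratio f l : (\sum_(i < n) w i * f (x i)) / n%:R @[n --> \oo] --> c0 * l ->
  \sum_(i < n) (w i / \sum_(j < n) w j) * f (x i) @[n --> \oo] --> l.
Proof.
move=> H; under eq_cvg do rewrite ratio.
have -> : l = (c0 * l) / c0 by rewrite mulrC mulKf// gt_eqF.
by apply: cvgM => //; apply: cvgV => //; rewrite gt_eqF.
Qed.

Lemma barycenter_L2_bound :
  \sum_(i < n) (w i / \sum_(j < n) w j) * sqdist (x i) 0 @[n --> \oo] --> m2 /\
  \forall n \near \oo, n%:R^-1 * \sum_(i < n) sqdist (T_ n (x i)) 0 <=
     \sum_(i < n) (w i / \sum_(j < n) w j) * sqdist (x i) 0.
Proof.
split; first exact: (cvg_ratio (f := fun u => sqdist u 0)).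
have [Lg] := eventually_plan; apply: filterS => n [_ [_ [_ m2E] _ _]].
by rewrite (m2E (fun u => sqdist u 0)).
Qed.

(** Under the plans, [y - T x] tends to 0 in probability: cover most of [nu] by
    boxes [C] of small diameter; if [y] lies in [C] and is far from [T x], then
    [T x] is outside [C], an event covered by [plan_stability].  The bounded
    second moments of both terms upgrade this to convergence in mean, and Jensen's
    inequality passes to the barycentric projection. *)
Lemma barycenter_L1_cvg :
  n%:R^-1 * \sum_(i < n) \sum_j `|T_ n (x i) 0 j - T (x i) 0 j| @[n --> \oo] --> 0.
Proof.
have [Lg ev] := eventually_plan.
pose G n A := wsum (Lg n).1 (Lg n).2 \1_A.
pose supp n := [set l | l \in (Lg n).1 /\ 0 < (Lg n).2 l].
have plG : \forall n \near \oo, cyc_monotone (supp n) /\ plan_like (G n) (supp n).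
  apply: filterS ev => n [n0 [g0 [f1 f2] cm _ _]]; split => //.
  have one : wsum (Lg n).1 (Lg n).2 (fun=> 1) = 1.
    by rewrite (f1 (fun=> 1)) sumr_const card_ord mulVf// pnatr_eq0 -lt0n.
  exact: wsum_plan_like.
have fstG A : \forall n \near \oo, (\sum_(i < n) \1_A (x i)) / n%:R = G n (A `*` setT).
  apply: filterS ev => n [n0 [g0 [f1 f2] cm _ _]].
  rewrite mulrC -(f1 \1_A); apply: eq_bigr => l _; congr (_ * _); apply: eq_indic.
  by split => [Al|[]].
have sndG A : \forall n \near \oo, \sum_(i < n) (w i / \sum_(j < n) w j) * \1_A (x i) = G n (setT `*` A).
  apply: filterS ev => n [n0 [g0 [f1 f2] cm _ _]].
  rewrite -(f2 \1_A); apply: eq_bigr => l _; congr (_ * _); apply: eq_indic.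
  by split => [Al|[]].
have G2 s : G n (setT `*` cboxes s) @[n --> \oo] --> pr nu (cboxes s).
  by apply: (cvg_trans (near_eq_cvg (sndG (cboxes s)))); exact: cvg_ratio.
have G1 s : G n ((setT `\` cboxes s) `*` setT) @[n --> \oo] --> pr mu (setT `\` cboxes s).
  by apply: (cvg_trans (near_eq_cvg (fstG (setT `\` cboxes s)))); exact: S1.
have G3 c s : G n (((T @^-1` ~` cbox c) `\` cboxes s) `*` setT) @[n --> \oo] -->
    pr mu ((T @^-1` ~` cbox c) `\` cboxes s).
  by apply: (cvg_trans (near_eq_cvg (fstG ((T @^-1` ~` cbox c) `\` cboxes s)))); exact: S3.
have stab c : G n ((T @^-1` ~` cbox c) `*` cbox c) @[n --> \oo] --> 0.
  by apply: (plan_stability nullmu mu2 nu2 tT T_optimal plG).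
(* convergence of y - T x to 0 in probability, coordinate by coordinate *)
have prob j (e h : R) : 0 < e -> 0 < h -> \forall n \near \oo,
    wsum (Lg n).1 (Lg n).2 (fun l => (e <= `|l.2 0 j - T l.1 0 j|)%R%:R) <= h.
  move=> e0 h0.
  have [k ke] : exists k : nat, 2 * k.+1%:R^-1 < e.
    exists (Num.truncn (2 / e)); rewrite ltr_pdivrMr// mulrC -ltr_pdivrMr//.
    exact: truncnS_gt.
  have h30 : 0 < h / 3 by rewrite divr_gt0.
  have [s [sk]] := cboxes_inner_pr nu [set c | c.2 = k] h30.
  rewrite -cbox_setT {1}/pr probability_setT/= => sh.
  have ev1 : \forall n \near \oo, \sum_(c <- s) G n ((T @^-1` ~` cbox c) `*` cbox c) < h / 3.
    have : \sum_(c <- s) G n ((T @^-1` ~` cbox c) `*` cbox c) @[n --> \oo] --> \sum_(c <- s) (0 : R).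
      by apply: cvg_sumr => c; exact: stab.
    by rewrite big1// => H; exact: cvgr_lt H _ h30.
  have ev2 : \forall n \near \oo, 1 - h / 3 - h / 3 < G n (setT `*` cboxes s).
    by apply: cvgr_gt (G2 s) _ _; lra.
  apply: filterS3 ev ev1 (filterI ev2 plG) => n [n0 [g0 [f1 f2] cm _ _]] e1 [e2 [_ [_ _ _ GT]]].
  apply: (@le_trans _ _ (wsum (Lg n).1 (Lg n).2 (fun l => (1 + - 1 * \1_(setT `*` cboxes s) l) +
     \sum_(c <- s) \1_((T @^-1` ~` cbox c) `*` cbox c) l))).
    apply: wsum_le => // l; case: (boolP (e <= _)%R) => [el|_]; last first.
      apply: addr_ge0; last exact: sumr_ge0.
      by rewrite indicE; case: (_ \in _); rewrite /= ?mulr1 ?mulr0 ?addr0// subrr.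
    have [sl|nsl] := pselect (cboxes s l.2); last first.
      have z : \1_(setT `*` cboxes s) l = 0 :> R by rewrite indicE memNset//= => -[].
      by rewrite z mulr0 addr0 lerDl sumr_ge0.
    have [[q k'] cs cl] := sl; have /= k'k := sk _ cs; rewrite {}k'k in cs cl.
    apply: (@le_trans _ _ (\sum_(c <- s) \1_((T @^-1` ~` cbox c) `*` cbox c) l)); last first.
      rewrite lerDr indicE; case: (_ \in _); rewrite /= ?mulr1 ?mulr0 ?addr0// subrr//.
    rewrite (big_rem (q, k))//= {1}indicE mem_set/=; last first.
      split => //= Tl; have := cbox_diam j cl Tl => h'.
      by have := lt_le_trans ke el; rewrite ltNge h'.
    by rewrite lerDl sumr_ge0.
  rewrite wsumD wsumD wsumZ wsum_sum.
  have -> : wsum (Lg n).1 (Lg n).2 (fun=> 1) = 1.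
    by rewrite -[RHS]GT; apply: eq_bigr => l _; rewrite indicT.
  move: e1 e2; rewrite /G; lra.
have tj j : wsum (Lg n).1 (Lg n).2 (fun l => `|l.2 0 j - T l.1 0 j|) @[n --> \oo] --> 0.
  apply/cvgrPdist_lt => /= eta eta0.
  have m20 : 0 <= m2.
    apply: (cvgr_to_ge S5); apply: nearW => n; rewrite divr_ge0// sumr_ge0// => i _.
    exact: sqdist_ge0.
  (* the second moment of [y - T x] is at most [4 (m2 + 1)] eventually; this [K]
     makes the last term of [markov_linear] at most [eta / 4] *)
  pose K := 16 * (m2 + 1) / eta.
  have K0 : 0 < K by rewrite divr_gt0// mulr_gt0//; lra.
  have e40 : 0 < eta / 4 by rewrite divr_gt0.
  have h0 : 0 < eta / 4 / K by rewrite divr_gt0.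
  have ev1 := prob j _ _ e40 h0.
  have ev2 : \forall n \near \oo, \sum_(i < n) (w i / \sum_(j < n) w j) * sqdist (x i) 0 < m2 + 1.
    by apply: cvgr_lt (barycenter_L2_bound.1) _ _; lra.
  have ev3 : \forall n \near \oo, (\sum_(i < n) sqdist (T (x i)) 0) / n%:R < m2 + 1.
    by apply: cvgr_lt S5 _ _; lra.
  apply: filterS3 ev ev1 (filterI ev2 ev3) => n [n0 [g0 [f1 f2] cm _ _]] e1 [e2 e3].
  rewrite sub0r normrN ger0_norm; last by apply: wsum_ge0.
  apply: (@le_lt_trans _ _ (wsum (Lg n).1 (Lg n).2 (fun l => (eta / 4 +
     K * (eta / 4 <= `|l.2 0 j - T l.1 0 j|)%R%:R) + K^-1 * (2 * sqdist l.2 0 + 2 * sqdist (T l.1) 0)))).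
    apply: wsum_le => // l; apply: le_trans (markov_linear (normr_ge0 _) (ltW e40) K0) _.
    rewrite lerD2l ler_wpM2l// ?invr_ge0 ?(ltW K0)//.
    have coord (u : E) : (u 0 j) ^+ 2 <= sqdist u 0.
      by rewrite sqdist0E (bigD1 j)//= lerDl sumr_ge0// => i _; exact: sqr_ge0.
    have := coord l.2; have := coord (T l.1).
    rewrite real_normK ?num_real//.
    have := sqr_ge0 (l.2 0 j + T l.1 0 j).
    move: (l.2 0 j) (T l.1 0 j) (sqdist _ _) (sqdist _ _) => a b A B h1 h2 h3.
    have e' : (a - b) ^+ 2 = 2 * a ^+ 2 + 2 * b ^+ 2 - (a + b) ^+ 2 by ring.
    lra.
  rewrite (wsumD _ _ (fun l : E * E => eta / 4 + K * (eta / 4 <= `|l.2 0 j - T l.1 0 j|)%R%:R)).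
  rewrite (wsumD _ _ (fun=> eta / 4)) (wsumZ _ _ K) (wsumZ _ _ K^-1).
  rewrite (wsumD _ _ (fun l : E * E => 2 * sqdist l.2 0)) !(wsumZ _ _ 2).
  have -> : wsum (Lg n).1 (Lg n).2 (fun=> eta / 4) = eta / 4.
    by rewrite (f1 (fun=> eta / 4)) sumr_const card_ord -[(eta / 4) *+ n]mulr_natl mulKf// pnatr_eq0 -lt0n.
  rewrite (f2 (fun u => sqdist u 0)) (f1 (fun u => sqdist (T u) 0)).
  rewrite mulrC in e3.
  have q1 : K * wsum (Lg n).1 (Lg n).2 (fun l => (eta / 4 <= `|l.2 0 j - T l.1 0 j|)%R%:R) <= eta / 4.
    by rewrite mulrC -ler_pdivlMr.
  have q2 : K^-1 * (2 * \sum_(i < n) (w i / \sum_(j < n) w j) * sqdist (x i) 0 +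
      2 * (n%:R^-1 * \sum_(i < n) sqdist (T (x i)) 0)) <= eta / 4.
    rewrite mulrC ler_pdivrMr// /K.
    have -> : eta / 4 * (16 * (m2 + 1) / eta) = 4 * (m2 + 1) by field; rewrite gt_eqF.
    lra.
  lra.
have : \sum_j wsum (Lg n).1 (Lg n).2 (fun l => `|l.2 0 j - T l.1 0 j|) @[n --> \oo] --> \sum_(j < d) (0 : R).
  by apply: cvg_sumr => j; exact: tj.
rewrite big1// => H; apply: (squeeze_cvgr _ (cvg_cst 0) H).
apply: filterS ev => n [n0 [g0 _ _ bd _]]; apply/andP; split.
  by rewrite mulr_ge0 ?invr_ge0// sumr_ge0// => i _; exact: sumr_ge0.
rewrite exchange_big/= mulr_sumr; apply: ler_sum => j _.
exact: (bd j (fun u => T u 0 j)).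
Qed.

Let y n i := T_ n (x i).

(** A point [T (x i)] in an inner box union that [T_ n] moves out of [U] is moved by
    at least the margin [r], and [barycenter_L1_cvg] bounds the proportion of such
    indices. *)
Lemma barycenter_open_liminf U : open U -> forall e : R, 0 < e ->
  \forall n \near \oo, pr nu U - e <= av y n \1_U.
Proof.
move=> oU e e0.
have e40 : 0 < e / 4 by rewrite divr_gt0.
have [s [sU le]] := cboxes_inner_open nu oU e40.
have [r r0 Hr] := compact_open_margin (@cboxes_compact R d s) oU sU.
have er0 : 0 < e / 4 * r by rewrite mulr_gt0.
have ev1 : \forall n \near \oo, pr nu (cboxes s) - e / 4 < (\sum_(i < n) \1_(cboxes s) (T (x i))) / n%:R.
  by apply: cvgr_gt (@S6 s) _ _; lra.
have ev2 : \forall n \near \oo,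
    n%:R^-1 * \sum_(i < n) \sum_j `|T_ n (x i) 0 j - T (x i) 0 j| < e / 4 * r.
  exact: cvgr_lt barycenter_L1_cvg _ er0.
apply: filterS2 ev1 ev2 => n e1 e2.
have key : n%:R^-1 * \sum_(i < n) \1_(cboxes s) (T (x i)) <=
    av y n \1_U + r^-1 * (n%:R^-1 * \sum_(i < n) \sum_j `|T_ n (x i) 0 j - T (x i) 0 j|).
  rewrite /av mulrCA -mulrDr ler_wpM2l ?invr_ge0// mulr_sumr -big_split/=.
  apply: ler_sum => i _.
  have s0 : 0 <= \sum_j `|T_ n (x i) 0 j - T (x i) 0 j| by exact: sumr_ge0.
  have rs0 : 0 <= r^-1 * \sum_j `|T_ n (x i) 0 j - T (x i) 0 j|.
    by rewrite mulr_ge0// invr_ge0 ltW.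
  have [sT|nsT] := pselect (cboxes s (T (x i))); last first.
    by rewrite [leLHS]indicE memNset// addr_ge0// indicE.
  have [Uy|nUy] := pselect (U (y n i)).
    by rewrite !indicE !mem_set// lerDl.
  rewrite [leLHS]indicE mem_set// indicE memNset// add0r mulrC ler_pdivlMr// mul1r leNgt.
  apply/negP => lt; apply: nUy; apply: (Hr (T (x i))) => // j.
  rewrite distrC; apply: le_lt_trans lt.
  by rewrite (bigD1 j)//= lerDl sumr_ge0.
have q : r^-1 * (n%:R^-1 * \sum_(i < n) \sum_j `|T_ n (x i) 0 j - T (x i) 0 j|) <= e / 4.
  by rewrite mulrC ler_pdivrMr// ltW.
rewrite mulrC in e1; lra.
Qed.

Lemma integral_empirical (z : nat -> E) n (f : E -> R) : measurable_fun setT f ->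
  (\int[empirical_measure z n]_u (f u)%:E = (n%:R^-1 * \sum_(i < n) f (z i))%:E)%E.
Proof.
move=> mf.
have E1 g : wsum [seq z i | i <- iota 0 n] (fun=> n%:R^-1) g = n%:R^-1 * \sum_(i < n) g (z i).
  by rewrite /wsum big_map -mulr_sumr -[in iota _ _](subn0 n) -/(index_iota 0 n) big_mkord.
rewrite -E1; apply: integral_wsum_signed => //.
  by move=> A mA; rewrite empirical_measureE E1.
Qed.

Lemma pushforward_empirical n :
  pushforward (empirical_measure x n) (T_ n) = empirical_measure (y n) n.
Proof.
apply/funext => A; rewrite /pushforward !empirical_measureE.
by congr EFin; congr (_ * _); apply: eq_bigr => i _; apply: eq_indic.
Qed.

Lemma barycenter_weakly_cvg :
  weakly_cvg (fun n => pushforward (empirical_measure x n) (T_ n)) (pushforward mu T).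
Proof.
move=> f cf [M fM]; have mf := continuous_measurable_rV cf.
have -> : (\int[pushforward mu T]_u (f u)%:E = \int[nu]_u (f u)%:E)%E.
  have [mT TE] := tT.
  pose TM : {mfun E >-> E} := HB.pack T (isMeasurableFun.Build _ _ _ _ _ mT).
  transitivity (\int[distribution mu TM]_u (f u)%:E)%E; first by [].
  by apply: eq_measure_integral => A mA _; exact: TE.
have -> : (fun n => \int[pushforward (empirical_measure x n) (T_ n)]_u (f u)%:E)%E =
    (fun n => (av y n f)%:E).
  by apply/funext => n; rewrite pushforward_empirical integral_empirical.
exact: (portmanteau barycenter_open_liminf cf fM).
Qed.

Hypothesis m2E : (\int[nu]_u (sqdist u 0)%:E = m2%:E)%E.

Lemma Lnorm_enorm (m : {measure set E -> \bar R}) (S : E -> E) (b : R) :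
  (\int[m]_u (sqdist (S u) 0)%:E = b%:E)%E ->
  Lnorm m 2%:E (fun z => (enorm (S z))%:E) = (Num.sqrt b)%:E.
Proof.
move=> Sb; rewrite unlock /Lnorm.
have -> : (\int[m]_z (`|(enorm (S z))%:E| `^ 2) = b%:E)%E.
  rewrite -Sb; apply: eq_integral => u _ /=.
  by rewrite ger0_norm ?sqrtr_ge0// powR_mulrn ?sqrtr_ge0// sqdistx0.
have b0 : 0 <= b.
  by rewrite -lee_fin -Sb integral_ge0// => u _; rewrite lee_fin sqdist_ge0.
by rewrite poweR_EFin powR12_sqrt.
Qed.

(** The integral of a kernel is measurable for nonnegative integrands; hence the
    split into positive and negative parts. *)
Lemma measurable_barycentric_projection n : measurable_fun setT (T_ n).
Proof.
apply: measurable_fun_mx => i j; under eq_fun do rewrite mxE.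
pose fp (u : E) := Num.max (u 0 j) 0; pose fm (u : E) := Num.max (- u 0 j) 0.
have mj : measurable_fun setT (fun u : E => u 0 j) by exact: measurable_coord.
have mfp : measurable_fun setT fp by apply: measurable_maxr.
have mfm : measurable_fun setT fm by apply: measurable_maxr => //; exact: measurableT_comp.
apply: measurableT_comp; first by [].
have E1 u : (\int[kappa n u]_v (v 0 j)%:E =
    \int[kappa n u]_v (fp v)%:E - \int[kappa n u]_v (fm v)%:E)%E.
  rewrite integralE; congr (_ - _)%E; apply: eq_integral => v _.
    by rewrite funeposE /fp /= EFin_max.
  by rewrite funenegE /fm /= EFin_max EFinN.
under eq_fun do rewrite E1.
apply: emeasurable_funB; apply: measurable_fun_integral_kernel.
- by move=> A mA; exact: measurable_kernel.
- by move=> v; rewrite lee_fin le_max lexx orbT.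
- exact/measurable_EFinP.
- by move=> A mA; exact: measurable_kernel.
- by move=> v; rewrite lee_fin le_max lexx orbT.
- exact/measurable_EFinP.
Qed.

Lemma barycenter_limsup :
  (limn_esup (fun n => Lnorm (empirical_measure x n) 2%:E (fun z => (enorm (T_ n z))%:E))
   <= Lnorm mu 2%:E (fun z => (enorm (T z))%:E))%E.
Proof.
have [cvb leb] := barycenter_L2_bound.
have m20 : 0 <= m2.
  by rewrite -lee_fin -m2E integral_ge0// => u _; rewrite lee_fin sqdist_ge0.
have msq : measurable_fun setT (fun u : E => sqdist u 0) by apply: measurable_sqdist.
rewrite (@Lnorm_enorm mu T m2); last first.
  rewrite -m2E; apply: (integral_transport (k := fun u => (sqdist u 0)%:E) tT).
    exact/measurable_EFinP.
  by move=> u; rewrite lee_fin sqdist_ge0.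
have LnE n : Lnorm (empirical_measure x n) 2%:E (fun z => (enorm (T_ n z))%:E) =
    (Num.sqrt (n%:R^-1 * \sum_(i < n) sqdist (T_ n (x i)) 0))%:E.
  apply: Lnorm_enorm; apply: (integral_empirical x n (f := fun u => sqdist (T_ n u) 0)).
  by apply: measurable_sqdist => //; exact: measurable_barycentric_projection.
apply/lee_addgt0Pr => e e0; rewrite -EFinD /limn_esup limf_esupE.
pose b n := \sum_(i < n) (w i / \sum_(j < n) w j) * sqdist (x i) 0.
have cvs : Num.sqrt (b n) @[n --> \oo] --> Num.sqrt m2.
  by apply: (cvg_comp b Num.sqrt cvb); exact: sqrt_continuous.
have ev : \forall n \near \oo, Num.sqrt (b n) < Num.sqrt m2 + e.
  by apply: cvgr_lt cvs _ _; rewrite ltrDl.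
have ev2 : \forall n \near \oo, (Lnorm (empirical_measure x n) 2%:E (fun z => (enorm (T_ n z))%:E)
    <= (Num.sqrt m2 + e)%:E)%E.
  apply: filterS2 ev leb => n e1 e2; rewrite LnE lee_fin (le_trans _ (ltW e1))//.
  exact: ler_wsqrtr.
case: ev2 => N _ HN.
apply: (@le_trans _ _ (ereal_sup ((fun n => Lnorm (empirical_measure x n) 2%:E (fun z => (enorm (T_ n z))%:E)) @` [set n | (N <= n)%N]))).
  apply: ereal_inf_lbound; exists [set n | (N <= n)%N] => //.
  by exists N.
by apply: ub_ereal_sup => _ [n /= Nn <-]; exact: HN.
Qed.

End sample_convergence.

(** * Importance weights *)

Section density.
Context {d : measure_display} {T : measurableType d} {R : realType}.
Variables (l m : {measure set T -> \bar R}) (h : T -> R).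
Hypotheses (mh : measurable_fun setT h) (h0 : forall x, 0 <= h x).
Hypothesis mE : forall A, measurable A -> m A = (\int[l]_(x in A) (h x)%:E)%E.

Import HBNNSimple.

(** True for indicators by hypothesis, hence for simple functions, hence in general
    by monotone convergence. *)
Lemma integral_density (f : T -> R) : measurable_fun setT f ->
  (forall x, 0 <= f x) -> (\int[m]_x (f x)%:E = \int[l]_x (f x * h x)%:E)%E.
Proof.
move=> mf f0; have mf' : measurable_fun setT (EFin \o f) by exact/measurable_EFinP.
pose s := nnsfun_approx measurableT mf'.
have s_cvg x : (s n x)%:E @[n --> \oo] --> (f x)%:E.
  by apply: (@cvg_nnsfun_approx _ _ _ setT measurableT _ mf') => // y _; rewrite lee_fin.
have s_nd x a b : (a <= b)%N -> s a x <= s b x.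
  by move=> ab; exact/lefP/nd_nnsfun_approx.
have -> : (\int[m]_x (f x)%:E = lim (\int[m]_x (s n x)%:E @[n --> \oo]))%E.
  under eq_integral => x _ do rewrite -(cvg_lim _ (s_cvg x))//.
  apply: monotone_convergence => //.
  - by move=> n; exact/measurable_EFinP/measurable_funP.
  - by move=> n x _; rewrite lee_fin.
  - by move=> x _ a b ab; rewrite lee_fin s_nd.
have -> : (\int[l]_x (f x * h x)%:E = lim (\int[l]_x (s n x * h x)%:E @[n --> \oo]))%E.
  have sh x : (s n x * h x)%:E @[n --> \oo] --> (f x * h x)%:E.
    under eq_fun do rewrite EFinM.
    by rewrite EFinM; apply: cvgeZr => //; exact: s_cvg.
  under eq_integral => x _ do rewrite -(cvg_lim _ (sh x))//.
  apply: monotone_convergence => //.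
  - by move=> n; apply/measurable_EFinP; apply: measurable_funM => //; exact/measurable_funP.
  - by move=> n x _; rewrite lee_fin mulr_ge0.
  - by move=> x _ a b ab; rewrite lee_fin ler_wpM2r ?s_nd.
suff su n : (\int[m]_x (s n x)%:E = \int[l]_x (s n x * h x)%:E)%E.
  by under eq_fun do rewrite su.
have mi r : measurable_fun setT (fun x => \1_(s n @^-1` [set r]) x * h x).
  by apply: measurable_funM => //; exact: measurable_indic.
have i0 r x : 0 <= \1_(s n @^-1` [set r]) x * h x by rewrite mulr_ge0// indicE.
transitivity (\sum_(r \in range (s n)) (r%:E * m (s n @^-1` [set r])))%E.
  by rewrite integralT_nnsfun sintegralE.
transitivity (\int[l]_x (\sum_(r \in range (s n))
    (r * (\1_(s n @^-1` [set r]) x * h x))%:E))%E; last first.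
  apply: eq_integral => x _.
  rewrite fsumEFin//; congr EFin; rewrite [in RHS](fimfunE (s n) x).
  rewrite mulr_fsuml; apply: eq_fsbigr => r _; exact: mulrA.
rewrite (@ge0_integral_fsum _ _ _ _ _ measurableT)//.
- apply: eq_fsbigr => r; rewrite inE => -[y _ <-].
  rewrite ge0_integral_EFinZ// mE//; congr (_ * _)%E.
  rewrite integral_mkcond; apply: eq_integral => x _.
  by rewrite patchE indicE; case: ifPn; rewrite ?mul1r ?mul0r.
- by move=> r; apply/measurable_EFinP; exact: measurable_funM.
- move=> r x _; have := nnfun_muleindic_ge0 (s n) r x.
  by rewrite mulrA EFinM !lee_fin => ?; rewrite mulr_ge0.
Qed.

End density.

Section importance_weights.
Context {R : realType} {d : nat}.
Local Notation E := 'rV[R]_d.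
Variables (mu nu : probability E R) (p q : E -> R).
Hypotheses (mup : unnormalized_density mu p) (nuq : unnormalized_density nu q).
Hypothesis pq0 : forall z, p z = 0 -> q z = 0.

Lemma density_ratio_ge0 x : 0 <= q x / p x.
Proof. by case: mup nuq => _ p0 _ [_ q0 _]; rewrite divr_ge0. Qed.

(** The power function with exponent -1 agrees with the inverse on nonnegative
    numbers, 0 included, and is measurable. *)
Lemma measurable_density_ratio : measurable_fun setT (fun x => q x / p x).
Proof.
case: mup nuq => mp p0 _ [mq _ _].
under eq_fun do rewrite -(powR_inv1 (p0 _)).
apply: measurable_funM => //.
exact: (measurableT_comp (measurable_powR (-1))).
Qed.

(** If [mu] has density [a p] and [nu] has density [b q], then [(q / p) mu] has
    density [a q] (where [p] vanishes so does [q]), that is, it is [(a / b) nu]. *)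
Lemma integral_density_ratio : exists2 c : R, 0 < c &
  forall f : E -> R, measurable_fun setT f -> (forall x, 0 <= f x) ->
    (\int[mu]_x (q x / p x * f x)%:E = c%:E * \int[nu]_x (f x)%:E)%E.
Proof.
case: mup nuq => mp p0 [a a0 muE] [mq q0 [b b0 nuE]].
exists (a / b); first by rewrite divr_gt0.
move=> f mf f0; have mw := measurable_density_ratio.
have ma : measurable_fun setT (fun x => a * p x) by exact: measurable_funM.
have mb : measurable_fun setT (fun x => b * q x) by exact: measurable_funM.
rewrite (integral_density ma _ muE); last 3 first.
- by move=> x; rewrite mulr_ge0 // ltW.
- exact: measurable_funM.
- by move=> x; rewrite mulr_ge0// density_ratio_ge0.
rewrite (integral_density mb _ nuE)//; last by move=> x; rewrite mulr_ge0 // ltW.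
rewrite -ge0_integral_EFinZ//; last 3 first.
- exact: measurable_funM.
- by move=> x; rewrite !mulr_ge0 // ltW.
- by rewrite divr_ge0// ltW.
apply: eq_integral => x _; congr EFin.
have [px0|px0] := eqVneq (p x) 0; first by rewrite px0 (pq0 px0) !(mul0r, mulr0).
by field; rewrite px0 gt_eqF.
Qed.

End importance_weights.

(** * Convergence along almost every sample *)

Section strong_law.
Context {R : realType} {d : nat} {dO : measure_display} {Omega : measurableType dO}.
Local Notation E := 'rV[R]_d.
Variables (mu : probability E R) (P : probability Omega R) (X : nat -> {RV P >-> E}).
Hypothesis indep : mutually_independent X.
Hypothesis lawX : forall i A, measurable A -> distribution P (X i) A = mu A.

Lemma slln_countable (I : countType) (g : I -> E -> R) (m : I -> R) :
  (forall k, measurable_fun setT (g k)) -> (forall k x, 0 <= g k x) ->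
  (forall k, (\int[mu]_x (g k x)%:E = (m k)%:E)%E) ->
  {ae P, forall o k, (\sum_(i < n) g k (X i o)) / n%:R @[n --> \oo] --> m k}.
Proof.
move=> mg g0 gm.
have H (j : nat) : {ae P, forall o, forall k, choice.unpickle j = Some k ->
    (\sum_(i < n) g k (X i o)) / n%:R @[n --> \oo] --> m k}.
  case E : (choice.unpickle j) => [k|]; last by apply: aeW => o k.
  by apply: filterS (slln indep lawX (mg k) (g0 k) (gm k)) => o ? _ [<-].
move/ae_foralln : H; apply: filterS => o Ho k.
by apply: (Ho (choice.pickle k)); exact: choice.pickleK.
Qed.

Lemma slln_sets (I : countType) (A : I -> set E) : (forall k, measurable (A k)) ->
  {ae P, forall o k, (\sum_(i < n) \1_(A k) (X i o)) / n%:R @[n --> \oo] --> pr mu (A k)}.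
Proof.
move=> mA; apply: (@slln_countable I (fun k => \1_(A k))).
- by move=> k; exact: measurable_indic.
- by move=> k x; rewrite indicE.
- by move=> k; rewrite integral_indic// setIT; exact: prE.
Qed.

End strong_law.

Theorem proposition5p1 (R : realType) (d : nat)
    (mu nu : probability 'rV[R]_d R) (p q : 'rV[R]_d -> R)
    (T : 'rV[R]_d -> 'rV[R]_d)
    (dO : measure_display) (Omega : measurableType dO)
    (P : probability Omega R) (X : nat -> {RV P >-> 'rV[R]_d})
    (gamma : nat -> Omega -> probability ('rV[R]_d * 'rV[R]_d)%type R)
    (kappa : nat -> Omega -> R.-pker 'rV[R]_d ~> 'rV[R]_d) :
  let x omega i := X i omega in
  let w omega i := q (x omega i) / p (x omega i) in
  let mu_ omega n := empirical_measure (x omega) n in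
  let nu_ omega n := weighted_empirical_measure (w omega) (x omega) n in
  let T_ omega n := barycentric_projection (kappa n omega) in
  finite_second_moment mu ->
  finite_second_moment nu ->
  unnormalized_density mu p ->
  unnormalized_density nu q ->
  (forall z, p z = 0 -> q z = 0) ->
  monge_map mu nu T ->
  mutually_independent X ->
  (forall i A, measurable A -> distribution P (X i) A = mu A) ->
  {ae P, forall omega, forall n, 0 < \sum_(i < n) w omega i ->
     optimal_plan (mu_ omega n) (nu_ omega n) (gamma n omega) /\
     conditional_distribution (gamma n omega) (kappa n omega)} ->
  (forall A, measurable A -> pushforward mu T A = nu A) /\
  {ae P, forall omega,
     weakly_cvg (fun n => pushforward (mu_ omega n) (T_ omega n))
                (pushforward mu T) /\
     (limn_esup (fun n =>
        Lnorm (mu_ omega n) 2%:E (fun z => (enorm (T_ omega n z))%:E))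
      <= Lnorm mu 2%:E (fun z => (enorm (T z))%:E))%E}.
Proof.
move=> x w mu_ nu_ T_ mu2 nu2 mup nuq pq0 [tT T_min] indep lawX plan.
split; first exact: tT.2.
have T_optimal S : transport_map mu nu S ->
    (\int[mu]_x (sqdist x (T x))%:E <= \int[mu]_x (sqdist x (S x))%:E)%E.
  move=> tS.
  under eq_integral do rewrite -sqdistE.
  under [leRHS]eq_integral do rewrite -sqdistE.
  rewrite -/(monge_cost mu T) T_min; apply: ereal_inf_lbound; by exists S.
have msq y : measurable_fun setT (fun u : 'rV[R]_d => sqdist u y) by exact: measurable_sqdist.
have sq0 (u v : 'rV[R]_d) : 0 <= sqdist u v by rewrite -sqdistE exprn_ge0// sqrtr_ge0.
pose m2 := fine (\int[nu]_u (sqdist u 0)%:E).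
have m2E : (\int[nu]_u (sqdist u 0)%:E)%E = m2%:E.
  rewrite fineK// ge0_fin_numE; first exact: second_moment_sqdist.
  by apply: integral_ge0 => u _; rewrite lee_fin.
have [c0 c0_gt0 wE] := integral_density_ratio mup nuq pq0.
have mw := measurable_density_ratio mup nuq.
have w0 := density_ratio_ge0 mup nuq.
pose code : countType := ('rV[rat]_d * nat)%type.
have mT : measurable_fun setT T := tT.1.
have mTpre A : measurable A -> measurable (T @^-1` A).
  by move=> mA; rewrite -[X in measurable X]setTI; exact: mT.
have nu1 : (\int[nu]_z (1 : R)%:E = 1)%E.
  by have := integral_cst nu measurableT (1 : R)%:E; rewrite /= probability_setT mule1.
have int_boxes s : (\int[nu]_z (\1_(cboxes s) z : R)%:E = (pr nu (cboxes s))%:E)%E.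
  rewrite integral_indic// ?setIT; last exact: measurable_cboxes.
  by apply: prE; exact: measurable_cboxes.
have s0 : {ae P, forall o, (\sum_(i < n) w o i) / n%:R @[n --> \oo] --> c0}.
  apply: (slln indep lawX mw w0).
  under eq_integral do rewrite -[q _ / _]mulr1.
  by rewrite (wE (cst 1))// /cst/= nu1 mule1.
have s1 := slln_sets indep lawX (A := fun s : seq code => setT `\` cboxes s)
  (fun s => measurableD measurableT (measurable_cboxes s)).
have s2 : {ae P, forall o (s : seq code),
    (\sum_(i < n) w o i * \1_(cboxes s) (x o i)) / n%:R @[n --> \oo]
      --> c0 * pr nu (cboxes s)}.
  apply: (slln_countable indep lawX
    (g := fun s z => q z / p z * \1_(cboxes s) z)) => [s|s z|s].
  - by apply: measurable_funM => //; apply: measurable_indic; exact: measurable_cboxes.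
  - by rewrite mulr_ge0// indicE.
  - rewrite wE; [by rewrite int_boxes EFinM|
      by apply: measurable_indic; exact: measurable_cboxes|by move=> z; rewrite indicE].
have s3 := slln_sets indep lawX
  (A := fun cs : code * seq code => (T @^-1` ~` cbox cs.1) `\` cboxes cs.2)
  (fun cs => measurableD (mTpre _ (measurableC (measurable_cbox cs.1)))
                         (measurable_cboxes cs.2)).
have s4 : {ae P, forall o, (\sum_(i < n) w o i * sqdist (x o i) 0) / n%:R @[n --> \oo]
    --> c0 * m2}.
  apply: (slln indep lawX (g := fun z => q z / p z * sqdist z 0)).
  - exact: measurable_funM.
  - by move=> z; rewrite mulr_ge0.
  - by rewrite wE// m2E EFinM.
have s5 : {ae P, forall o, (\sum_(i < n) sqdist (T (x o i)) 0) / n%:R @[n --> \oo] --> m2}.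
  apply: (slln indep lawX (g := fun z => sqdist (T z) 0)) => //.
  - exact: (measurableT_comp (msq 0)).
  - rewrite (integral_transport tT (k := fun u => (sqdist u 0)%:E))//.
      exact/measurable_EFinP.
    by move=> u; rewrite lee_fin.
have s6 : {ae P, forall o (s : seq code),
    (\sum_(i < n) \1_(cboxes s) (T (x o i))) / n%:R @[n --> \oo] --> pr nu (cboxes s)}.
  apply: (slln_countable indep lawX (g := fun s z => \1_(cboxes s) (T z))) => [s|s z|s].
  - apply: (measurableT_comp _ mT).
    by apply: measurable_indic; exact: measurable_cboxes.
  - by rewrite indicE.
  - rewrite (integral_transport tT (k := fun u => (\1_(cboxes s) u)%:E))//.
      by apply/measurable_EFinP; apply: measurable_indic; exact: measurable_cboxes.
apply: filterS (filterI plan (filterI s0 (filterI s1 (filterI s2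
  (filterI s3 (filterI s4 (filterI s5 s6))))))).
move=> o [plan_o [h0 [h1 [h2 [h3 [h4 [h5 h6]]]]]]]; split.
- exact: (barycenter_weakly_cvg (density_line_null mup) mu2 nu2 tT T_optimal
    plan_o c0_gt0 h0 h1 h2 (fun c s => h3 (c, s)) h4 h5 h6).
- exact: (barycenter_limsup tT plan_o c0_gt0 h0 h4 m2E).
Qed.
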